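(* For all $(\tau_1,\tau_2,\tau_3)\in[0,1]^3$, the semigroup $S_1(t)=e^{t\mathbb{B}_1}$ on $\mathbb{H}_1$ is exponentially stable, i.e. there exist constants $M\ge 1$ and $\omega>0$ such that $\|S_1(t)\|_{\mathcal{L}(\mathbb{H}_1)}\le Me^{-\omega t}$ for all $t\ge 0$.
   Context: Let $l>0$ and let $\rho_1,\dots,\rho_5,\kappa_1,\kappa_2,b_1,b_2,\jmath,\gamma_1,\gamma_2,\gamma_3,\delta,\beta,K$ be positive constants; let $\tau_1,\tau_2,\tau_3\in[0,1]$. $\langle\cdot,\cdot\rangle$ and $\|\cdot\|$ denote the inner product and norm of the complex space $L^2(0,l)$. $A=-\partial_{xx}$ with domain $\mathfrak{D}(A)=H^2(0,l)\cap H^1_0(0,l)$, a strictly positive self-adjoint operator in $L^2(0,l)$; $A^\sigma$, $\sigma\in\mathbb{R}$, are its fractional powers, $\mathfrak{D}(A^\sigma)$ carries the norm $\|A^\sigma\cdot\|$ (completion of $L^2(0,l)$ if $\sigma<0$, and $A^\sigma$ is extended accordingly to this scale); $\mathfrak{D}(A^0)=L^2(0,l)$, $\mathfrak{D}(A^{1/2})=H^1_0(0,l)$, $\mathfrak{D}(A^{-1/2})=H^{-1}(0,l)$. Phase space: $\mathbb{H}_1=[\mathfrak{D}(A^{1/2})\times\mathfrak{D}(A^0)]^4\times\mathfrak{D}(A^{1/2})$, with elements $U=(\varphi,u,\psi,v,y,s,z,w,\theta)^T$ and the Hilbert norm (induced by the corresponding inner product) $$\|U\|_{\mathbb{H}_1}^2=\rho_1\|u\|^2+\rho_2\|v\|^2+\rho_3\|s\|^2+\rho_4\|w\|^2+b_1\|A^{1/2}\psi\|^2+b_2\|A^{1/2}z\|^2+\kappa_1\|\varphi_x-\psi\|^2+\kappa_2\|y_x-z\|^2+\jmath\|y-\varphi\|^2+\tfrac{\rho_5\delta}{\beta}\|A^{1/2}\theta\|^2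 .$$ The operator $\mathbb{B}_1:\mathfrak{D}(\mathbb{B}_1)\subset\mathbb{H}_1\to\mathbb{H}_1$ maps $U$ to the vector with components, in order, $u$; $\ -\frac{\kappa_1}{\rho_1}A\varphi-\frac{\kappa_1}{\rho_1}\psi_x+\frac{\jmath}{\rho_1}(y-\varphi)-\frac{\gamma_1}{\rho_1}A^{\tau_1}u$; $\ v$; $\ -\frac{b_1}{\rho_2}A\psi+\frac{\kappa_1}{\rho_2}(\varphi_x-\psi)+\frac{\delta}{\rho_2}A\theta$; $\ s$; $\ -\frac{\kappa_2}{\rho_3}Ay-\frac{\kappa_2}{\rho_3}z_x-\frac{\jmath}{\rho_3}(y-\varphi)-\frac{\gamma_2}{\rho_3}A^{\tau_2}s$; $\ w$; $\ -\frac{b_2}{\rho_4}Az+\frac{\kappa_2}{\rho_4}(y_x-z)-\frac{\gamma_3}{\rho_4}A^{\tau_3}w$; $\ -\frac{K}{\rho_5}A\theta-\frac{\beta}{\rho_5}v$. Its domain is $$\mathfrak{D}(\mathbb{B}_1)=\{U\in\mathbb{H}_1:\ (u,v,s,w)\in[\mathfrak{D}(A^{1/2})]^4,\ \theta\in\mathfrak{D}(A^{1/2})\cap H^3(0,l),\ \varphi\in\mathfrak{D}(A)\cap\mathfrak{D}(A^{\tau_1}),\ \psi\in\mathfrak{D}(A),\ y\in\mathfrak{D}(A)\cap\mathfrak{D}(A^{\tau_2}),\ z\in\mathfrak{D}(A)\cap\mathfrak{D}(A^{\tau_3})\}.$$ $S_1(t)=e^{t\mathbb{B}_1}$ denotes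 the $C_0$-semigroup of contractions generated by $\mathbb{B}_1$ on $\mathbb{H}_1$. It is the first-order form of the Timoshenko double wall carbon nanotube system coupled with the heat equation, with $\varphi_t=u$, $\psi_t=v$, $y_t=s$, $z_t=w$ and homogeneous Dirichlet boundary conditions.
   Formalization: The printed domain does not map into H_1 and, if some tau_i>1/2, yields no closed operator; the domain is taken with the added conditions u, s, w in D(A^{tau_1}), D(A^{tau_2}), D(A^{tau_3}) and B_1U in H_1, and S_1 is the contraction semigroup generated by the closure of B_1. *)

(* Defs.v *)
From mathcomp Require Export all_boot all_order all_algebra.
From mathcomp.real_closed Require Export complex.
From mathcomp Require Export all_classical all_reals all_analysis.

Set Implicit Arguments.
Unset Strict Implicit.
Unset Printing Implicit Defensive.

Export Order.TTheory GRing.Theory Num.Theory.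
Export numFieldNormedType.Exports.

Local Open Scope classical_set_scope.
Local Open Scope ring_scope.
Local Open Scope complex_scope.

(** Elements of the complex Hilbert space L^2(0,l) are represented by functions
[R -> R[i]] of which only the restriction to ]0,l[, up to a.e. equality, matters:
[l2norm] is the norm of the class of the function, a seminorm on representatives. *)

(* Only meaningful when the real and imaginary parts of [f] are integrable, the
   real integrals defaulting to 0 otherwise. *)
Definition cintegral (R : realType) (l : R) (f : R -> R[i]) : R[i] :=
  (\int[lebesgue_measure]_(x in `]0, l[) complex.Re (f x))%R
  +i* (\int[lebesgue_measure]_(x in `]0, l[) complex.Im (f x))%R.

Definition sqmod (R : realType) (z : R[i]) : R :=
  complex.Re z ^+ 2 + complex.Im z ^+ 2.

Definition L2 (R : realType) (l : R) (f : R -> R[i]) : Prop :=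
  [/\ measurable_fun `]0, l[ (fun x => complex.Re (f x)),
      measurable_fun `]0, l[ (fun x => complex.Im (f x)) &
      (\int[lebesgue_measure]_(x in `]0%R, l[) (sqmod (f x))%:E < +oo)%E].

Definition inner (R : realType) (l : R) (f g : R -> R[i]) : R[i] :=
  cintegral l (fun x => f x * conjc (g x)).

Definition l2norm (R : realType) (l : R) (f : R -> R[i]) : R :=
  Num.sqrt (\int[lebesgue_measure]_(x in `]0, l[) sqmod (f x)).

(** Test functions are C^1 with compact support in ]0,l[ (as in Brezis, _Functional
Analysis, Sobolev Spaces and Partial Differential Equations_, Ch. 8); C^oo test
functions give the same weak derivatives and the same space H^1_0. *)

Definition C1c (R : realType) (l : R) (p : R -> R) : Prop :=
  [/\ forall x, derivable p x 1,
      continuous (derive1 p) &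
      exists a b : R,
        [/\ 0 < a, b < l & forall x, ~~ (a <= x <= b) -> p x = 0]].

Definition is_weak_derivative (R : realType) (l : R) (f g : R -> R[i]) : Prop :=
  L2 l g /\
  forall p, C1c l p ->
    cintegral l (fun x => f x * (derive1 p x)%:C) =
    - cintegral l (fun x => g x * (p x)%:C).

(* A representative of f_x, unique up to a.e. equality; junk value 0 when the
   weak derivative does not exist in L^2(0,l). *)
Definition dx (R : realType) (l : R) (f : R -> R[i]) : R -> R[i] :=
  xget (0 : R -> R[i]) [set g | is_weak_derivative l f g].

Fixpoint sobolev (R : realType) (l : R) (k : nat) (f : R -> R[i]) : Prop :=
  L2 l f /\
  if k is k'.+1 then exists g, is_weak_derivative l f g /\ sobolev l k' g
  else True.

(* H^1_0(0,l): closure in H^1(0,l) of the complex-valued test functions. *)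
Definition H10 (R : realType) (l : R) (f : R -> R[i]) : Prop :=
  sobolev l 1 f /\
  exists p : nat -> R -> R[i],
    (forall n, C1c l (fun x => complex.Re (p n x)) /\
               C1c l (fun x => complex.Im (p n x))) /\
    (fun n => l2norm l (f - p n) ^+ 2 + l2norm l (dx l (f - p n)) ^+ 2)
      @ \oo --> (0 : R).

Definition DA (R : realType) (l : R) (f : R -> R[i]) : Prop :=
  sobolev l 2 f /\ H10 l f.

Definition opA (R : realType) (l : R) (f : R -> R[i]) : R -> R[i] :=
  - dx l (dx l f).

(* [e] is an orthonormal basis of L^2(0,l) of eigenvectors of A, with
   eigenvalues [lam]. *)
Definition eigenbasis (R : realType) (l : R)
    (e : nat -> R -> R[i]) (lam : nat -> R) : Prop :=
  [/\ forall n, [/\ DA l (e n), 0 < lam n &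
        \forall x \ae (@lebesgue_measure R), x \in `]0, l[ ->
          opA l (e n) x = (lam n)%:C * e n x],
      forall m n, inner l (e m) (e n) = (m == n)%:R &
      forall f, L2 l f ->
        (fun N => l2norm l (f - \sum_(n < N) inner l f (e n) *: e n))
          @ \oo --> (0 : R)].

(* g = A^sigma f, by the spectral decomposition of A (which has compact
   resolvent): A^sigma f = \sum_n lam_n^sigma <f, e_n> e_n in L^2(0,l).  The
   sum does not depend on the eigenbasis. *)
Definition is_powA (R : realType) (l sigma : R) (f g : R -> R[i]) : Prop :=
  [/\ L2 l f, L2 l g &
      exists (e : nat -> R -> R[i]) (lam : nat -> R),
        eigenbasis l e lam /\
        (fun N => l2norm l (g -
            \sum_(n < N) ((lam n `^ sigma)%:C * inner l f (e n)) *: e n))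
          @ \oo --> (0 : R)].

(* For sigma >= 0, the domain of A^sigma as an operator in L^2(0,l). *)
Definition DpowA (R : realType) (l sigma : R) (f : R -> R[i]) : Prop :=
  exists g, is_powA l sigma f g.

Definition powA (R : realType) (l sigma : R) (f : R -> R[i]) : R -> R[i] :=
  xget (0 : R -> R[i]) [set g | is_powA l sigma f g].

(** The Banach space is given by a subspace [H] of a complex vector space [V] of
representatives, and a seminorm [N] on [H]; vectors [x], [y] with
[N (x - y) = 0] stand for the same element. *)

Definition contraction_semigroup (R : realType) (V : lmodType R[i])
    (H : set V) (N : V -> R) (S : R -> V -> V) : Prop :=
  [/\ forall t x, 0 <= t -> H x -> H (S t x),
      forall t (a : R[i]) x y, 0 <= t -> H x -> H y ->
        N (S t (a *: x + y) - (a *: S t x + S t y)) = 0,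
      (forall x, H x -> N (S 0 x - x) = 0) /\
      (forall s t x, 0 <= s -> 0 <= t -> H x ->
        N (S (s + t) x - S s (S t x)) = 0),
      forall x, H x -> N (S t x - x) @[t --> 0^'+] --> (0 : R) &
      forall t x, 0 <= t -> H x -> N (S t x) <= N x].

(* x is in the domain of the infinitesimal generator of S, which maps it to y. *)
Definition generator (R : realType) (V : lmodType R[i])
    (H : set V) (N : V -> R) (S : R -> V -> V) (x y : V) : Prop :=
  [/\ H x, H y &
      N ((t^-1)%:C *: (S t x - x) - y) @[t --> 0^'+] --> (0 : R)].

(* (x, y) is in the closure, in H x H, of the graph of B : D -> H. *)
Definition graph_closure (R : realType) (V : lmodType R[i])
    (H : set V) (N : V -> R) (D : set V) (B : V -> V) (x y : V) : Prop :=
  [/\ H x, H y &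
      forall eps : R, 0 < eps ->
        exists2 w, D w & N (x - w) < eps /\ N (y - B w) < eps].

(* S = e^{tB}: the generator of S is the closure of B (B itself when B is
   closed).  The closure matters for the operator [opB1] below, which is not
   closed on [DB1] when some tau_i > 1/2: its closure only requires
   kappa1 A phi + gamma1 A^tau1 u to be in L^2(0,l), and not each term. *)
Definition generated_by (R : realType) (V : lmodType R[i])
    (H : set V) (N : V -> R) (D : set V) (B : V -> V) (S : R -> V -> V) : Prop :=
  forall x y, generator H N S x y <-> graph_closure H N D B x y.

Definition opnorm (R : realType) (V : lmodType R[i])
    (H : set V) (N : V -> R) (T : V -> V) : \bar R :=
  ereal_sup [set (N (T x))%:E | x in [set x | H x /\ N x <= 1]].

Record params (R : realType) := Params {
  len : R;
  rho1 : R; rho2 : R; rho3 : R; rho4 : R; rho5 : R;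
  kappa1 : R; kappa2 : R;
  b1 : R; b2 : R;
  jm : R;
  gamma1 : R; gamma2 : R; gamma3 : R;
  delta : R; beta : R; K : R }.

Definition params_pos (R : realType) (c : params R) : Prop :=
  0 < len c /\
  [/\ 0 < rho1 c, 0 < rho2 c, 0 < rho3 c, 0 < rho4 c & 0 < rho5 c] /\
  [/\ 0 < kappa1 c, 0 < kappa2 c, 0 < b1 c, 0 < b2 c & 0 < jm c] /\
  [/\ 0 < gamma1 c, 0 < gamma2 c & 0 < gamma3 c] /\
  [/\ 0 < delta c, 0 < beta c & 0 < K c].

Inductive component := cphi | cu | cpsi | cv | cy | cs | cz | cw | ctheta.

Definition state (R : realType) : lmodType R[i] := component -> R -> R[i].

Definition phase_space (R : realType) (c : params R) : set (state R) :=
  [set U |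
    [/\ DpowA (len c) (1 / 2) (U cphi), L2 (len c) (U cu),
        DpowA (len c) (1 / 2) (U cpsi) & L2 (len c) (U cv)] /\
    [/\ DpowA (len c) (1 / 2) (U cy), L2 (len c) (U cs),
        DpowA (len c) (1 / 2) (U cz), L2 (len c) (U cw) &
        DpowA (len c) (1 / 2) (U ctheta)]].

Definition phase_norm (R : realType) (c : params R) (U : state R) : R :=
  let nsq f := l2norm (len c) f ^+ 2 in
  let D := dx (len c) in
  let Ah := powA (len c) (1 / 2) in
  Num.sqrt (
    rho1 c * nsq (U cu) + rho2 c * nsq (U cv) +
    rho3 c * nsq (U cs) + rho4 c * nsq (U cw) +
    b1 c * nsq (Ah (U cpsi)) + b2 c * nsq (Ah (U cz)) +
    kappa1 c * nsq (D (U cphi) - U cpsi) +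
    kappa2 c * nsq (D (U cy) - U cz) +
    jm c * nsq (U cy - U cphi) +
    rho5 c * delta c / beta c * nsq (Ah (U ctheta))).

Definition opB1 (R : realType) (c : params R) (tau1 tau2 tau3 : R)
    (U : state R) : state R :=
  let D := dx (len c) in
  let A := opA (len c) in
  let phi := U cphi in let u := U cu in
  let psi := U cpsi in let v := U cv in
  let y := U cy in let s := U cs in
  let z := U cz in let w := U cw in
  let theta := U ctheta in
  fun i => match i with
  | cphi => u
  | cu => - ((kappa1 c / rho1 c)%:C *: A phi)
          - (kappa1 c / rho1 c)%:C *: D psi
          + (jm c / rho1 c)%:C *: (y - phi)
          - (gamma1 c / rho1 c)%:C *: powA (len c) tau1 u
  | cpsi => v
  | cv => - ((b1 c / rho2 c)%:C *: A psi)
          + (kappa1 c / rho2 c)%:C *: (D phi - psi)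
          + (delta c / rho2 c)%:C *: A theta
  | cy => s
  | cs => - ((kappa2 c / rho3 c)%:C *: A y)
          - (kappa2 c / rho3 c)%:C *: D z
          - (jm c / rho3 c)%:C *: (y - phi)
          - (gamma2 c / rho3 c)%:C *: powA (len c) tau2 s
  | cz => w
  | cw => - ((b2 c / rho4 c)%:C *: A z)
          + (kappa2 c / rho4 c)%:C *: (D y - z)
          - (gamma3 c / rho4 c)%:C *: powA (len c) tau3 w
  | ctheta => - ((K c / rho5 c)%:C *: A theta) - (beta c / rho5 c)%:C *: v
  end.

(* The last two clauses express that B1 takes its values in the phase space.
   For u in D(A^{1/2}), the extension of A^tau u to the scale of negative powers
   lies in L^2(0,l) iff u is in D(A^tau); the membership of [opB1 U] then only
   adds A theta \in D(A^{1/2}). *)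
Definition DB1 (R : realType) (c : params R) (tau1 tau2 tau3 : R) :
    set (state R) :=
  [set U | phase_space c U /\
    [/\ DpowA (len c) (1 / 2) (U cu), DpowA (len c) (1 / 2) (U cv),
        DpowA (len c) (1 / 2) (U cs) & DpowA (len c) (1 / 2) (U cw)] /\
    [/\ DpowA (len c) (1 / 2) (U ctheta) /\ sobolev (len c) 3 (U ctheta),
        DA (len c) (U cphi) /\ DpowA (len c) tau1 (U cphi),
        DA (len c) (U cpsi),
        DA (len c) (U cy) /\ DpowA (len c) tau2 (U cy) &
        DA (len c) (U cz) /\ DpowA (len c) tau3 (U cz)] /\
    [/\ DpowA (len c) tau1 (U cu), DpowA (len c) tau2 (U cs) &
        DpowA (len c) tau3 (U cw)] /\
    phase_space c (opB1 c tau1 tau2 tau3 U)].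

(* Main.v *)
(** The functional [N |U|^2 + M rho5 Re<theta,v> + Re(rho1 <u,phi> + rho2 <v,psi> +
    rho3 <s,y> + rho4 <w,z>)] decays along the orbits. The energy [|U|^2] dissipates the
    three damping terms, which dominate the kinetic energies of [u], [s], [w] whatever
    the exponents, and [|A theta|^2]; the derivative of the second term controls [|v|^2]
    (this is the only dissipation of the [psi] equation), and that of the last terms
    yields the potential energy with a negative sign. The fractional powers and the
    weak derivatives are compared through the expansion in the eigenbasis of [A]. The
    differential inequality is integrated on the domain, where difference quotients of
    an orbit converge uniformly in time, and extended by density of finite expansions. *)

(* The generator is only the closure of [opB1] on [DB1], so an orbit issued from [DB1] is not known
   to stay in it. What is available is that [(S t x, S t (B x))] lies in the graph of the generator,
   hence is a limit of pairs [(d, B d)] with [d] in the domain; the dissipation inequality is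
   continuous for [N] and passes to that limit.

   The eigenbasis comes from the definitions: membership in [DpowA] carries one, so it is at hand as
   soon as the phase space has an element. Its vectors are limits of test functions, which also
   yields the uniqueness of weak derivatives. Each [is_powA] may carry another eigenbasis, hence
   coefficients are first shown not to depend on it.

   The delicate terms are [<A^tau u, phi>] and its analogues, because the dissipation [<A^tau u, u>]
   does not bound the norm of [A^tau u]. Young's inequality is applied to each coefficient with
   weight [lam n ^ tau], and only afterwards is [lam n ^ tau] compared with [lam n], which is where
   [tau <= 1] enters. The comparison of the damping with the kinetic energy rests on a lower bound
   for [lam n], that is on Poincare's inequality, here with constant [4 * l ^ 2]. *)
From HB Require Import structures.
From mathcomp Require Import ring lra measurable_realfun.
Require Import Defs.

Set Implicit Arguments.
Unset Strict Implicit.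
Unset Printing Implicit Defensive.

Local Open Scope classical_set_scope.
Local Open Scope ring_scope.
Local Open Scope complex_scope.

(** * Real symmetric forms on a subspace of a complex vector space *)

Section SymmetricForms.
Context (R : realType) (V : lmodType R[i]).
Implicit Types (H : set V) (b q : V -> V -> R).

Definition is_subspace H : Prop :=
  H 0 /\ forall (a : R[i]) x y, H x -> H y -> H (a *: x + y).

(* Bilinearity is over the reals only. *)
Definition sym_form H b : Prop :=
  (forall x y, H x -> H y -> b x y = b y x) /\
  forall (a : R) x y z, H x -> H y -> H z ->
    b (a%:C *: x + y) z = a * b x z + b y z.

Section Subspace.
Variable H : set V.
Hypothesis subH : is_subspace H.

Lemma subspaceD x y : H x -> H y -> H (x + y).
Proof. by move=> Hx Hy; have := subH.2 1 x y Hx Hy; rewrite scale1r. Qed.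

Lemma subspaceZ (a : R[i]) x : H x -> H (a *: x).
Proof. by move=> Hx; have := subH.2 a x 0 Hx subH.1; rewrite addr0. Qed.

Lemma subspaceB x y : H x -> H y -> H (x - y).
Proof.
by move=> Hx Hy; apply: subspaceD => //; rewrite -scaleN1r; exact: subspaceZ.
Qed.

Lemma subspace_sum (I : Type) (r : seq I) (P : pred I) (F : I -> V) :
  (forall i, P i -> H (F i)) -> H (\sum_(i <- r | P i) F i).
Proof. by move=> HF; apply: big_ind => //; [exact: subH.1|exact: subspaceD]. Qed.

End Subspace.

Section Form.
Variables (H : set V) (b : V -> V -> R).
Hypotheses (subH : is_subspace H) (symb : sym_form H b).

Lemma formC x y : H x -> H y -> b x y = b y x.
Proof. exact: symb.1. Qed.

Lemma formDl x y z : H x -> H y -> H z -> b (x + y) z = b x z + b y z.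
Proof.
by move=> Hx Hy Hz; have := symb.2 1 x y z Hx Hy Hz; rewrite scale1r mul1r.
Qed.

Lemma form0l z : H z -> b 0 z = 0.
Proof.
move=> Hz; have := formDl (subH.1) (subH.1) Hz; rewrite addr0 => /eqP.
by rewrite -subr_eq0 opprD addrA subrr add0r oppr_eq0 => /eqP.
Qed.

Lemma formZl (a : R) x z : H x -> H z -> b (a%:C *: x) z = a * b x z.
Proof.
move=> Hx Hz; have := symb.2 a x 0 z Hx subH.1 Hz.
by rewrite addr0 form0l// addr0.
Qed.

Lemma formBl x y z : H x -> H y -> H z -> b (x - y) z = b x z - b y z.
Proof.
move=> Hx Hy Hz; rewrite formDl//; last first.
  by rewrite -scaleN1r; exact: subspaceZ.
have -> : - y = ((-1 : R)%:C : R[i]) *: y by rewrite rmorphN1 scaleN1r.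
by rewrite formZl// mulN1r.
Qed.

Lemma formDr x y z : H x -> H y -> H z -> b z (x + y) = b z x + b z y.
Proof.
move=> Hx Hy Hz; rewrite formC ?formDl// 1?(formC Hz)// 1?(formC Hx)//.
  by rewrite (formC Hy).
exact: subspaceD.
Qed.

Lemma formZr (a : R) x z : H x -> H z -> b z (a%:C *: x) = a * b z x.
Proof.
by move=> Hx Hz; rewrite formC ?formZl// 1?(formC Hx)//; exact: subspaceZ.
Qed.

Lemma formBr x y z : H x -> H y -> H z -> b z (x - y) = b z x - b z y.
Proof.
move=> Hx Hy Hz; rewrite formC ?formBl// ?(formC Hx)// ?(formC Hy)//.
exact: subspaceB.
Qed.

Lemma form_sqD x y : H x -> H y ->
  b (x + y) (x + y) = b x x + 2 * b x y + b y y.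
Proof.
move=> Hx Hy; have Hxy := subspaceD subH Hx Hy.
by rewrite formDl// !formDr// (formC Hy Hx); ring.
Qed.

Hypothesis psd : forall x, H x -> 0 <= b x x.

Lemma form_CS x y : H x -> H y -> b x y ^+ 2 <= b x x * b y y.
Proof.
move=> Hx Hy.
have key (t : R) : 0 <= b x x + 2 * t * b x y + t ^+ 2 * b y y.
  have Hty : H (t%:C *: y) by exact: subspaceZ.
  have := psd (subspaceD subH Hx Hty).
  by rewrite form_sqD// !formZr// formZl// => /le_trans; apply; rewrite le_eqVlt;
    apply/orP; left; apply/eqP; ring.
have [y0|y0] := eqVneq (b y y) 0.
  have [-> //|xy0] := eqVneq (b x y) 0; first by rewrite expr0n /= y0 mulr0.
  (* The form may be degenerate: if [b y y = 0] while [b x y] is nonzero, the polynomial is affine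
     in [t] and takes the value [-1] at this point. *)
  have := key (- (b x x + 1) / (2 * b x y)); rewrite y0 mulr0 addr0.
  have -> : 2 * (- (b x x + 1) / (2 * b x y)) * b x y = - (b x x + 1) by field.
  lra.
have y1 : 0 < b y y by rewrite lt_def y0 psd.
have := key (- b x y / b y y).
have -> : b x x + 2 * (- b x y / b y y) * b x y + (- b x y / b y y) ^+ 2 * b y y
  = (b x x * b y y - b x y ^+ 2) / b y y by field.
by rewrite pmulr_lge0 ?invr_gt0// subr_ge0.
Qed.

Lemma form_CS_sqrt x y : H x -> H y ->
  `|b x y| <= Num.sqrt (b x x) * Num.sqrt (b y y).
Proof.
move=> Hx Hy; rewrite -sqrtrM ?psd// -sqrtr_sqr ler_sqrt ?form_CS//.
by rewrite mulr_ge0 ?psd.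
Qed.

Lemma form_triangle x y : H x -> H y ->
  Num.sqrt (b (x + y) (x + y)) <= Num.sqrt (b x x) + Num.sqrt (b y y).
Proof.
move=> Hx Hy.
set s := Num.sqrt _ + _.
have -> : s = Num.sqrt (s ^+ 2) by rewrite sqrtr_sqr ger0_norm ?addr_ge0 ?sqrtr_ge0.
rewrite ler_sqrt ?sqr_ge0// /s form_sqD// sqrrD !sqr_sqrtr ?psd//.
have := form_CS_sqrt Hx Hy; have := ler_norm (b x y).
by rewrite -mulr_natl; lra.
Qed.

End Form.
End SymmetricForms.

(** The shape in which limits are taken in the decay argument. The bound [e <= 1] allows a factor
    like [N a + e] to be replaced by [N a + 1]. The contradiction comes from [e = a / (k + a + 1)],
    for which [k * e < a]. *)
Lemma le0_small (R : realType) (a k : R) : 0 <= k ->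
  (forall e : R, 0 < e -> e <= 1 -> a <= k * e) -> a <= 0.
Proof.
move=> k0 h; rewrite leNgt; apply/negP => a0.
have d0 : 0 < k + a + 1 by lra.
have := h (a / (k + a + 1)) (divr_gt0 a0 d0).
rewrite ler_pdivrMr// mul1r => /(_ _); rewrite mulrA ler_pdivlMr// => h1.
have: a * (k + a + 1) <= k * a by apply: h1; lra.
nra.
Qed.

(** * Exponential decay of a contraction semigroup with a strict Lyapunov form *)

Section LyapunovDecay.
Context (R : realType) (V : lmodType R[i]) (H D : set V).
Variables (b q : V -> V -> R) (N : V -> R) (B : V -> V) (S : R -> V -> V).
Variables (m C w : R).
Hypotheses (subH : is_subspace H) (symb : sym_form H b) (symq : sym_form H q).
Hypothesis NE : forall x, N x = Num.sqrt (b x x).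
Hypothesis psd : forall x, H x -> 0 <= b x x.
Hypotheses (m_gt0 : 0 < m) (C_gt0 : 0 < C) (w_gt0 : 0 < w).
Hypothesis q_lower : forall x, H x -> m * b x x <= q x x.
Hypothesis q_upper : forall x, H x -> q x x <= C * b x x.
Hypothesis D_sub : forall x, D x -> H x /\ H (B x).
Hypothesis D_dense : forall x (eps : R), H x -> 0 < eps ->
  exists2 d, D d & N (x - d) < eps.
Hypothesis lyapunov : forall x, D x -> q (B x) x <= - w * q x x.
Hypothesis semiS : contraction_semigroup H N S.
Hypothesis genS : generated_by H N D B S.

Let psdq x : H x -> 0 <= q x x.
Proof.
by move=> Hx; apply: le_trans (q_lower Hx); rewrite mulr_ge0 ?psd// ltW.
Qed.

Let N0 x : 0 <= N x.
Proof. by rewrite NE sqrtr_ge0. Qed.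

Let ND x y : H x -> H y -> N (x + y) <= N x + N y.
Proof. by rewrite !NE; exact: form_triangle. Qed.

Let NZ (a : R) x : H x -> 0 <= a -> N (a%:C *: x) = a * N x.
Proof.
move=> Hx a0; have Hax := subspaceZ subH (a%:C) Hx.
rewrite !NE (formZl subH)// (formZr subH)// mulrA -expr2 sqrtrM ?sqr_ge0//.
by rewrite sqrtr_sqr ger0_norm.
Qed.

Let NN x : H x -> N (- x) = N x.
Proof.
move=> Hx; have -> : - x = ((-1 : R)%:C : R[i]) *: x by rewrite rmorphN1 scaleN1r.
have Hax := subspaceZ subH ((-1 : R)%:C : R[i]) Hx.
by rewrite !NE (formZl subH)// (formZr subH)// !mulN1r opprK.
Qed.

Let q_bound x y : H x -> H y -> `|q x y| <= C * (N x * N y).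
Proof.
move=> Hx Hy; apply: le_trans (form_CS_sqrt subH symq psdq Hx Hy) _.
rewrite !NE; apply: (@le_trans _ _
  (Num.sqrt (C * b x x) * Num.sqrt (C * b y y))).
  by apply: ler_pM; rewrite ?sqrtr_ge0// ler_sqrt ?q_upper// mulr_ge0 ?psd// ltW.
by rewrite !sqrtrM ?(ltW C_gt0)// mulrACA -expr2 sqr_sqrtr// (ltW C_gt0).
Qed.

Let q_null x y : H x -> H y -> N (x - y) = 0 -> q x x = q y y.
Proof.
move=> Hx Hy xy0; have Hxy := subspaceB subH Hx Hy.
have z z' : H z' -> q (x - y) z' = 0.
  move=> Hz'; have := q_bound Hxy Hz'; rewrite xy0 mul0r mulr0 normr_le0.
  by move/eqP.
have -> : x = (x - y) + y by rewrite subrK.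
rewrite (form_sqD subH symq)// z// z//; lra.
Qed.

Let Ntrans x y z : H x -> H y -> H z ->
  N (x - y) = 0 -> N (y - z) = 0 -> N (x - z) = 0.
Proof.
move=> Hx Hy Hz xy yz; apply/eqP; rewrite eq_le N0 andbT.
have -> : x - z = (x - y) + (y - z) by rewrite addrA subrK.
by apply: le_trans (ND (subspaceB subH Hx Hy) (subspaceB subH Hy Hz)) _; rewrite xy yz addr0.
Qed.

Let HS t x : 0 <= t -> H x -> H (S t x).
Proof. by case: semiS => + _ _ _ _ => h; exact: h. Qed.

Let NS t x : 0 <= t -> H x -> N (S t x) <= N x.
Proof. by case: semiS => _ _ _ _; exact. Qed.

Let Slin t (a : R[i]) x y : 0 <= t -> H x -> H y ->
  N (S t (a *: x + y) - (a *: S t x + S t y)) = 0.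
Proof. by case: semiS => _ + _ _ _ => h; exact: h. Qed.

Let Smul s t x : 0 <= s -> 0 <= t -> H x -> N (S (s + t) x - S s (S t x)) = 0.
Proof. by case: semiS => _ _ [_ h] _ _; exact: h. Qed.

Let rem x h := (h^-1)%:C *: (S h x - x) - B x.

(* The Taylor remainder at time t is the image under S t of the one at time 0,
   hence uniformly small in t. *)
Let taylor x t h : D x -> 0 <= t -> 0 < h ->
  exists z, [/\ H z, N z <= h * N (rem x h) &
    S (h + t) x = S t x + h%:C *: S t (B x) + z].
Proof.
move=> /D_sub[Hx HBx] t0 h0.
have h1 := ltW h0.
have HSh := HS h1 Hx; have HSt := HS t0 Hx; have HStB := HS t0 HBx.
have Hr : H (rem x h).
  by apply: subspaceB => //; apply: subspaceZ => //; exact: subspaceB.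
have HStr := HS t0 Hr.
(* Taking [z] as the exact difference makes it collect, besides [h *: S t (rem x h)], the null
   vectors by which [S] fails to be linear and multiplicative on representatives. *)
exists (S (h + t) x - (S t x + h%:C *: S t (B x))); split; last by rewrite [RHS]addrC subrK.
  apply: subspaceB => //; first by apply: HS => //; rewrite addr_ge0.
  by apply: subspaceD => //; exact: subspaceZ.
have e0 : S h x = h%:C *: rem x h + (h%:C *: B x + x).
  rewrite /rem scalerBr scalerA -rmorphM mulfV ?gt_eqF// rmorph1 scale1r.
  by rewrite addrA subrK subrK.
have Hhx : H (h%:C *: B x + x) by apply: subH.2.
have HShh : H (S (h + t) x) by apply: HS => //; rewrite addr_ge0.
have HStSh := HS t0 HSh; have HSthx := HS t0 Hhx.
have Hhr : H (h%:C *: S t (rem x h)) by apply: subspaceZ.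
have HhSB : H (h%:C *: S t (B x) + S t x) by apply: subH.2.
have close : N (S (h + t) x -
    (h%:C *: S t (rem x h) + (h%:C *: S t (B x) + S t x))) = 0.
  apply: (@Ntrans _ (S t (S h x))) => //; first exact: subspaceD.
    by rewrite addrC [h + t]addrC addrC; exact: Smul.
  apply: (@Ntrans _ (h%:C *: S t (rem x h) + S t (h%:C *: B x + x))) => //.
  - exact: subspaceD.
  - exact: subspaceD.
  - by rewrite {1}e0; exact: Slin.
  - by rewrite opprD addrACA subrr add0r; exact: Slin.
have Hc := subspaceB subH HShh (subspaceD subH Hhr HhSB).
have -> : S (h + t) x - (S t x + h%:C *: S t (B x)) =
    (S (h + t) x - (h%:C *: S t (rem x h) + (h%:C *: S t (B x) + S t x)))
    + h%:C *: S t (rem x h).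
  rewrite [h%:C *: S t (B x) + _]addrC.
  move: (h%:C *: S t (rem x h)) (S t x + _) (S (h + t) x) => r k p.
  by rewrite [r + k]addrC opprD addrA subrK.
apply: le_trans (ND Hc Hhr) _.
by rewrite close add0r NZ// ler_pM2l// NS.
Qed.

(** The pair [(x, B x)] is in the graph closure with [x] itself as approximant, so [generated_by]
    gives differentiability at time 0. *)
Let rem_cvg x : D x -> N (rem x h) @[h --> 0^'+] --> (0 : R).
Proof.
move=> Dx; have [Hx HBx] := D_sub Dx.
have [|_ _] := (genS x (B x)).2; last exact.
split => // eps eps0; exists x => //.
have n0 : forall y, N (y - y) = 0.
  by move=> y; rewrite subrr NE (form0l subH symb) ?sqrtr0//; exact: subH.1.
by rewrite !n0.
Qed.

(** The expansion [taylor] at time [t] is the differentiability at 0 of the orbit of [S t x]. This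
    membership replaces [D (S t x)], which may fail. *)
Let orbit_generator x t : D x -> 0 <= t -> generator H N S (S t x) (S t (B x)).
Proof.
move=> Dx t0; have [Hx HBx] := D_sub Dx.
have Hxt := HS t0 Hx; have Hyt := HS t0 HBx.
split => //.
apply: (@squeeze_cvgr _ _ _ _ (fun=> 0) (fun h => N (rem x h))); last 2 first.
- exact: cvg_cst.
- exact: rem_cvg.
near=> h.
have h0 : 0 < h by near: h; exact: nbhs_right_gt.
have h1 := ltW h0.
rewrite N0/=; have [z [Hz Nz E]] := taylor Dx t0 h0.
have HSS : H (S h (S t x)) by apply: HS.
have HSS' : H (S (h + t) x) by apply: HS => //; rewrite addr_ge0.
have Hd := subspaceB subH HSS HSS'.
have -> : (h^-1)%:C *: (S h (S t x) - S t x) - S t (B x) =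
    (h^-1)%:C *: ((S h (S t x) - S (h + t) x) + z).
  have -> : z = S (h + t) x - (S t x + h%:C *: S t (B x)) by rewrite E addrC addKr.
  rewrite addrA subrK opprD addrA [RHS]scalerBr; congr (_ - _).
  by rewrite scalerA -rmorphM mulVf ?gt_eqF// rmorph1 scale1r.
rewrite NZ ?invr_ge0//; last exact: subspaceD.
rewrite mulrC ler_pdivrMr// [leRHS]mulrC; apply: le_trans (ND Hd Hz) _.
by rewrite -NN// opprB Smul// add0r.
Unshelve. all: by end_near. Qed.

(** Reading [generated_by] from left to right approximates [(S t x, S t (B x))] by pairs [(v, B v)]
    with [v] in [D], where the inequality is assumed; both sides are continuous for [N] by
    Cauchy-Schwarz. *)
Let lyapunov_orbit x t : D x -> 0 <= t ->
  q (S t (B x)) (S t x) <= - w * q (S t x) (S t x).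
Proof.
move=> Dx t0; have [Hx0 HBx0] := D_sub Dx.
have [Hx Hy cl] := (genS _ _).1 (orbit_generator Dx t0).
move: (S t x) (S t (B x)) Hx Hy cl => a y Ha Hy cl.
rewrite -subr_le0.
(* The constant adds the costs of replacing [(a, y)] by [(v, B v)] one slot at a time: the first
   summand for [q y a], the second for [w * q a a]. *)
apply: (@le0_small _ _ (C * (N a + N y + 1) + 2 * w * C * (N a + 1))).
  have c0 := ltW C_gt0; have w0 := ltW w_gt0.
  by rewrite !(addr_ge0, mulr_ge0).
move=> e e0 e1; have [v Dv [Nv NBv]] := cl e e0.
have [Hv HBv] := D_sub Dv.
have Hav := subspaceB subH Ha Hv; have HyB := subspaceB subH Hy HBv.
have NvE : N v <= N a + 1.
  have -> : v = a - (a - v) by rewrite opprB addrC subrK.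
  apply: le_trans (ND _ _) _ => //; first by rewrite -scaleN1r; exact: subspaceZ.
  by rewrite NN// lerD2l; lra.
have NBvE : N (B v) <= N y + 1.
  have -> : B v = y - (y - B v) by rewrite opprB addrC subrK.
  apply: le_trans (ND _ _) _ => //; first by rewrite -scaleN1r; exact: subspaceZ.
  by rewrite NN// lerD2l; lra.
have e1' : q (y - B v) a <= C * (e * N a).
  apply: le_trans (ler_norm _) _; apply: le_trans (q_bound HyB Ha) _.
  by rewrite ler_pM2l// ler_wpM2r// ltW.
have e2 : q (B v) (a - v) <= C * ((N y + 1) * e).
  apply: le_trans (ler_norm _) _; apply: le_trans (q_bound HBv Hav) _.
  by rewrite ler_pM2l// ler_pM// ltW.
have e3 : q (a - v) a <= C * (e * N a).
  apply: le_trans (ler_norm _) _; apply: le_trans (q_bound Hav Ha) _.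
  by rewrite ler_pM2l// ler_wpM2r// ltW.
have e4 : q v (a - v) <= C * ((N a + 1) * e).
  apply: le_trans (ler_norm _) _; apply: le_trans (q_bound Hv Hav) _.
  by rewrite ler_pM2l// ler_pM// ltW.
move: e1' e2 e3 e4 (lyapunov Dv).
rewrite !(formBl subH symq)// !(formBr subH symq)//.
move: (N a) (N y) (q y a) (q (B v) a) (q (B v) v) (q a a) (q v a) (q v v)
  => na ny p1 p2 p3 p4 p5 p6 f1 f2 f3 f4 f5.
have : w * (p4 - p6) <= w * (C * (e * na) + C * ((na + 1) * e)).
  by rewrite ler_pM2l//; lra.
have : 0 <= w * C * e by rewrite !mulr_ge0// ltW.
nra.
Qed.

(** One explicit Euler step: [q (B x) x] is half the derivative of [q] along the orbit, whence the
    factor [2 * w]. The threshold [h0] does not depend on [t] since the Taylor remainder is uniform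
    in time, which permits equal steps along the whole orbit. *)
Let step x e : D x -> 0 < e -> e <= 1 ->
  exists2 h0, 0 < h0 & forall h t, 0 < h -> h < h0 -> 0 <= t ->
  q (S (h + t) x) (S (h + t) x) <=
    (1 - 2 * w * h) * q (S t x) (S t x) +
    h * ((2 * C * N x + C * (N (B x) + 1) ^+ 2) * e).
Proof.
move=> Dx e0 e1; have [Hx HBx] := D_sub Dx.
have /cvgrPdist_lt /(_ e e0) := rem_cvg Dx.
rewrite near_withinE => -[d /= d0 hd].
(* [h < d] makes the remainder small, and [h < e] turns the quadratic term in [h] into a multiple of
   [h * e]. *)
exists (Num.min d e); first by rewrite lt_min d0.
move=> h t h0; rewrite lt_min => /andP[hd' he] t0.
have r1 : N (rem x h) < e.
  have := hd h; rewrite /= !sub0r !normrN !ger0_norm ?N0// ?(ltW h0)//; exact.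
have [z [Hz Nz ->]] := taylor Dx t0 h0.
have lo := lyapunov_orbit Dx t0.
have Ha := HS t0 Hx; have Hy := HS t0 HBx.
have Na := NS t0 Hx; have Ny := NS t0 HBx.
have Hhy := subspaceZ subH h%:C Hy.
have Hp := subspaceD subH Hhy Hz.
rewrite -addrA (form_sqD subH symq)// (formDr subH symq)// (formZr subH symq)//.
have b1 : q (S t x) z <= C * (N x * (h * e)).
  apply: le_trans (ler_norm _) _; apply: le_trans (q_bound Ha Hz) _.
  rewrite ler_pM2l// ler_pM// (le_trans Nz)// ler_pM2l// ltW//.
have b2 : q (h%:C *: S t (B x) + z) (h%:C *: S t (B x) + z)
    <= C * (h * (N (B x) + 1)) ^+ 2.
  apply: le_trans (q_upper Hp) _; rewrite ler_pM2l//.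
  rewrite -[leLHS]sqr_sqrtr ?psd// -NE.
  rewrite ler_sqr ?nnegrE ?N0//; last by rewrite mulr_ge0// ?addr_ge0// ltW.
  apply: le_trans (ND Hhy Hz) _; rewrite NZ// ?(ltW h0)// mulrDr.
  by rewrite lerD// ?ler_pM2l// (le_trans Nz)// ler_pM2l//; lra.
have b3 : C * (h * (N (B x) + 1)) ^+ 2 <= C * (N (B x) + 1) ^+ 2 * (h * e).
  have : h * h <= h * e by rewrite ler_pM2l// ltW.
  move=> /(ler_wpM2l (_ : 0 <= C * (N (B x) + 1) ^+ 2)).
  have g : 0 <= C * (N (B x) + 1) ^+ 2 by rewrite mulr_ge0 ?sqr_ge0// ltW.
  by move=> /(_ g); rewrite exprMn; lra.
have b4 : h * q (S t x) (S t (B x)) <= h * (- w * q (S t x) (S t x)).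
  by rewrite ler_pM2l// (symq.1).
move: b1 b2 b3 b4; lra.
Qed.

(** Euler steps of length [t / n.+1], with [1 - x <= expR (- x)]. As the factor of each step is at
    most 1, the local errors [h * (kk * e)] are not amplified; they add up to [t * kk * e], which
    vanishes with [e]. *)
Let orbit_decay x t : D x -> 0 <= t ->
  q (S t x) (S t x) <= expR (- (2 * w * t)) * q x x.
Proof.
move=> Dx; have [Hx HBx] := D_sub Dx.
have q0 : q (S 0 x) (S 0 x) = q x x.
  apply: q_null => //; first exact: HS.
  by case: semiS => _ _ [h _] _ _; exact: h.
rewrite le_eqVlt => /predU1P[<-|t0].
  by rewrite mulr0 oppr0 expR0 mul1r q0.
set kk := 2 * C * N x + C * (N (B x) + 1) ^+ 2.
have kk0 : 0 <= kk.
  by have c0 := ltW C_gt0; rewrite !(addr_ge0, mulr_ge0, sqr_ge0).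
rewrite -subr_le0; apply: (@le0_small _ _ (t * kk)).
  by rewrite mulr_ge0// ltW.
move=> e e0 e1; have [h0 h00 st] := step Dx e0 e1.
have [n hn] : exists n : nat, t / h0 < n.+1%:R.
  exists (Num.truncn (t / h0)); exact: truncnS_gt.
set h := t / n.+1%:R.
have hp : 0 < h by rewrite divr_gt0.
have hh0 : h < h0.
  by rewrite /h ltr_pdivrMr// mulrC -ltr_pdivrMr.
have ex1 : expR (- (2 * w * h)) <= 1.
  rewrite -[leRHS]expR0 ler_expR oppr_le0; apply: mulr_ge0; last exact: ltW.
  by apply: mulr_ge0 => //; exact: ltW.
have it k : q (S (h *+ k) x) (S (h *+ k) x) <=
    expR (- (2 * w * h) *+ k) * q x x + k%:R * (h * (kk * e)).
  elim: k => [|k IH]; first by rewrite !mulr0n expR0 mul1r mul0r addr0 q0.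
  have hk0 : 0 <= h *+ k by rewrite mulrn_wge0// ltW.
  have := st h (h *+ k) hp hh0 hk0; rewrite -mulrS -/kk => /le_trans; apply.
  have : 1 - 2 * w * h <= expR (- (2 * w * h)) by exact: expR_ge1Dx.
  have Q0 := psdq (HS hk0 Hx).
  move=> /(ler_wpM2r Q0) => a1.
  have a2 := ler_wpM2l (expR_ge0 (- (2 * w * h))) IH.
  have g0 : 0 <= k%:R * (h * (kk * e)).
    have h1 := ltW hp; have e01 := ltW e0.
    by apply: mulr_ge0 => //; apply: mulr_ge0 => //; exact: mulr_ge0.
  have a3 := ler_wpM2r g0 ex1.
  rewrite [X in expR X]mulrS expRD -natr1.
  move: a1 a2 a3; lra.
have := it n.+1.
have -> : h *+ n.+1 = t by rewrite -[LHS]mulr_natr divfK.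
have -> : - (2 * w * h) *+ n.+1 = - (2 * w * t).
  by rewrite -[LHS]mulr_natr mulNr -[_ * h * _]mulrA divfK.
have -> : n.+1%:R * (h * (kk * e)) = t * kk * e.
  by rewrite mulrA [_ * h]mulrC divfK// mulrA.
lra.
Qed.

Let domain_decay x t : D x -> 0 <= t ->
  N (S t x) <= Num.sqrt (C / m) * expR (- (w * t)) * N x.
Proof.
move=> Dx t0; have [Hx HBx] := D_sub Dx.
have Ha := HS t0 Hx.
have : m * b (S t x) (S t x) <= C * (expR (- (w * t)) ^+ 2 * b x x).
  apply: le_trans (q_lower Ha) _; apply: le_trans (orbit_decay Dx t0) _.
  have -> : expR (- (w * t)) ^+ 2 = expR (- (2 * w * t)).
    by rewrite -expRM_natl mulrN mulrA.
  by rewrite [leRHS]mulrCA ler_pM2l ?expR_gt0// q_upper.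
rewrite mulrC -ler_pdivlMr// => h.
rewrite !NE -[expR _]ger0_norm ?expR_ge0// -sqrtr_sqr -!sqrtrM; last 2 first.
- by rewrite mulr_ge0 ?sqr_ge0// divr_ge0// ltW.
- by rewrite divr_ge0// ltW.
rewrite ler_sqrt; last first.
  have c0 := ltW C_gt0; have m0 := ltW m_gt0.
  by rewrite !(mulr_ge0, invr_ge0, psd, sqr_ge0).
by apply: le_trans h _; rewrite le_eqVlt; apply/orP; left; apply/eqP; ring.
Qed.

Lemma lyapunov_exponential_stability :
  exists M omega : R, [/\ 1 <= M, 0 < omega &
    forall t : R, 0 <= t ->
      (opnorm H N (S t) <= (M * expR (- (omega * t)))%:E)%E].
Proof.
(* The factor [sqrt (C / m)] comes from comparing [q] with the norm on both sides; the added 1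
   secures [1 <= M]. *)
exists (Num.sqrt (C / m) + 1), w; split => //.
  by rewrite lerDr sqrtr_ge0.
move=> t t0; apply: ge_ereal_sup => _ [x [Hx Nx] <-]; rewrite lee_fin.
set M := Num.sqrt _ + 1; set E := expR _.
have M0 : 0 <= M by rewrite addr_ge0 ?sqrtr_ge0.
have E0 : 0 <= E by exact: expR_ge0.
rewrite -subr_le0; apply: (@le0_small _ _ (1 + M * E)).
  by rewrite addr_ge0// mulr_ge0.
(* For [d] in the domain within [e] of [x], the part [S t (x - d)] has norm at most [e] by
   contraction, and [N d <= 1 + e]; this explains the constant [1 + M * E]. *)
move=> e e0 e1; have [d Dd xd] := D_dense Hx e0.
have [Hd _] := D_sub Dd; have Hxd := subspaceB subH Hx Hd.
have HSd := HS t0 Hd; have HSx := HS t0 Hx; have HSxd := HS t0 Hxd.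
have lin : N (S t x - (S t (x - d) + S t d)) = 0.
  by have := Slin 1 t0 Hxd Hd; rewrite !scale1r subrK.
have Hr := subspaceB subH HSx (subspaceD subH HSxd HSd).
have -> : S t x = S t x - (S t (x - d) + S t d) + (S t (x - d) + S t d).
  by rewrite subrK.
have b1 := ND Hr (subspaceD subH HSxd HSd).
have b2 := ND HSxd HSd.
have b3 := NS t0 Hxd.
have b4 := domain_decay Dd t0; rewrite -/E in b4.
have b5 : N d <= 1 + e.
  have -> : d = x - (x - d) by rewrite opprB addrC subrK.
  apply: le_trans (ND _ _) _ => //; first by rewrite -scaleN1r; exact: subspaceZ.
  by rewrite NN//; lra.
have b6 : Num.sqrt (C / m) * E * N d <= M * E * (1 + e).
  by rewrite ler_pM ?mulr_ge0 ?sqrtr_ge0// ler_wpM2r// lerDl.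
move: b1 b2 b3 b4 b6; rewrite lin; lra.
Qed.

End LyapunovDecay.

(* Locked, as unification would otherwise compare integrals. *)
HB.lock Definition rinner (R : realType) (l : R) (f g : R -> R[i]) : R :=
  complex.Re (inner l f g).

Lemma rinnerE (R : realType) (l : R) (f g : R -> R[i]) :
  rinner l f g = complex.Re (inner l f g).
Proof. by rewrite rinner.unlock. Qed.

(** * Complex and real inner products on L^2(0,l) *)

Section SquareIntegrable.
Context (R : realType) (l : R).
Implicit Types (f g h : R -> R[i]).
Let mu := @lebesgue_measure R.
Let I : set R := `]0, l[%classic.

Local Notation rinner := (rinner l).

Lemma ReD (a b : R[i]) : complex.Re (a + b) = complex.Re a + complex.Re b.
Proof. by case: a; case: b. Qed.

Lemma ImD (a b : R[i]) : complex.Im (a + b) = complex.Im a + complex.Im b.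
Proof. by case: a; case: b. Qed.

Lemma ReM (a b : R[i]) : complex.Re (a * b) =
  complex.Re a * complex.Re b - complex.Im a * complex.Im b.
Proof. by case: a => a a'; case: b. Qed.

Lemma ImM (a b : R[i]) : complex.Im (a * b) =
  complex.Re a * complex.Im b + complex.Im a * complex.Re b.
Proof. by case: a => a a'; case: b. Qed.

Lemma Reconj (a : R[i]) : complex.Re (conjc a) = complex.Re a.
Proof. by case: a. Qed.

Lemma Imconj (a : R[i]) : complex.Im (conjc a) = - complex.Im a.
Proof. by case: a. Qed.

Lemma complex_eq (a b : R[i]) :
  complex.Re a = complex.Re b -> complex.Im a = complex.Im b -> a = b.
Proof. by case: a => ? ?; case: b => ? ? /= -> ->. Qed.

Lemma sqmod_ge0 (z : R[i]) : 0 <= sqmod z.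
Proof. by rewrite addr_ge0 ?sqr_ge0. Qed.

Let mI : measurable (I : set (measurableTypeR R)). Proof. exact: measurable_itv. Qed.

Lemma L2_measurable_sqmod f : L2 l f -> measurable_fun I (fun x => sqmod (f x)).
Proof.
by case=> m1 m2 _; apply: measurable_funD; apply: measurable_funX.
Qed.

Lemma L2_sqmod_integrable f : L2 l f ->
  mu.-integrable I (EFin \o (fun x => sqmod (f x))).
Proof.
move=> Lf; apply/integrableP; split.
  by apply/measurable_EFinP; exact: L2_measurable_sqmod.
case: Lf => _ _; apply: le_lt_trans; rewrite le_eqVlt; apply/orP; left; apply/eqP.
by apply: eq_integral => x _; rewrite /= ger0_norm ?sqmod_ge0.
Qed.

Lemma L2_dominated f g (h : R -> R) : L2 l f -> L2 l g -> measurable_fun I h ->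
  (forall x, `|h x| <= sqmod (f x) + sqmod (g x)) ->
  mu.-integrable I (EFin \o h).
Proof.
move=> Lf Lg mh hle.
have := integrableD mI (L2_sqmod_integrable Lf) (L2_sqmod_integrable Lg).
apply: le_integrable => //; first exact/measurable_EFinP.
by move=> x _ /=; rewrite lee_fin (le_trans (hle x))// ler_norm.
Qed.

Lemma integrable_Re_inner f g : L2 l f -> L2 l g ->
  mu.-integrable I (EFin \o (fun x => complex.Re (f x * conjc (g x)))).
Proof.
move=> Lf Lg; apply: (L2_dominated Lf Lg).
  case: Lf => mf1 mf2 _; case: Lg => mg1 mg2 _.
  rewrite (_ : (fun _ => _) = (fun x => complex.Re (f x) * complex.Re (g x)
     + complex.Im (f x) * complex.Im (g x))).
    by apply: measurable_funD; apply: measurable_funM.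
  by apply/funext => x; rewrite ReM Reconj Imconj mulrN opprK.
move=> x; rewrite ReM Reconj Imconj /sqmod ler_norml.
move: (complex.Re (f x)) (complex.Im (f x)) (complex.Re (g x)) (complex.Im (g x)).
move=> a b c d; have := sqr_ge0 (a - c); have := sqr_ge0 (a + c).
have := sqr_ge0 (b - d); have := sqr_ge0 (b + d).
have := sqr_ge0 a; have := sqr_ge0 b; have := sqr_ge0 c; have := sqr_ge0 d.
by move=> *; apply/andP; split; nra.
Qed.

Lemma integrable_Im_inner f g : L2 l f -> L2 l g ->
  mu.-integrable I (EFin \o (fun x => complex.Im (f x * conjc (g x)))).
Proof.
move=> Lf Lg; apply: (L2_dominated Lf Lg).
  case: Lf => mf1 mf2 _; case: Lg => mg1 mg2 _.
  rewrite (_ : (fun _ => _) = (fun x => complex.Im (f x) * complex.Re (g x)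
     - complex.Re (f x) * complex.Im (g x))).
    by apply: measurable_funB; apply: measurable_funM.
  by apply/funext => x; rewrite ImM Reconj Imconj mulrN addrC.
move=> x; rewrite ImM Reconj Imconj /sqmod ler_norml.
move: (complex.Re (f x)) (complex.Im (f x)) (complex.Re (g x)) (complex.Im (g x)).
move=> a b c d; have := sqr_ge0 (a - d); have := sqr_ge0 (a + d).
have := sqr_ge0 (b - c); have := sqr_ge0 (b + c).
have := sqr_ge0 a; have := sqr_ge0 b; have := sqr_ge0 c; have := sqr_ge0 d.
by move=> *; apply/andP; split; nra.
Qed.

Lemma L2_subspace : is_subspace (L2 l : set (R -> R[i])).
Proof.
split.
  split => /=; [exact: measurable_cst|exact: measurable_cst|].
  by rewrite integral0_eq// => x _; rewrite /sqmod /= expr0n /= addr0.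
move=> a f g Lf Lg.
have [mf1 mf2 _] := Lf; have [mg1 mg2 _] := Lg.
have m1 : measurable_fun I (fun x => complex.Re ((a *: f + g) x)).
  rewrite (_ : (fun _ => _) = (fun x => (complex.Re a * complex.Re (f x) -
    complex.Im a * complex.Im (f x)) + complex.Re (g x))).
    apply: measurable_funD => //; apply: measurable_funB;
      by apply: measurable_funM => //; exact: measurable_cst.
  by apply/funext => x; rewrite fctE ReD -ReM.
have m2 : measurable_fun I (fun x => complex.Im ((a *: f + g) x)).
  rewrite (_ : (fun _ => _) = (fun x => (complex.Re a * complex.Im (f x) +
    complex.Im a * complex.Re (f x)) + complex.Im (g x))).
    apply: measurable_funD => //; apply: measurable_funD;
      by apply: measurable_funM => //; exact: measurable_cst.
  by apply/funext => x; rewrite fctE ImD -ImM.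
split => //.
(* Integrates the pointwise bound [|a f + g|^2 <= 2 |a|^2 |f|^2 + 2 |g|^2]. *)
have := integrableD mI
  (integrableZl mI (2 * sqmod a) (L2_sqmod_integrable Lf))
  (integrableZl mI 2 (L2_sqmod_integrable Lg)).
move=> /integrableP[_]; apply: le_lt_trans; apply: ge0_le_integral => //.
- by move=> x _; rewrite lee_fin sqmod_ge0.
- by apply/measurable_EFinP; apply: measurable_funD; apply: measurable_funX.
- apply: measurableT_comp => //; apply: emeasurable_funD;
    by apply: measurable_funeM; apply/measurable_EFinP; exact: L2_measurable_sqmod.
- move=> x _ /=; rewrite lee_fin.
  apply: le_trans (ler_norm _); rewrite fctE /sqmod ReD ImD ReM ImM.
  move: (complex.Re (f x)) (complex.Im (f x)) (complex.Re (g x)) (complex.Im (g x)).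
  move: (complex.Re a) (complex.Im a) => p q b c d e.
  have := sqr_ge0 (p * b - q * c - d); have := sqr_ge0 (p * c + q * b - e); lra.
Qed.

Lemma inner_linear (a : R[i]) f g h : L2 l f -> L2 l g -> L2 l h ->
  inner l (a *: f + g) h = a * inner l f h + inner l g h.
Proof.
move=> Lf Lg Lh.
have iRf := integrable_Re_inner Lf Lh; have iIf := integrable_Im_inner Lf Lh.
have iRg := integrable_Re_inner Lg Lh; have iIg := integrable_Im_inner Lg Lh.
have ZE (c : R) (F : R -> R) : mu.-integrable I (EFin \o F) ->
    mu.-integrable I (EFin \o (fun x => c * F x)) by exact: integrableZl.
have BE (F G : R -> R) : mu.-integrable I (EFin \o F) -> mu.-integrable I (EFin \o G) ->
    mu.-integrable I (EFin \o (fun x => F x - G x)) by exact: integrableB.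
have DE (F G : R -> R) : mu.-integrable I (EFin \o F) -> mu.-integrable I (EFin \o G) ->
    mu.-integrable I (EFin \o (fun x => F x + G x)) by exact: integrableD.
apply: complex_eq.
- rewrite ReD ReM /inner /cintegral /=.
  rewrite -!RintegralZl// -RintegralB ?ZE// -RintegralD//; last exact: BE (ZE _ _ iRf) (ZE _ _ iIf).
  by apply: eq_Rintegral => x _; rewrite -ReM -ReD fctE mulrDl mulrA.
- rewrite ImD ImM /inner /cintegral /=.
  rewrite -!RintegralZl// -RintegralD ?ZE// -RintegralD//; last exact: DE (ZE _ _ iIf) (ZE _ _ iRf).
  by apply: eq_Rintegral => x _; rewrite -ImM -ImD fctE mulrDl mulrA.
Qed.

Lemma innerC f g : L2 l f -> L2 l g -> inner l g f = conjc (inner l f g).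
Proof.
move=> Lf Lg; apply: complex_eq; rewrite ?Reconj ?Imconj /inner /cintegral /=.
  apply: eq_Rintegral => x _; rewrite !ReM !Reconj !Imconj; ring.
rewrite -mulN1r -RintegralZl//; last exact: integrable_Im_inner.
apply: eq_Rintegral => x _; rewrite !ImM !Reconj !Imconj; ring.
Qed.

Lemma l2normE f : l2norm l f = Num.sqrt (rinner f f).
Proof.
rewrite /l2norm rinnerE /inner /cintegral /=; congr Num.sqrt.
apply: eq_Rintegral => x _; rewrite ReM Reconj Imconj /sqmod; ring.
Qed.

Lemma rinner_form : sym_form (L2 l : set (R -> R[i])) rinner.
Proof.
split=> [f g Lf Lg|a f g h Lf Lg Lh].
  by rewrite !rinnerE (innerC Lg Lf) Reconj.
by rewrite !rinnerE inner_linear// ReD ReM mul0r subr0.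
Qed.

Lemma rinner_ge0 f : 0 <= rinner f f.
Proof.
rewrite rinnerE; apply: Rintegral_ge0 => x _; rewrite ReM Reconj Imconj mulrN opprK -!expr2.
exact: sqmod_ge0.
Qed.

Lemma l2norm_sqr f : l2norm l f ^+ 2 = rinner f f.
Proof. by rewrite l2normE sqr_sqrtr// rinner_ge0. Qed.

Lemma l2norm_ge0 f : 0 <= l2norm l f.
Proof. by rewrite sqrtr_ge0. Qed.

(** Since [<i f, g> = i <f, g>], the imaginary part of [<f, g>] is minus the real part of
    [<i f, g>]. The real form thus determines the complex product, and limits are taken on [rinner]
    only. *)
Lemma innerE f g : L2 l f -> L2 l g ->
  inner l f g = rinner f g -i* rinner ('i *: f) g.
Proof.
move=> Lf Lg; have := inner_linear 'i Lf L2_subspace.1 Lg.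
rewrite addr0 => E; apply: complex_eq => /=; first by rewrite rinnerE.
have E0 : inner l 0 g = 0.
  have := inner_linear 1 L2_subspace.1 L2_subspace.1 Lg.
  by rewrite scaler0 addr0 mul1r => /esym/eqP; rewrite -subr_eq0 addrK => /eqP.
by rewrite rinnerE E E0 addr0 ReM /= mul0r mul1r sub0r opprK.
Qed.

Lemma rinner_CS f g : L2 l f -> L2 l g ->
  `|rinner f g| <= l2norm l f * l2norm l g.
Proof.
rewrite !l2normE; apply: form_CS_sqrt => //; [exact: L2_subspace|exact: rinner_form|].
by move=> *; exact: rinner_ge0.
Qed.

Lemma l2norm_triangle f g : L2 l f -> L2 l g ->
  l2norm l (f + g) <= l2norm l f + l2norm l g.
Proof.
rewrite !l2normE; apply: form_triangle => //; [exact: L2_subspace|exact: rinner_form|].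
by move=> *; exact: rinner_ge0.
Qed.

Lemma l2norm_ae0 f : L2 l f ->
  (\forall x \ae mu, x \in `]0, l[ -> f x = 0) -> l2norm l f = 0.
Proof.
move=> Lf f0; rewrite /l2norm /Rintegral; apply/eqP; rewrite sqrtr_eq0.
rewrite (@ae_eq_integral _ _ _ mu I (cst 0))//.
- by rewrite integral_cst//= mul0e.
- by apply/measurable_EFinP; exact: L2_measurable_sqmod.
- case: f0 => A [mA A0 sA]; exists A; split => // x /= nx; apply: sA => /= fx.
  apply: nx => Ix; rewrite fx ?inE//.
  by rewrite /sqmod /= expr0n /= addr0.
Qed.

Lemma L2D f g : L2 l f -> L2 l g -> L2 l (f + g).
Proof. exact: (subspaceD L2_subspace). Qed.

Lemma L2B f g : L2 l f -> L2 l g -> L2 l (f - g).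
Proof. exact: (subspaceB L2_subspace). Qed.

Lemma L2Z (a : R[i]) f : L2 l f -> L2 l (a *: f).
Proof. exact: (subspaceZ L2_subspace). Qed.

Lemma L2_0 : L2 l 0.
Proof. exact: L2_subspace.1. Qed.

Lemma L2_sum (J : Type) (r : seq J) (P : pred J) (F : J -> R -> R[i]) :
  (forall i, P i -> L2 l (F i)) -> L2 l (\sum_(i <- r | P i) F i).
Proof. exact: (subspace_sum L2_subspace). Qed.

Lemma rinnerC f g : L2 l f -> L2 l g -> rinner f g = rinner g f.
Proof. exact: rinner_form.1. Qed.

Lemma rinnerDl f g h : L2 l f -> L2 l g -> L2 l h ->
  rinner (f + g) h = rinner f h + rinner g h.
Proof. exact: (formDl rinner_form). Qed.

Lemma rinnerBl f g h : L2 l f -> L2 l g -> L2 l h ->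
  rinner (f - g) h = rinner f h - rinner g h.
Proof. exact: (formBl L2_subspace rinner_form). Qed.

Lemma rinnerBr f g h : L2 l f -> L2 l g -> L2 l h ->
  rinner h (f - g) = rinner h f - rinner h g.
Proof. exact: (formBr L2_subspace rinner_form). Qed.

Lemma rinnerZl (a : R) f h : L2 l f -> L2 l h ->
  rinner (a%:C *: f) h = a * rinner f h.
Proof. exact: (formZl L2_subspace rinner_form). Qed.

Lemma rinnerZr (a : R) f h : L2 l f -> L2 l h ->
  rinner h (a%:C *: f) = a * rinner h f.
Proof. exact: (formZr L2_subspace rinner_form). Qed.

Lemma inner0l h : L2 l h -> inner l 0 h = 0.
Proof.
move=> Lh; have := inner_linear 1 L2_0 L2_0 Lh.
by rewrite scaler0 addr0 mul1r => /esym/eqP; rewrite -subr_eq0 addrK => /eqP.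
Qed.

Lemma innerZl (a : R[i]) f h : L2 l f -> L2 l h ->
  inner l (a *: f) h = a * inner l f h.
Proof.
by move=> Lf Lh; have := inner_linear a Lf L2_0 Lh; rewrite addr0 inner0l// addr0.
Qed.

Lemma innerDl f g h : L2 l f -> L2 l g -> L2 l h ->
  inner l (f + g) h = inner l f h + inner l g h.
Proof.
by move=> Lf Lg Lh; have := inner_linear 1 Lf Lg Lh; rewrite scale1r mul1r.
Qed.

Lemma innerNl f h : L2 l f -> L2 l h -> inner l (- f) h = - inner l f h.
Proof. by move=> Lf Lh; rewrite -scaleN1r innerZl// mulN1r. Qed.

Lemma innerBl f g h : L2 l f -> L2 l g -> L2 l h ->
  inner l (f - g) h = inner l f h - inner l g h.
Proof.
move=> Lf Lg Lh; have LN : L2 l (- g) by rewrite -scaleN1r; exact: L2Z.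
by rewrite innerDl// innerNl.
Qed.

Lemma inner_suml (J : Type) (r : seq J) (a : J -> R[i]) (F : J -> R -> R[i]) h :
  (forall i, L2 l (F i)) -> L2 l h ->
  inner l (\sum_(i <- r) a i *: F i) h = \sum_(i <- r) a i * inner l (F i) h.
Proof.
move=> LF Lh; elim: r => [|i r IH]; first by rewrite !big_nil inner0l.
rewrite !big_cons inner_linear// ?IH//.
by apply: L2_sum => j _; exact: L2Z.
Qed.

Lemma innerZr (a : R[i]) f h : L2 l f -> L2 l h ->
  inner l h (a *: f) = conjc a * inner l h f.
Proof.
move=> Lf Lh; rewrite (innerC (L2Z a Lf) Lh) innerZl// (innerC Lf Lh).
by apply: complex_eq; rewrite !(ReM, ImM, Reconj, Imconj); ring.
Qed.

Lemma innerDr f g h : L2 l f -> L2 l g -> L2 l h ->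
  inner l h (f + g) = inner l h f + inner l h g.
Proof.
move=> Lf Lg Lh; rewrite (innerC (L2D Lf Lg) Lh) (innerC Lf Lh) (innerC Lg Lh).
by rewrite innerDl//; apply: complex_eq; rewrite !(ReD, ImD, Reconj, Imconj); ring.
Qed.

Lemma rinner_sqZ (a : R[i]) f : L2 l f ->
  rinner (a *: f) (a *: f) = sqmod a * rinner f f.
Proof.
move=> Lf; rewrite !rinnerE innerZl// ?innerZr//; last exact: L2Z.
rewrite mulrA; case: a => a b; rewrite ReM /sqmod /=; ring.
Qed.

Lemma l2normZ (a : R[i]) f : L2 l f ->
  l2norm l (a *: f) = Num.sqrt (sqmod a) * l2norm l f.
Proof. by move=> Lf; rewrite !l2normE rinner_sqZ// sqrtrM// sqmod_ge0. Qed.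

Lemma l2normN f : L2 l f -> l2norm l (- f) = l2norm l f.
Proof.
move=> Lf; rewrite -scaleN1r l2normZ//.
by rewrite /sqmod /= oppr0 sqrrN expr1n expr0n /= addr0 sqrtr1 mul1r.
Qed.

Lemma l2normC f g : L2 l f -> L2 l g -> l2norm l (f - g) = l2norm l (g - f).
Proof. by move=> Lf Lg; rewrite -l2normN ?opprB//; exact: L2B. Qed.

Lemma l2norm0 : l2norm l 0 = 0.
Proof. by rewrite l2normE !rinnerE inner0l ?sqrtr0//; exact: L2_0. Qed.

Lemma rinner_nulll f h : L2 l f -> L2 l h -> l2norm l f = 0 -> rinner f h = 0.
Proof.
move=> Lf Lh f0; have := rinner_CS Lf Lh; rewrite f0 mul0r normr_le0.
by move=> /eqP.
Qed.

Lemma inner_nulll f h : L2 l f -> L2 l h -> l2norm l f = 0 -> inner l f h = 0.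
Proof.
move=> Lf Lh f0; rewrite innerE// !rinner_nulll//; last first.
- by rewrite l2normZ// f0 mulr0.
- exact: L2Z.
by apply: complex_eq; rewrite //= oppr0.
Qed.

Lemma inner_congrl f g h : L2 l f -> L2 l g -> L2 l h ->
  l2norm l (f - g) = 0 -> inner l f h = inner l g h.
Proof.
move=> Lf Lg Lh fg0; apply/eqP; rewrite -subr_eq0 -innerBl//.
by rewrite inner_nulll//; exact: L2B.
Qed.

Lemma rinner_congrl f g h : L2 l f -> L2 l g -> L2 l h ->
  l2norm l (f - g) = 0 -> rinner f h = rinner g h.
Proof. by move=> Lf Lg Lh fg0; rewrite !rinnerE (inner_congrl Lf Lg). Qed.

Lemma inner_congrr f g h : L2 l f -> L2 l g -> L2 l h ->
  l2norm l (f - g) = 0 -> inner l h f = inner l h g.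
Proof.
by move=> Lf Lg Lh fg0; rewrite (innerC Lf Lh) (innerC Lg Lh) (inner_congrl Lf Lg).
Qed.

Lemma l2norm_congr f g : L2 l f -> L2 l g ->
  l2norm l (f - g) = 0 -> l2norm l f = l2norm l g.
Proof.
move=> Lf Lg fg; rewrite !l2normE; congr Num.sqrt.
rewrite (rinner_congrl Lf Lg Lf fg) rinnerC//.
by rewrite (rinner_congrl Lf Lg Lg fg).
Qed.

Definition l2cvg (u : nat -> R -> R[i]) f : Prop :=
  (fun n => l2norm l (f - u n)) @ \oo --> (0 : R).

Lemma rinner_cvg u v f g : L2 l f -> L2 l g ->
  (forall n, L2 l (u n)) -> (forall n, L2 l (v n)) -> l2cvg u f -> l2cvg v g ->
  (fun n => rinner (u n) (v n)) @ \oo --> rinner f g.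
Proof.
move=> Lf Lg Lu Lv uf vg; apply/subr_cvg0.
pose a n := l2norm l (f - u n); pose c n := l2norm l (g - v n).
pose d n := a n * l2norm l g + (l2norm l f + a n) * c n.
have d0 : d @ \oo --> (0 : R).
  have -> : (0 : R) = 0 * l2norm l g + (l2norm l f + 0) * 0.
    by rewrite mul0r mulr0 addr0.
  apply: cvgD; first by apply: cvgM => //; exact: cvg_cst.
  by apply: cvgM => //; apply: cvgD => //; exact: cvg_cst.
apply/norm_cvg0P; apply: (@squeeze_cvgr _ _ _ _ (fun=> 0) d) => //; last exact: cvg_cst.
apply: nearW => n; rewrite normr_ge0/=.
have Lfu := L2B Lf (Lu n); have Lgv := L2B Lg (Lv n).
have -> : rinner (u n) (v n) - rinner f g =
    - (rinner (f - u n) g + rinner (u n) (g - v n)).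
  by rewrite rinnerBl// rinnerBr//; ring.
rewrite normrN; apply: le_trans (ler_normD _ _) _; apply: lerD.
  exact: rinner_CS.
apply: le_trans (rinner_CS (Lu n) Lgv) _; apply: ler_wpM2r; first exact: l2norm_ge0.
have -> : u n = f - (f - u n) by rewrite opprB addrC subrK.
apply: le_trans (l2norm_triangle Lf _) _.
  by rewrite -scaleN1r; exact: L2Z.
by rewrite l2normN// opprB (addrC f) subrK.
Qed.

Lemma l2cvg_cst f : l2cvg (fun=> f) f.
Proof. by rewrite /l2cvg subrr l2norm0; exact: cvg_cst. Qed.

Lemma l2cvgZ (a : R[i]) u f : L2 l f -> (forall n, L2 l (u n)) ->
  l2cvg u f -> l2cvg (fun n => a *: u n) (a *: f).
Proof.
move=> Lf Lu uf; rewrite /l2cvg (_ : (fun n => _) =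
    (fun n => Num.sqrt (sqmod a) * l2norm l (f - u n))); last first.
  by apply/funext => n; rewrite -scalerBr l2normZ//; exact: L2B.
rewrite -(mulr0 (Num.sqrt (sqmod a))).
by apply: cvgM; [exact: cvg_cst|exact: uf].
Qed.

Lemma l2cvgD u v f g : L2 l f -> L2 l g ->
  (forall n, L2 l (u n)) -> (forall n, L2 l (v n)) -> l2cvg u f -> l2cvg v g ->
  l2cvg (fun n => u n + v n) (f + g).
Proof.
move=> Lf Lg Lu Lv uf vg.
apply: (@squeeze_cvgr _ _ _ _ (fun=> 0)
  (fun n => l2norm l (f - u n) + l2norm l (g - v n))).
- apply: nearW => n; rewrite l2norm_ge0/= opprD addrACA.
  by apply: l2norm_triangle; exact: L2B.
- exact: cvg_cst.
- by rewrite -[0]addr0; exact: cvgD.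
Qed.

(* Applying the hypothesis to ['i *: f] gives the imaginary part. *)
Lemma inner_eq_rinner f g f' g' : L2 l f -> L2 l g -> L2 l f' -> L2 l g' ->
  (forall a : R[i], rinner (a *: f) g = rinner (a *: f') g') ->
  inner l f g = inner l f' g'.
Proof.
move=> Lf Lg Lf' Lg' e; rewrite !innerE// e; congr (_ -i* _).
by have := e 1; rewrite !scale1r.
Qed.

End SquareIntegrable.

(** Adding to [a n] the tail [2 * s * 2^-1 ^+ n] of the increments makes the sequence nonincreasing,
    so convergence follows from the monotone case. *)
Lemma cvgn_geometric_increments (R : realType) (a : nat -> R) (s : R) : 0 <= s ->
  (forall k, `|a k.+1 - a k| <= s * 2^-1 ^+ k) ->
  cvgn a /\ forall n, `|limn a - a n| <= 2 * s * 2^-1 ^+ n.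
Proof.
move=> s0 ha.
pose p k : R := 2^-1 ^+ k.
have p0 k : 0 < p k by rewrite exprn_gt0// invr_gt0.
have pS k : p k.+1 = p k / 2 by rewrite /p exprSr.
have h n j : `|a (n + j)%N - a n| <= 2 * s * p n - 2 * s * p (n + j)%N.
  elim: j => [|j IH]; first by rewrite addn0 subrr normr0 subrr.
  rewrite addnS; have -> : a (n + j).+1 - a n =
    (a (n + j).+1 - a (n + j)%N) + (a (n + j)%N - a n) by rewrite addrA subrK.
  apply: le_trans (ler_normD _ _) _.
  have := ha (n + j)%N; rewrite -/(p _) pS; lra.
have h' n m : (n <= m)%N -> `|a m - a n| <= 2 * s * p n.
  move=> nm; have := h n (m - n)%N; rewrite subnKC// => /le_trans; apply.
  by rewrite gerBl !mulr_ge0// ltW.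
have ca : cvgn a.
  have -> : a = (fun n => a n + 2 * s * p n) \- (fun n => 2 * s * p n).
    by apply/funext => n /=; rewrite addrK.
  apply: is_cvgB; last first.
    apply: is_cvgM; first exact: is_cvg_cst.
    apply/cvg_ex; exists 0; apply: cvg_expr.
    by rewrite ger0_norm ?invr_ge0// invf_lt1// ltr1n.
  apply: nonincreasing_is_cvgn.
    apply/nonincreasing_seqP => n; rewrite pS.
    by have := ha n; rewrite -/(p _) ler_norml; lra.
  exists (a 0%N - 2 * s) => _ [n _ <-].
  have := h' 0%N n (leq0n _); rewrite /p expr0 mulr1 ler_norml => /andP[b1 b2].
  have : 0 <= 2 * s * p n by rewrite !mulr_ge0// ltW.
  rewrite /p; lra.
split => // n; rewrite ler_distl; apply/andP; split.
  apply: limr_ge => //; exists n => // m /= nm.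
  by have := h' n m nm; rewrite ler_norml -/(p n); lra.
apply: limr_le => //; exists n => // m /= nm.
by have := h' n m nm; rewrite ler_norml -/(p n); lra.
Qed.

(** * Completeness of L^2(0,l) *)

Section RieszFischer.
Context (R : realType) (l : R).
Let mu := @lebesgue_measure R.
Let I : set R := `]0, l[%classic.
Let mI : measurable (I : set (measurableTypeR R)). Proof. exact: measurable_itv. Qed.

(* The weights [4 ^ k] make [|v k.+1 - v k| <= sqrt G * 2 ^- k] at every point
   where the integrable function [G] is finite. *)
Let real_limit (v : nat -> R -> R) :
  (forall k, measurable_fun I (v k)) ->
  (forall k, (\int[mu]_(x in I) ((v k.+1 x - v k x) ^+ 2)%:E
     <= (8^-1 ^+ k)%:E)%E) ->
  exists g : R -> R, measurable_fun I g /\ forall n,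
    (\int[mu]_(x in I) ((g x - v n x) ^+ 2)%:E <= (8 * 4^-1 ^+ n)%:E)%E.
Proof.
move=> mv iv.
pose w k x : R := 4 ^+ k * (v k.+1 x - v k x) ^+ 2.
have w0 k x : 0 <= w k x by rewrite /w mulr_ge0 ?sqr_ge0 ?exprn_ge0.
have md k : measurable_fun I (fun x => (v k.+1 x - v k x) ^+ 2).
  by apply: measurable_funX; exact: measurable_funB.
have mw k : measurable_fun I (w k).
  by apply: measurable_funM => //; exact: measurable_cst.
pose G x : \bar R := (\sum_(k <oo) (w k x)%:E)%E.
have mG : measurable_fun I G.
  rewrite (_ : G = (fun x => (\sum_(0 <= k <oo | k \in predT) (w k x)%:E)%E)).
    apply: ge0_emeasurable_sum => [k x _ _|k _]; first by rewrite lee_fin.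
    exact/measurable_EFinP.
  by apply/funext => x; apply: eq_eseriesl => k.
have G0 x : (0 <= G x)%E by apply: nneseries_ge0 => k _ _; rewrite lee_fin.
(* The weight [4 ^ k] against the bound [8^-1 ^ k] leaves [2^-1 ^ k], whose sum is 2; hence [G] is
   finite almost everywhere. *)
have iG : (\int[mu]_(x in I) G x <= 2%:E)%E.
  rewrite integral_nneseries//; last 2 first.
  - by move=> k; apply/measurable_EFinP; exact: mw.
  - by move=> k x _; rewrite lee_fin.
  have <- : (\sum_(k <oo) ((2 / (2 ^ (k + 1))%:R)%:E : \bar R))%E = 2%:E.
    by apply/cvg_lim => //; have := @cvg_geometric_eseries_half R 2 0; rewrite expr0 divr1; exact.
  apply: lee_nneseries => k _.
    by move=> _; apply: integral_ge0 => x _; rewrite lee_fin.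
  have -> : (\int[mu]_(x in I) (w k x)%:E =
      (4 ^+ k)%:E * \int[mu]_(x in I) ((v k.+1 x - v k x) ^+ 2)%:E)%E.
    rewrite -ge0_integralZl//.
    - apply/measurable_EFinP; exact: md.
    - by move=> x _; rewrite lee_fin sqr_ge0.
  apply: (@le_trans _ _ ((4 ^+ k)%:E * (8^-1 ^+ k)%:E)%E).
    by rewrite lee_pmul2l ?lte_fin ?exprn_gt0.
  rewrite -EFinM lee_fin -exprMn natrX addn1 exprS invfM mulrA mulfV// mul1r.
  rewrite -exprVn le_eqVlt; apply/orP; left; apply/eqP; congr (_ ^+ _).
  lra.
have Gint : mu.-integrable I G.
  apply/integrableP; split => //; apply: le_lt_trans (ltry 2).
  apply: le_trans iG; rewrite le_eqVlt; apply/orP; left; apply/eqP.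
  by apply: eq_integral => x _; rewrite gee0_abs.
pose A : set R := I `&` [set x | (G x < +oo)%E].
have mA : measurable (A : set (measurableTypeR R)) by exact: emeasurable_fun_infty_o.
(* Cut off outside [A], the sequence converges at every point of [I], so its pointwise limit is
   measurable. *)
pose v' k x := v k x * \1_A x.
have v'A x : A x -> v'^~ x = v^~ x.
  by move=> Ax; apply/funext => k; rewrite /v' indicE mem_set// mulr1.
have incr x : A x -> forall k, `|v k.+1 x - v k x| <= Num.sqrt (fine (G x)) * 2^-1 ^+ k.
  move=> [_ Gx] k.
  have Gfin : G x \is a fin_num by rewrite ge0_fin_numE.
  have wG : w k x <= fine (G x).
    rewrite -lee_fin fineK//.
    apply: (le_trans _ (nneseries_lim_ge k.+1 _)) => //; last first.
      by move=> n _ _; rewrite lee_fin.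
    rewrite big_mkord big_ord_recr/= leeDr// sume_ge0// => i _.
    by rewrite lee_fin.
  have f0 : 0 <= fine (G x) by rewrite fine_ge0.
  rewrite -ler_sqr ?nnegrE ?mulr_ge0 ?sqrtr_ge0 ?exprn_ge0 ?invr_ge0//.
  rewrite exprMn sqr_sqrtr// -exprM mulnC exprM exprVn -[X in _ <= _ * X ^+ _]/(_^-1).
  have -> : (2 ^+ 2 : R) = 4 by ring.
  by rewrite exprVn ler_pdivlMr ?exprn_gt0// mulrC real_normK ?num_real.
pose g x := limn (v'^~ x).
have key x : A x -> cvgn (v'^~ x) /\ forall n, (g x - v n x) ^+ 2 <=
     4 * 4^-1 ^+ n * fine (G x).
  move=> Ax; have [c1 c2] := cvgn_geometric_increments (sqrtr_ge0 _) (incr x Ax).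
  rewrite /g v'A//; split => // n; have := c2 n.
  move: (limn _ - _) => z hz.
  have f0 : 0 <= fine (G x) by rewrite fine_ge0.
  have : `|z| ^+ 2 <= (2 * Num.sqrt (fine (G x)) * 2^-1 ^+ n) ^+ 2.
    by rewrite ler_sqr// nnegrE !mulr_ge0 ?sqrtr_ge0 ?exprn_ge0 ?invr_ge0.
  rewrite real_normK ?num_real// !exprMn sqr_sqrtr// -exprM mulnC exprM => /le_trans; apply.
  rewrite le_eqVlt; apply/orP; left; apply/eqP.
  have -> : (2^-1 ^+ 2 : R) = 4^-1 by field.
  ring.
have mg : measurable_fun I g.
  apply: (@measurable_fun_cvg _ _ _ _ v') => [m|x Ix].
    by apply: measurable_funM => //; exact: measurable_indic.
  have [Ax|nAx] := pselect (A x); first exact: (key x Ax).1.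
  have E : v'^~ x = fun=> 0.
    by apply/funext => k; rewrite /v' indicE memNset// mulr0.
  by rewrite E /g E; exact: is_cvg_cst.
exists g; split => // n.
have c4 : 0 <= 4 * 4^-1 ^+ n :> R by rewrite mulr_ge0 ?exprn_ge0 ?invr_ge0.
apply: (@le_trans _ _ (\int[mu]_(x in I) ((4 * 4^-1 ^+ n)%:E * G x))%E).
  apply: ae_ge0_le_integral => //.
  - by move=> x _; rewrite lee_fin sqr_ge0.
  - by apply/measurable_EFinP; apply: measurable_funX; exact: (measurable_funB mg (mv n)).
  - by move=> x _; rewrite mule_ge0.
  - by apply: measurable_funeM.
  - case: (integrable_ae mI Gint) => Z [mZ Z0 sZ]; exists Z; split => // x /= nx.
    apply: sZ => /= Gfin; apply: nx => Ix.
    have := Gfin Ix => Gf; have Ax : A x by split => //; rewrite /= -ge0_fin_numE.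
    rewrite -(fineK Gf) -EFinM lee_fin; exact: (key x Ax).2.
rewrite ge0_integralZl//; rewrite ?lee_fin//.
apply: (@le_trans _ _ ((4 * 4^-1 ^+ n)%:E * 2%:E)%E).
  by apply: lee_wpmul2l => //; rewrite lee_fin.
rewrite -EFinM lee_fin; lra.
Qed.

Lemma riesz_fischer (u : nat -> R -> R[i]) : (forall n, L2 l (u n)) ->
  (forall e : R, 0 < e -> exists N, forall m n, (N <= m)%N -> (N <= n)%N ->
    l2norm l (u m - u n) < e) ->
  exists2 f, L2 l f & l2cvg l u f.
Proof.
move=> Lu cu.
have cu' k : exists N, forall m n, (N <= m)%N -> (N <= n)%N ->
    l2norm l (u m - u n) ^+ 2 <= 8^-1 ^+ k.
  have h0 : 0 < Num.sqrt (8^-1 ^+ k : R) by rewrite sqrtr_gt0 exprn_gt0// invr_gt0.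
  have e0 : 0 <= 8^-1 ^+ k :> R by rewrite exprn_ge0 ?invr_ge0.
  have [N hN] := cu _ h0; exists N => m n Nm Nn; have := ltW (hN m n Nm Nn).
  by rewrite -{2}(sqr_sqrtr e0) ler_sqr ?nnegrE ?l2norm_ge0 ?sqrtr_ge0.
have [ch hch] := choice cu'.
(* A partial sum of the Cauchy ranks dominates [ch k] both at [k] and at [k.+1], so consecutive
   terms of the subsequence [u (p k)] differ by at most [8^-1 ^+ k] in squared norm, as [real_limit]
   requires. *)
pose p k := (\sum_(i < k.+1) ch i)%N.
have pch k : (ch k <= p k)%N by rewrite /p big_ord_recr/= leq_addl.
have pS k : (ch k <= p k.+1)%N by rewrite /p big_ord_recr/= (leq_trans (pch k))// leq_addr.
have dist k : (\int[mu]_(x in I) (sqmod (u (p k.+1) x - u (p k) x))%:E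
    <= (8^-1 ^+ k)%:E)%E.
  have Ld := L2B (Lu (p k.+1)) (Lu (p k)).
  rewrite -[leLHS]fineK; last first.
    exact: (integrable_fin_num mI (L2_sqmod_integrable Ld)).
  rewrite lee_fin; have := hch k _ _ (pS k) (pch k).
  by rewrite /l2norm sqr_sqrtr// Rintegral_ge0// => x _; rewrite sqmod_ge0.
have part (q : R[i] -> R) : (forall a b, q (a - b) = q a - q b) ->
    (forall a, q a ^+ 2 <= sqmod a) ->
    (forall n, measurable_fun I (fun x => q (u n x))) ->
    exists g : R -> R, measurable_fun I g /\ forall n,
    (\int[mu]_(x in I) ((g x - q (u (p n) x)) ^+ 2)%:E <= (8 * 4^-1 ^+ n)%:E)%E.
  move=> qB qle mq; apply: (@real_limit (fun n x => q (u (p n) x))) => // k.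
  apply: le_trans (dist k); apply: ge0_le_integral => //.
  - by move=> x _; rewrite lee_fin sqr_ge0.
  - by apply/measurable_EFinP; apply: measurable_funX; exact: (measurable_funB (mq _) (mq _)).
  - by apply/measurable_EFinP; exact: (L2_measurable_sqmod (L2B (Lu (p k.+1)) (Lu (p k)))).
  - by move=> x _; rewrite lee_fin -qB.
have [gr [mgr hr]] : exists g : R -> R, measurable_fun I g /\ forall n,
    (\int[mu]_(x in I) ((g x - complex.Re (u (p n) x)) ^+ 2)%:E
       <= (8 * 4^-1 ^+ n)%:E)%E.
  apply: part => [a b|a|n]; [by case: a; case: b| |by have [] := Lu n].
  by rewrite /sqmod lerDl sqr_ge0.
have [gi [mgi hi]] : exists g : R -> R, measurable_fun I g /\ forall n,
    (\int[mu]_(x in I) ((g x - complex.Im (u (p n) x)) ^+ 2)%:E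
       <= (8 * 4^-1 ^+ n)%:E)%E.
  apply: part => [a b|a|n]; [by case: a; case: b| |by have [] := Lu n].
  by rewrite /sqmod lerDr sqr_ge0.
pose f x := gr x +i* gi x.
have est n : (\int[mu]_(x in I) (sqmod ((f - u (p n)) x))%:E <= (16 * 4^-1 ^+ n)%:E)%E.
  have [m1 m2 _] := Lu (p n).
  under eq_integral do rewrite EFinD.
  rewrite ge0_integralD//.
  - have -> : 16 * 4^-1 ^+ n = 8 * 4^-1 ^+ n + 8 * 4^-1 ^+ n :> R by lra.
    rewrite EFinD; apply: leeD; first apply: le_trans (hr n); last apply: le_trans (hi n).
      rewrite le_eqVlt; apply/orP; left; apply/eqP; apply: eq_integral => x _.
      by rewrite !fctE /f; case: (u (p n) x).
    rewrite le_eqVlt; apply/orP; left; apply/eqP; apply: eq_integral => x _.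
    by rewrite !fctE /f; case: (u (p n) x).
  - by move=> x _; rewrite lee_fin sqr_ge0.
  - apply/measurable_EFinP; apply: measurable_funX.
    apply: (eq_measurable_fun (fun x => gr x - complex.Re (u (p n) x))).
      by move=> x _; rewrite !fctE /f; case: (u (p n) x).
    exact: (measurable_funB mgr m1).
  - by move=> x _; rewrite lee_fin sqr_ge0.
  - apply/measurable_EFinP; apply: measurable_funX.
    apply: (eq_measurable_fun (fun x => gi x - complex.Im (u (p n) x))).
      by move=> x _; rewrite !fctE /f; case: (u (p n) x).
    exact: (measurable_funB mgi m2).
have Ld n : L2 l (f - u (p n)).
  have [m1 m2 _] := Lu (p n); split.
  - apply: (eq_measurable_fun (fun x => gr x - complex.Re (u (p n) x))).
      by move=> x _; rewrite !fctE /f; case: (u (p n) x).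
    exact: (measurable_funB mgr m1).
  - apply: (eq_measurable_fun (fun x => gi x - complex.Im (u (p n) x))).
      by move=> x _; rewrite !fctE /f; case: (u (p n) x).
    exact: (measurable_funB mgi m2).
  - exact: le_lt_trans (est n) (ltry _).
have Lf : L2 l f by rewrite -(subrK (u (p 0%N)) f); exact: L2D.
have nd n : l2norm l (f - u (p n)) <= 4 * 2^-1 ^+ n.
  have q0 : 0 <= 4 * 2^-1 ^+ n :> R by rewrite mulr_ge0 ?exprn_ge0 ?invr_ge0.
  rewrite -ler_sqr ?nnegrE ?l2norm_ge0//.
  rewrite /l2norm sqr_sqrtr; last by apply: Rintegral_ge0 => x _; exact: sqmod_ge0.
  rewrite exprMn -exprM mulnC exprM; have -> : (2^-1 ^+ 2 : R) = 4^-1 by field.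
  have -> : (4 ^+ 2 : R) = 16 by ring.
  rewrite -lee_fin fineK ?est//.
  exact: (integrable_fin_num mI (L2_sqmod_integrable (Ld n))).
exists f => //.
apply/cvgrPdist_le => e e0.
have [k hk] : exists k, 4 * 2^-1 ^+ k <= e / 2 /\ Num.sqrt (8^-1 ^+ k) <= e / 2.
  have c1 : (fun k => 4 * 2^-1 ^+ k : R) @ \oo --> (0 : R).
    rewrite -(mulr0 4); apply: cvgM; first exact: cvg_cst.
    by apply: cvg_expr; rewrite ger0_norm ?invr_ge0// invf_lt1// ltr1n.
  have e2 : 0 < e / 2 by lra.
  have /cvgrPdist_le/(_ _ e2) [k _ hk] := c1.
  exists k; have := hk k (leqnn k); rewrite /= sub0r normrN => h1.
  have h2 : 4 * 2^-1 ^+ k <= e / 2 by apply: le_trans h1; exact: ler_norm.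
  split => //; apply: le_trans h2.
  have p2 : 0 <= 2^-1 ^+ k :> R by rewrite exprn_ge0 ?invr_ge0.
  rewrite -ler_sqr ?nnegrE ?sqrtr_ge0 ?mulr_ge0// sqr_sqrtr ?exprn_ge0 ?invr_ge0//.
  rewrite exprMn -exprM mulnC exprM; have -> : (2^-1 ^+ 2 : R) = 4^-1 by field.
  have : 8^-1 ^+ k <= 4^-1 ^+ k :> R.
    by apply: lerXn2r; rewrite ?nnegrE ?invr_ge0// lef_pV2 ?posrE// ler_nat.
  have : 0 <= 4^-1 ^+ k :> R by rewrite exprn_ge0 ?invr_ge0.
  lra.
case: hk => k1 k2.
exists (ch k) => // n /= kn; rewrite sub0r normrN ger0_norm ?l2norm_ge0//.
have -> : f - u n = (f - u (p k)) + (u (p k) - u n) by rewrite addrA subrK.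
apply: le_trans (l2norm_triangle (Ld k) (L2B (Lu _) (Lu n))) _.
have a1 := le_trans (nd k) k1.
have a2 : l2norm l (u (p k) - u n) <= e / 2.
  apply: le_trans k2; rewrite -ler_sqr ?nnegrE ?l2norm_ge0 ?sqrtr_ge0//.
  have e0' : 0 <= 8^-1 ^+ k :> R by rewrite exprn_ge0 ?invr_ge0.
  rewrite (sqr_sqrtr e0'); exact: (hch k _ _ (pch k) kn).
lra.
Qed.

End RieszFischer.

(** * Test functions: integration by parts and Poincare's inequality *)

Section TestFunctions.
Context (R : realType) (l : R).
Hypothesis l_gt0 : 0 < l.
Implicit Types (f g h P : R -> R[i]) (p q : R -> R).
Let mu := @lebesgue_measure R.
Let I : set R := `]0, l[%classic.
Let mI : measurable (I : set (measurableTypeR R)). Proof. exact: measurable_itv. Qed.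

Definition realfun p : R -> R[i] := fun x => (p x)%:C.

Lemma derivable_continuous p : (forall x, derivable p x 1) -> continuous p.
Proof.
by move=> dp x; apply: differentiable_continuous; apply/derivable1_diffP.
Qed.

Lemma continuous_integrable p : continuous p -> mu.-integrable I (EFin \o p).
Proof.
move=> cp; apply: (@integrableS _ _ _ mu `[0, l]%classic) => //.
- exact: subset_itv_oo_cc.
- apply: continuous_compact_integrable; first exact: segment_compact.
  exact: continuous_subspaceT.
Qed.

Lemma Rintegral_derive1_eq0 p : (forall x, derivable p x 1) ->
  continuous (derive1 p) -> p 0 = 0 -> p l = 0 ->
  (\int[mu]_(x in I) derive1 p x)%R = 0.
Proof.
move=> dp cp p0 pl; have cont := derivable_continuous dp.
rewrite /I Rintegral_itv_bndo_bndc; last exact: continuous_integrable.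
rewrite Rintegral_itv_obnd_cbnd; last first.
  apply: (@integrableS _ _ _ mu `[0, l]%classic) => //.
  - exact: subset_itv_oc_cc.
  - apply: continuous_compact_integrable; first exact: segment_compact.
    exact: continuous_subspaceT.
have dF : derivable_oo_LRcontinuous p 0 l.
  split.
  - by move=> x _; exact: dp.
  - by apply: cvg_at_right_filter; exact: cont.
  - by apply: cvg_at_left_filter; exact: cont.
have cw : {within `[0, l], continuous (derive1 p)} by exact: continuous_subspaceT.
have := continuous_FTC2 l_gt0 cw dF (fun x _ => erefl).
by rewrite /Rintegral p0 pl -EFinB subrr => ->.
Qed.

Lemma C1c_boundary p : C1c l p -> p 0 = 0 /\ p l = 0.
Proof.
case=> _ _ [a [b [a0 bl pab]]]; split; apply: pab; rewrite negb_and -!ltNge.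
  by rewrite a0.
by rewrite bl orbT.
Qed.

Lemma derive1M p q x : derivable p x 1 -> derivable q x 1 ->
  derivable (p \* q) x 1 /\
  derive1 (p \* q) x = p x * derive1 q x + derive1 p x * q x.
Proof.
move=> dp dq; split; first exact: (derivableM dp dq).
by rewrite !derive1E (deriveM dp dq) /GRing.scale/= [q x * _]mulrC.
Qed.

Lemma C1c_parts p q : C1c l p -> C1c l q ->
  (\int[mu]_(x in I) (p x * derive1 q x))%R =
  - (\int[mu]_(x in I) (derive1 p x * q x))%R.
Proof.
move=> Cp Cq; have [p0 pl] := C1c_boundary Cp.
case: Cp => dp cp' _; case: Cq => dq cq' _.
have cp := derivable_continuous dp; have cq := derivable_continuous dq.
have c1 : continuous (fun x : R => p x * derive1 q x).
  by move=> x; apply: cvgM; [exact: cp|exact: cq'].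
have c2 : continuous (fun x : R => derive1 p x * q x).
  by move=> x; apply: cvgM; [exact: cp'|exact: cq].
have E : derive1 (p \* q) = fun x => p x * derive1 q x + derive1 p x * q x.
  by apply/funext => x; have [_ ->] := derive1M (dp x) (dq x).
apply/eqP; rewrite -subr_eq0 opprK -RintegralD//; try exact: continuous_integrable.
apply/eqP; have := @Rintegral_derive1_eq0 (p \* q).
rewrite E; apply.
- by move=> x; have [] := derive1M (dp x) (dq x).
- by move=> x; apply: cvgD; [exact: c1|exact: c2].
- by rewrite /= p0 mul0r.
- by rewrite /= pl mul0r.
Qed.

Lemma L2_continuous f : continuous (fun x : R => complex.Re (f x)) ->
  continuous (fun x : R => complex.Im (f x)) -> L2 l f.
Proof.
move=> c1 c2; split; try by apply: measurable_funTS; exact: continuous_measurable_fun.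
have c : continuous (fun x : R => sqmod (f x)).
  rewrite (_ : (fun _ => _) = (fun x => complex.Re (f x) * complex.Re (f x) +
      complex.Im (f x) * complex.Im (f x))); last by apply/funext => x; rewrite /sqmod !expr2.
  by move=> x; apply: cvgD; apply: cvgM; (exact: c1 || exact: c2).
have /integrableP[_] := continuous_integrable c.
apply: le_lt_trans; rewrite le_eqVlt; apply/orP; left; apply/eqP.
by apply: eq_integral => x _; rewrite gee0_abs// lee_fin sqmod_ge0.
Qed.

Lemma L2_realfun p : continuous p -> L2 l (realfun p).
Proof.
by move=> cp; apply: L2_continuous => //; exact: cst_continuous.
Qed.

Lemma rinner_realfun p q :
  rinner l (realfun p) (realfun q) = (\int[mu]_(x in I) (p x * q x))%R.
Proof.
rewrite !rinnerE /inner /cintegral /=; apply: eq_Rintegral => x _.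
by rewrite mul0r subr0.
Qed.

(* [p ^ 2] is minus twice [x * p * p'] up to the derivative of [x * p ^ 2]. *)
Lemma poincare_real p : C1c l p ->
  l2norm l (realfun p) ^+ 2 <= 4 * l ^+ 2 * l2norm l (realfun (derive1 p)) ^+ 2.
Proof.
move=> Cp; have [p0 pl] := C1c_boundary Cp; case: Cp => dp cp' _.
have cp := derivable_continuous dp.
have did x : derivable (@id R) x 1 by exact: derivable_id.
have cxp : continuous (fun x : R => x * p x).
  by move=> x; apply: cvgM; [exact: cvg_id|exact: cp].
have dpp x : derivable (p \* p) x 1 /\ derive1 (p \* p) x = 2 * (p x * derive1 p x).
  have [d e] := derive1M (dp x) (dp x); split => //; rewrite e; ring.
have dxp x : derivable (id \* (p \* p)) x 1 /\
    derive1 (id \* (p \* p)) x = 2 * ((x * p x) * derive1 p x) + p x * p x.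
  have [d e] := derive1M (did x) (dpp x).1; split => //; rewrite e (dpp x).2.
  rewrite [derive1 id x]derive1E derive_id /=; ring.
have c1 : continuous (fun x : R => 2 * ((x * p x) * derive1 p x)).
  move=> x; apply: cvgM; first exact: cvg_cst.
  by apply: cvgM; [exact: cxp|exact: cp'].
have c1' : continuous (fun x : R => (x * p x) * derive1 p x).
  by move=> x; apply: cvgM; [exact: cxp|exact: cp'].
have c2 : continuous (fun x : R => p x * p x).
  by move=> x; apply: cvgM; exact: cp.
have E : derive1 (id \* (p \* p)) =
    fun x => 2 * ((x * p x) * derive1 p x) + p x * p x.
  by apply/funext => x; have [_ ->] := dxp x.
have Lp := L2_realfun cp; have Lp' := L2_realfun cp'.
have Lxp := L2_realfun cxp.
have key : 2 * rinner l (realfun (fun x => x * p x)) (realfun (derive1 p)) +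
    l2norm l (realfun p) ^+ 2 = 0.
  rewrite l2norm_sqr !rinner_realfun -RintegralZl//; last exact: continuous_integrable.
  rewrite -RintegralD//; try exact: continuous_integrable.
  have := @Rintegral_derive1_eq0 (id \* (p \* p)); rewrite E; apply.
  - by move=> x; have [] := dxp x.
  - by move=> x; apply: cvgD; [exact: c1|exact: c2].
  - by rewrite /= mul0r.
  - by rewrite /= pl mul0r mulr0.
have xp : l2norm l (realfun (fun x => x * p x)) ^+ 2 <= l ^+ 2 * l2norm l (realfun p) ^+ 2.
  rewrite !l2norm_sqr !rinner_realfun -RintegralZl//; last exact: continuous_integrable.
  apply: le_Rintegral => //.
  - by apply: continuous_integrable => x; apply: cvgM; exact: cxp.
  - apply: continuous_integrable => x; apply: cvgM; first exact: cvg_cst.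
    exact: c2.
  - move=> x; rewrite /I/= in_itv/= => /andP[x0 xl].
    have -> : x * p x * (x * p x) = x ^+ 2 * (p x * p x) by ring.
    by rewrite ler_wpM2r// -?expr2 ?sqr_ge0// ler_sqr ?nnegrE ?ltW.
have := rinner_CS Lxp Lp'; rewrite ler_norml => /andP[+ _].
move: key xp (l2norm_ge0 l (realfun p)) (l2norm_ge0 l (realfun (derive1 p)))
  (l2norm_ge0 l (realfun (fun x => x * p x))).
move: (rinner l _ _) (l2norm l (realfun p)) (l2norm l (realfun (derive1 p)))
  (l2norm l (realfun (fun x => x * p x))) => r a b d key xp a0 b0 d0 cs.
(* Here [a = |p|], [b = |p'|] and [d = |x p|] are L^2 norms: [a ^ 2 = - 2 * r <= 2 * d * b <= 2 * l
   * a * b], and a factor [a] is cancelled when it is nonzero. *)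
have lda : d <= l * a.
  by rewrite -ler_sqr ?nnegrE ?(mulr_ge0 (ltW l_gt0))// exprMn.
have h1 : a ^+ 2 <= 2 * (d * b) by lra.
have h2 : d * b <= l * a * b by rewrite ler_wpM2r.
have [a00|an0] := eqVneq a 0.
  by rewrite a00 expr0n/=; have := sqr_ge0 (l * b); lra.
have h3 : a <= 2 * l * b.
  by rewrite -(@ler_pM2l _ a)// ?lt_def ?an0//; lra.
have : a ^+ 2 <= (2 * l * b) ^+ 2.
  by rewrite ler_sqr// nnegrE (le_trans a0).
lra.
Qed.

Definition complex_test P : Prop :=
  C1c l (fun x => complex.Re (P x)) /\ C1c l (fun x => complex.Im (P x)).

Definition test_derivative P : R -> R[i] := fun x =>
  derive1 (fun x => complex.Re (P x)) x +i* derive1 (fun x => complex.Im (P x)) x.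

Lemma realfun_ReIm P :
  P = realfun (fun x => complex.Re (P x)) + 'i *: realfun (fun x => complex.Im (P x)).
Proof.
apply/funext => x; rewrite fctE /realfun fctE.
by case: (P x) => a b; apply: complex_eq; rewrite /=; ring.
Qed.

Lemma test_derivative_ReIm P : test_derivative P =
  realfun (derive1 (fun x => complex.Re (P x))) +
  'i *: realfun (derive1 (fun x => complex.Im (P x))).
Proof. by rewrite {1}[LHS]realfun_ReIm. Qed.

Lemma L2_test P : complex_test P -> L2 l P /\ L2 l (test_derivative P).
Proof.
move=> [[d1 c1 _] [d2 c2 _]]; split; last exact: (@L2_continuous (test_derivative P) c1 c2).
exact: (L2_continuous (derivable_continuous d1) (derivable_continuous d2)).
Qed.

(** For real [p] and [q] the product [<p, i q>] is purely imaginary, so the cross term vanishes.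
    This carries Poincare's inequality from real to complex test functions. *)
Lemma l2norm_ReIm p q : continuous p -> continuous q ->
  l2norm l (realfun p + 'i *: realfun q) ^+ 2 =
  l2norm l (realfun p) ^+ 2 + l2norm l (realfun q) ^+ 2.
Proof.
move=> cp cq; have Lp := L2_realfun cp; have Lq := L2_realfun cq.
have Liq : L2 l ('i *: realfun q) by exact: L2Z.
rewrite !l2norm_sqr (form_sqD (L2_subspace l) (rinner_form l))//.
have -> : rinner l (realfun p) ('i *: realfun q) = 0.
  rewrite rinnerC// !rinnerE innerZl// ReM /= mul0r sub0r mul1r.
  have -> : (\int[mu]_(x in I) complex.Im (realfun q x * conjc (realfun p x)))%R
     = (\int[mu]_(x in I) cst 0 x)%R.
    by apply: eq_Rintegral => x _; rewrite /=; ring.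
  by rewrite Rintegral_cst// mul0r oppr0.
rewrite mulr0 addr0; congr (_ + _).
by rewrite rinner_sqZ// /sqmod /= expr0n expr1n /= add0r mul1r.
Qed.

Lemma poincare_test P : complex_test P ->
  l2norm l P ^+ 2 <= 4 * l ^+ 2 * l2norm l (test_derivative P) ^+ 2.
Proof.
move=> [C1 C2]; rewrite test_derivative_ReIm {1}(realfun_ReIm P).
have [d1 c1 _] := C1; have [d2 c2 _] := C2.
rewrite (l2norm_ReIm (derivable_continuous d1) (derivable_continuous d2)).
by rewrite (l2norm_ReIm c1 c2) mulrDr lerD// poincare_real.
Qed.

Lemma weak_derivativeE f g : is_weak_derivative l f g <->
  L2 l g /\ forall p, C1c l p ->
    inner l f (realfun (derive1 p)) = - inner l g (realfun p).
Proof.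
have E h q : inner l h (realfun q) = cintegral l (fun x => h x * (q x)%:C).
  rewrite /inner; congr cintegral; apply/funext => x; rewrite /realfun.
  by congr (_ * _); apply: complex_eq; rewrite /= ?oppr0.
by split=> -[Lg hg]; split => // p /hg; rewrite !E.
Qed.

Lemma weak_derivative_test f g P : L2 l f -> is_weak_derivative l f g ->
  complex_test P -> inner l f (test_derivative P) = - inner l g P.
Proof.
move=> Lf /weak_derivativeE[Lg W] [C1 C2].
have [d1 c1 _] := C1; have [d2 c2 _] := C2.
have L1 := L2_realfun c1; have L2' := L2_realfun c2.
have L3 := L2_realfun (derivable_continuous d1).
have L4 := L2_realfun (derivable_continuous d2).
have split2 h u v : L2 l h -> L2 l u -> L2 l v ->
    inner l h (u + 'i *: v) = inner l h u + conjc 'i * inner l h v.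
  move=> Lh Lu Lv; have Liv : L2 l ('i *: v) by exact: L2Z.
  by rewrite innerDr// innerZr.
rewrite test_derivative_ReIm [in RHS](realfun_ReIm P).
rewrite (split2 f _ _ Lf L1 L2') (split2 g _ _ Lg L3 L4) (W _ C1) (W _ C2).
by rewrite mulrN opprD.
Qed.

Lemma test_weak_derivative P : complex_test P ->
  is_weak_derivative l P (test_derivative P).
Proof.
move=> CP; have [LP LP'] := L2_test CP; apply/weak_derivativeE; split => // p Cp.
have [C1 C2] := CP; have [d1 c1 _] := C1; have [d2 c2 _] := C2.
have [dp cp _] := Cp.
have IE q r : continuous q -> continuous r ->
    inner l (realfun q) (realfun r) = (\int[mu]_(x in I) (q x * r x))%R%:C.
  move=> cq cr; apply: complex_eq; first by rewrite -rinnerE rinner_realfun.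
  rewrite /inner /cintegral /=; transitivity (\int[mu]_(x in I) cst 0 x)%R.
    by apply: eq_Rintegral => x _; rewrite /=; ring.
  by rewrite Rintegral_cst// mul0r.
rewrite test_derivative_ReIm [X in inner l X _ = _](realfun_ReIm P).
have L1 := L2_realfun c1; have L2' := L2_realfun c2.
have L3 := L2_realfun (derivable_continuous d1).
have L4 := L2_realfun (derivable_continuous d2).
have L5 := L2_realfun cp; have L6 := L2_realfun (derivable_continuous dp).
have Li h : L2 l h -> L2 l ('i *: h) by exact: L2Z.
rewrite (innerDl L3 (Li _ L4) L5) (innerDl L1 (Li _ L2') L6).
rewrite (innerZl 'i L4 L5) (innerZl 'i L2' L6).
have c5 := derivable_continuous dp.
have c3 := derivable_continuous d1.
have c4 := derivable_continuous d2.
rewrite (IE _ _ c3 cp) (IE _ _ c4 cp) (IE _ _ c1 c5) (IE _ _ c2 c5)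
  (C1c_parts C1 Cp) (C1c_parts C2 Cp).
by move: (\int[mu]_(x in I) _)%R (\int[mu]_(x in I) _)%R => a b;
   apply: complex_eq; rewrite /=; ring.
Qed.

End TestFunctions.

Lemma cvgn_unique (R : realType) (u : nat -> R) (a b : R) :
  u @ \oo --> a -> u @ \oo --> b -> a = b.
Proof. by move=> ua ub; rewrite -(cvg_lim _ ua)// -(cvg_lim _ ub). Qed.

Lemma cvgn_ext (R : realType) (u v : nat -> R) (a : R) :
  (forall n, u n = v n) -> u @ \oo --> a -> v @ \oo --> a.
Proof. by move=> /funext ->. Qed.

(** Locked, like [rinner], so that the choice of a representative stays opaque; [coef], [fpow] and
    [lopA] are locked copies in the same spirit. *)
HB.lock Definition wdx (R : realType) (l : R) (f : R -> R[i]) : R -> R[i] := dx l f.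

Lemma wdxE (R : realType) (l : R) (f : R -> R[i]) : dx l f = wdx l f.
Proof. by rewrite wdx.unlock. Qed.

(** * Weak derivatives, and H^1_0 by duality *)

Section WeakDerivative.
Context (R : realType) (l : R).
Hypothesis l_gt0 : 0 < l.
Implicit Types (f g h k : R -> R[i]) (p q : R -> R).

Lemma weak_derivative_L2 f g : is_weak_derivative l f g -> L2 l g.
Proof. by case. Qed.

Lemma weak_derivative_linear (a : R[i]) f f' g g' : L2 l f -> L2 l g ->
  is_weak_derivative l f f' -> is_weak_derivative l g g' ->
  is_weak_derivative l (a *: f + g) (a *: f' + g').
Proof.
move=> Lf Lg /weak_derivativeE[Lf' Wf] /weak_derivativeE[Lg' Wg].
apply/weak_derivativeE; split; first exact: (L2_subspace l).2.
move=> p Cp; have [dp cp _] := Cp.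
have L1 := L2_realfun l cp.
have L2' := L2_realfun l (derivable_continuous dp).
rewrite (inner_linear a Lf Lg L1) (inner_linear a Lf' Lg' L2').
by rewrite (Wf _ Cp) (Wg _ Cp) mulrN opprD.
Qed.

Lemma weak_derivativeB f f' g g' : L2 l f -> L2 l g ->
  is_weak_derivative l f f' -> is_weak_derivative l g g' ->
  is_weak_derivative l (f - g) (f' - g').
Proof.
move=> Lf Lg Wf Wg; have := weak_derivative_linear (-1) Lg Lf Wg Wf.
by rewrite !scaleN1r [- g + f]addrC [- g' + f']addrC.
Qed.

Lemma weak_derivative_congr f g f' g' : L2 l f -> L2 l g -> L2 l g' ->
  l2norm l (f - g) = 0 -> l2norm l (f' - g') = 0 ->
  is_weak_derivative l f f' -> is_weak_derivative l g g'.
Proof.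
move=> Lf Lg Lg' fg fg' /weak_derivativeE[Lf' Wf].
apply/weak_derivativeE; split => // p Cp; have [dp cp _] := Cp.
have L1 := L2_realfun l cp.
have L2' := L2_realfun l (derivable_continuous dp).
by rewrite -(inner_congrl Lf Lg L1 fg) -(inner_congrl Lf' Lg' L2' fg') Wf.
Qed.

(* The derivatives of elements of H^1_0, characterized by integration by parts
   against all of H^1 instead of by approximation. *)
Definition h10 f f' : Prop :=
  [/\ L2 l f, L2 l f' & forall h h', L2 l h -> is_weak_derivative l h h' ->
    inner l h' f = - inner l h f'].

(** A test function is itself in H^1, so it may be taken as [h]; conjugating the identity exchanges
    the two slots of the inner product. *)
Lemma h10_weak f f' : h10 f f' -> is_weak_derivative l f f'.
Proof.
move=> [Lf Lf' hf]; apply/weak_derivativeE; split => // p Cp.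
have [dp cp _] := Cp.
have L1 := L2_realfun l cp.
have L2' := L2_realfun l (derivable_continuous dp).
have E0 : derive1 (fun=> 0 : R) = fun=> 0.
  by apply/funext => x; rewrite derive1E derive_cst.
have Cp' : complex_test l (realfun p).
  split; first exact: Cp.
  have [a [b [a0 bl ab]]] : exists a b : R, [/\ 0 < a, b < l &
    forall x, ~~ (a <= x <= b) -> p x = 0] by case: Cp.
  split.
  - by move=> x; exact: derivable_cst.
  - by rewrite E0; exact: cst_continuous.
  - by exists a, b.
have W := test_weak_derivative l_gt0 Cp'.
have E1 : test_derivative (realfun p) = realfun (derive1 p).
  by apply/funext => x; rewrite /test_derivative /realfun /= E0.
rewrite E1 in W; have := hf _ _ L2' W.
rewrite (innerC Lf L1) (innerC Lf' L2').
case: (inner l f _) => a b; case: (inner l f' _) => c d /= [-> E].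
by apply: complex_eq => //=; apply: oppr_inj.
Qed.

Lemma h10_linear (a : R[i]) f f' g g' : h10 f f' -> h10 g g' ->
  h10 (a *: f + g) (a *: f' + g').
Proof.
move=> [Lf Lf' hf] [Lg Lg' hg]; split; try exact: (L2_subspace l).2.
move=> h h' Lh W; have Lh' := weak_derivative_L2 W.
rewrite (innerDr (L2Z a Lf) Lg Lh') (innerDr (L2Z a Lf') Lg' Lh).
by rewrite (innerZr a Lf Lh') (innerZr a Lf' Lh) (hf _ _ Lh W) (hg _ _ Lh W) mulrN opprD.
Qed.

Lemma h10_0 : h10 0 0.
Proof.
have L0 := L2_0 l; split => // h h' Lh W; have Lh' := weak_derivative_L2 W.
rewrite (innerC L0 Lh) (innerC L0 Lh') !inner0l//.
by rewrite rmorph0 oppr0.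
Qed.

Lemma h10_sum (N : nat) (a : nat -> R[i]) (f f' : nat -> R -> R[i]) :
  (forall n, h10 (f n) (f' n)) ->
  h10 (\sum_(n < N) a n *: f n) (\sum_(n < N) a n *: f' n).
Proof.
move=> hf; elim: N => [|N IH]; first by rewrite !big_ord0; exact: h10_0.
rewrite !big_ord_recr/= ![_ + a N *: _]addrC; exact: h10_linear.
Qed.

Lemma h10_congr f f' g g' : L2 l g -> L2 l g' ->
  l2norm l (f - g) = 0 -> l2norm l (f' - g') = 0 -> h10 f f' -> h10 g g'.
Proof.
move=> Lg Lg' fg fg' [Lf Lf' hf]; split => // h h' Lh W.
have Lh' := weak_derivative_L2 W.
by rewrite -(inner_congrr Lf Lg Lh' fg) -(inner_congrr Lf' Lg' Lh fg') (hf _ _ Lh W).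
Qed.

Lemma h10_test P : complex_test l P -> h10 P (test_derivative P).
Proof.
move=> CP; have [LP LP'] := L2_test CP; split => // h h' Lh W.
by rewrite (weak_derivative_test Lh W CP) opprK.
Qed.

(** Integration by parts against a fixed [h] is an identity between continuous functionals of [f]
    and of [f'], so it survives L^2 limits. This stability is what the description by duality is
    for. *)
Lemma h10_closed u u' f f' : L2 l f -> L2 l f' -> (forall n, h10 (u n) (u' n)) ->
  l2cvg l u f -> l2cvg l u' f' -> h10 f f'.
Proof.
move=> Lf Lf' hu cu cu'; split => // h h' Lh W.
have Lu n : L2 l (u n) by case: (hu n).
have Lu' n : L2 l (u' n) by case: (hu n).
have Lh' := weak_derivative_L2 W.
have LNh : L2 l (- h) by rewrite -scaleN1r; exact: L2Z.
rewrite -(innerNl Lh Lf'); apply: inner_eq_rinner => // a.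
have L1 := L2Z a Lh'; have L2' := L2Z a LNh.
have c1 := rinner_cvg L1 Lf (fun=> L1) Lu (l2cvg_cst _ _) cu.
have c2 := rinner_cvg L2' Lf' (fun=> L2') Lu' (l2cvg_cst _ _) cu'.
apply: (cvgn_unique c1); rewrite (_ : (fun n => _) =
  (fun n => rinner l (a *: - h) (u' n)))//.
apply/funext => n; rewrite !rinnerE (innerZl a Lh' (Lu n)) (innerZl a LNh (Lu' n)).
by rewrite (innerNl Lh (Lu' n)); have [_ _ /(_ _ _ Lh W) ->] := hu n.
Qed.

Lemma dx_weak f g : is_weak_derivative l f g -> is_weak_derivative l f (wdx l f).
Proof.
move=> W; rewrite -wdxE.
by apply: (@xgetPex _ 0 [set g | is_weak_derivative l f g]); exists g.
Qed.

End WeakDerivative.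

HB.lock Definition coef (R : realType) (l : R) (e : nat -> R -> R[i]) (f : R -> R[i]) (n : nat) :
  R[i] := inner l f (e n).

Lemma coefE (R : realType) (l : R) (e : nat -> R -> R[i]) (f : R -> R[i]) (n : nat) :
  inner l f (e n) = coef l e f n.
Proof. by rewrite coef.unlock. Qed.

(** * Weak derivatives and Green's formula in the presence of an eigenbasis *)

Section Eigenbasis.
Context (R : realType) (l : R) (e : nat -> R -> R[i]) (lam : nat -> R).
Hypotheses (l_gt0 : 0 < l) (eb : eigenbasis l e lam).
Implicit Types (f g h : R -> R[i]).

Local Notation coef := (coef l e).

Definition psum f N := \sum_(n < N) coef f n *: e n.

Lemma DA_e n : DA l (e n). Proof. by case: eb => /(_ n)[]. Qed.

Lemma lam_gt0 n : 0 < lam n. Proof. by case: eb => /(_ n)[]. Qed.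

Lemma L2_e n : L2 l (e n). Proof. by have [[]] := DA_e n. Qed.

Lemma inner_e m n : inner l (e m) (e n) = (m == n)%:R.
Proof. by case: eb. Qed.

Lemma psum_cvg f : L2 l f -> l2cvg l (psum f) f.
Proof.
case: eb => _ _ /[apply]; rewrite /l2cvg /psum.
by under [X in _ -> X @ _ --> _]eq_fun do under eq_bigr do rewrite -coefE.
Qed.

Lemma L2_psum f N : L2 l (psum f N).
Proof. by apply: L2_sum => n _; apply: L2Z; exact: L2_e. Qed.

Lemma coef_eq0 f : L2 l f -> (forall n, coef f n = 0) -> l2norm l f = 0.
Proof.
move=> Lf f0; have := psum_cvg Lf; rewrite /l2cvg (_ : (fun n => _) = fun=> l2norm l f).
  by move=> c; apply: (cvgn_unique _ c) => //; exact: cvg_cst.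
apply/funext => N; congr (l2norm l _); rewrite /psum big1 ?subr0// => n _.
by rewrite f0 scale0r.
Qed.

Lemma coef_inj f g : L2 l f -> L2 l g -> (forall n, coef f n = coef g n) ->
  l2norm l (f - g) = 0.
Proof.
move=> Lf Lg fg; apply: coef_eq0; first exact: L2B.
by move=> n; rewrite -coefE (innerBl Lf Lg (L2_e n)) !coefE fg subrr.
Qed.

Lemma coef_linear (a : R[i]) f g n : L2 l f -> L2 l g ->
  coef (a *: f + g) n = a * coef f n + coef g n.
Proof. by move=> Lf Lg; rewrite -!coefE; exact: (inner_linear a Lf Lg (L2_e n)). Qed.

Lemma coefB f g n : L2 l f -> L2 l g -> coef (f - g) n = coef f n - coef g n.
Proof. by move=> Lf Lg; rewrite -!coefE; exact: (innerBl Lf Lg (L2_e n)). Qed.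

Lemma H10_approx f : H10 l f -> L2 l f /\ exists2 P : nat -> R -> R[i],
  forall n, complex_test l (P n) &
  l2cvg l P f /\ (fun n => l2norm l (wdx l (f - P n))) @ \oo --> (0 : R).
Proof.
move=> [[Lf _] [P [CP cP']]]; split => //; exists P => //.
have cP : (fun n => l2norm l (f - P n) ^+ 2 + l2norm l (wdx l (f - P n)) ^+ 2) @ \oo --> (0 : R).
  by apply: cvgn_ext cP' => n; rewrite wdxE.
have aux (a b : nat -> R) : (forall n, 0 <= a n) ->
    (fun n => a n ^+ 2 + b n ^+ 2) @ \oo --> (0 : R) -> a @ \oo --> (0 : R).
  move=> a0 ab.
  have c : (fun n => Num.sqrt (a n ^+ 2 + b n ^+ 2)) @ \oo --> (0 : R).
    rewrite -[0]sqrtr0; apply: (cvg_comp _ _ ab); exact: sqrt_continuous.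
  apply: (@squeeze_cvgr _ _ _ _ (fun=> 0) _ _ _ _ _ c); last exact: cvg_cst.
  apply: nearW => n; rewrite a0/= -[leLHS]ger0_norm// -sqrtr_sqr.
  by rewrite ler_sqrt ?addr_ge0 ?sqr_ge0// lerDl sqr_ge0.
split; first by apply: (aux _ (fun n => l2norm l (wdx l (f - P n)))) => // n; exact: l2norm_ge0.
apply: (aux _ (fun n => l2norm l (f - P n))); first by move=> n; exact: l2norm_ge0.
rewrite (_ : (fun n => _) = (fun n => l2norm l (f - P n) ^+ 2 +
  l2norm l (wdx l (f - P n)) ^+ 2))//.
by apply/funext => n; rewrite addrC.
Qed.

(** The difference [g - g'] is orthogonal to all test functions. Each [e n] is in H^1_0, hence an
    L^2 limit of test functions, so all coefficients of [g - g'] vanish and completeness of the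
    eigenbasis concludes. *)
Lemma weak_derivative_unique f g g' : L2 l f ->
  is_weak_derivative l f g -> is_weak_derivative l f g' -> l2norm l (g - g') = 0.
Proof.
move=> Lf W W'; have Lg := weak_derivative_L2 W; have Lg' := weak_derivative_L2 W'.
have Ld := L2B Lg Lg'.
apply: coef_eq0 => // n.
have [_ [P CP [cP _]]] := H10_approx (DA_e n).2.
have LP k := (L2_test (CP k)).1.
rewrite -coefE -(inner0l (L2_e n)).
apply: inner_eq_rinner => //; [exact: L2_e|exact: L2_0|exact: L2_e|] => a.
have La := L2Z a Ld.
have c1 := rinner_cvg La (L2_e n) (fun=> La) LP (l2cvg_cst _ _) cP.
apply: (cvgn_unique c1); rewrite (_ : (fun n => _) = fun=> 0).
  by rewrite scaler0 !rinnerE inner0l//; [exact: cvg_cst|exact: L2_e].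
apply/funext => k; rewrite !rinnerE (innerZl a Ld (LP k)) (innerBl Lg Lg' (LP k)).
have := weak_derivative_test Lf W (CP k).
rewrite (weak_derivative_test Lf W' (CP k)) => /oppr_inj ->.
by rewrite subrr mulr0.
Qed.

Lemma dx_null f g : L2 l f -> is_weak_derivative l f g -> l2norm l (wdx l f - g) = 0.
Proof. by move=> Lf W; exact: (weak_derivative_unique Lf (dx_weak W)). Qed.

Lemma L2_dx f g : is_weak_derivative l f g -> L2 l (wdx l f).
Proof. by move=> /dx_weak/weak_derivative_L2. Qed.

Lemma h10_dx f f' : h10 l f f' -> h10 l f (wdx l f) /\ l2norm l (wdx l f - f') = 0.
Proof.
move=> hf; have [Lf Lf' _] := hf; have W := h10_weak l_gt0 hf.
have d0 := dx_null Lf W; have Ld := L2_dx W; split => //.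
apply: h10_congr hf => //; first by rewrite subrr l2norm0.
by rewrite l2normC.
Qed.

(** Test functions approximate [f] together with its derivative, and [h10] is closed. The definition
    of [H10] measures [dx (f - P n)], which agrees with [wdx l f - test_derivative (P n)] up to a
    null function by uniqueness. *)
Lemma H10_h10 f : H10 l f -> h10 l f (wdx l f).
Proof.
move=> Hf; have [Lf [P CP [cP cP']]] := H10_approx Hf.
have [[_ [g [W _]]] _] := Hf; have Wd := dx_weak W.
have LP k := (L2_test (CP k)).1; have LP' k := (L2_test (CP k)).2.
apply: (h10_closed Lf (weak_derivative_L2 Wd) (fun k => h10_test (CP k)) cP).
rewrite /l2cvg (_ : (fun n => _) = (fun n => l2norm l (wdx l (f - P n))))//.
apply/funext => n.
have Wn : is_weak_derivative l (f - P n) (wdx l f - test_derivative (P n)).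
  exact: (weak_derivativeB Lf (LP n) Wd (test_weak_derivative l_gt0 (CP n))).
have Ld := L2B (weak_derivative_L2 Wd) (LP' n).
rewrite -(l2norm_congr (L2_dx Wn) Ld)//.
exact: (dx_null (L2B Lf (LP n)) Wn).
Qed.

Lemma DA_h10 f : DA l f -> h10 l f (wdx l f).
Proof. by case=> _ /H10_h10. Qed.

Lemma sobolev2_weak f : sobolev l 2 f -> [/\ L2 l f, is_weak_derivative l f (wdx l f) &
  is_weak_derivative l (wdx l f) (wdx l (wdx l f))].
Proof.
move=> [Lf [g [W [Lg [g2 [W2 _]]]]]].
have d0 := dx_null Lf W; have Ld := L2_dx W.
split; [exact: Lf|exact: dx_weak W|].
apply: (@dx_weak _ _ _ g2).
apply: (weak_derivative_congr Lg Ld _ _ _ W2).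
- exact: weak_derivative_L2 W2.
- by rewrite l2normC.
- by rewrite subrr l2norm0.
Qed.

Lemma L2_opA f : sobolev l 2 f -> L2 l (opA l f).
Proof.
move=> /sobolev2_weak[_ _ /weak_derivative_L2 Lf]; rewrite /opA !wdxE -scaleN1r; exact: L2Z.
Qed.

Lemma DA_L2_opA f : DA l f -> L2 l (opA l f).
Proof. by case=> /L2_opA. Qed.

(** Green's formula: the boundary term vanishes because of [k] alone, [f] carrying no boundary
    condition. *)
Lemma inner_opA f k k' : sobolev l 2 f -> h10 l k k' ->
  inner l (opA l f) k = inner l (wdx l f) k'.
Proof.
move=> /sobolev2_weak[Lf W W2] [Lk Lk' hk]; have Ldd := weak_derivative_L2 W2.
by rewrite /opA !wdxE (innerNl Ldd Lk) (hk _ _ (weak_derivative_L2 W) W2) opprK.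
Qed.

Lemma opA_e n : l2norm l (opA l (e n) - (lam n)%:C *: e n) = 0.
Proof.
have [/(_ n)[De _ ae] _ _] := eb.
apply: l2norm_ae0; first by apply: L2B; [exact: DA_L2_opA|exact: L2Z (L2_e n)].
case: ae => A [mA A0 sA]; exists A; split => // x /= nx; apply: sA => /= fx.
by apply: nx => Ix; rewrite !fctE fx// subrr.
Qed.

Lemma inner_opA_e n f : L2 l f -> inner l (opA l (e n)) f = (lam n)%:C * inner l (e n) f.
Proof.
move=> Lf; rewrite (inner_congrl _ _ _ (opA_e n))//.
- exact: innerZl (L2_e n) Lf.
- exact: DA_L2_opA (DA_e n).
- exact: L2Z (L2_e n).
Qed.

(** Green's formula combined with the eigenvalue equation. With [f = e m] it says that the
    derivatives of the [e n] are orthogonal with squared norms [lam n]. *)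
Lemma inner_dx_e f f' n : h10 l f f' ->
  inner l f' (wdx l (e n)) = (lam n)%:C * coef f n.
Proof.
move=> hf; have [Lf Lf' _] := hf; have [_ Le' _] := DA_h10 (DA_e n).
rewrite (innerC Le' Lf') -(inner_opA (DA_e n).1 hf) (inner_opA_e n Lf) rmorphM/=.
rewrite oppr0 -coefE (innerC (L2_e n) Lf).
by congr (_ * _).
Qed.

Lemma coef_opA f n : sobolev l 2 f -> h10 l f (wdx l f) -> coef (opA l f) n = (lam n)%:C * coef f n.
Proof.
move=> Sf hf; rewrite -coefE (inner_opA Sf (DA_h10 (DA_e n))).
by rewrite (inner_dx_e n hf).
Qed.

(** [lam n] is the squared norm of the derivative of the unit vector [e n], so this is Poincare's
    inequality, carried to the limit from test functions approximating [e n] in H^1. *)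
Lemma lam_lower n : 1 <= 4 * l ^+ 2 * lam n.
Proof.
have [_ [P CP [cP cP']]] := H10_approx (DA_e n).2.
have he := DA_h10 (DA_e n); have [Le Le' _] := he.
have LP k := (L2_test (CP k)).1; have LP' k := (L2_test (CP k)).2.
have W := dx_weak (h10_weak l_gt0 he).
have cd : l2cvg l (fun k => test_derivative (P k)) (wdx l (e n)).
  rewrite /l2cvg (_ : (fun n => _) = (fun k => l2norm l (wdx l (e n - P k))))//.
  apply/funext => k.
  have Wn : is_weak_derivative l (e n - P k) (wdx l (e n) - test_derivative (P k)).
    exact: (weak_derivativeB Le (LP k) W (test_weak_derivative l_gt0 (CP k))).
  have Ld := L2B Le' (LP' k).
  by rewrite -(l2norm_congr (L2_dx Wn) Ld)//; exact: (dx_null (L2B Le (LP k)) Wn).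
have c1 := rinner_cvg Le Le LP LP cP cP.
have c2 := rinner_cvg Le' Le' LP' LP' cd cd.
have E1 : rinner l (e n) (e n) = 1 by rewrite !rinnerE inner_e eqxx.
have E2 : rinner l (wdx l (e n)) (wdx l (e n)) = lam n.
  by rewrite !rinnerE (inner_dx_e n he) -coefE inner_e eqxx mulr1.
rewrite -[leLHS]E1 -E2 -subr_ge0.
have c3 : (fun k => 4 * l ^+ 2 * rinner l (test_derivative (P k)) (test_derivative (P k))
    - rinner l (P k) (P k)) @ \oo -->
    4 * l ^+ 2 * rinner l (wdx l (e n)) (wdx l (e n)) - rinner l (e n) (e n).
  by apply: cvgB => //; apply: cvgM => //; exact: cvg_cst.
rewrite -(cvg_lim _ c3)//; apply: limr_ge; first by apply/cvg_ex; eexists; exact: c3.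
apply: nearW => k /=; rewrite subr_ge0 -!l2norm_sqr.
exact: poincare_test.
Qed.

End Eigenbasis.

HB.lock Definition fpow (R : realType) (l s : R) (f : R -> R[i]) : R -> R[i] := powA l s f.

Lemma fpowE (R : realType) (l s : R) (f : R -> R[i]) : powA l s f = fpow l s f.
Proof. by rewrite fpow.unlock. Qed.

(** * Fractional powers of A through coefficients *)

Section SpectralCalculus.
Context (R : realType) (l : R) (e : nat -> R -> R[i]) (lam : nat -> R).
Hypotheses (l_gt0 : 0 < l) (eb : eigenbasis l e lam).
Implicit Types (f g h : R -> R[i]).
Local Notation cf := (coef l e).
Local Notation ps := (psum l e).
Local Notation L2e := (L2_e eb).
Local Notation lam0 := (lam_gt0 eb).

(** The eigenbasis inside [is_powA] need not be [e]. If [<e' m, e n>] is nonzero, evaluating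
    [<A (e' m), e n>] in two ways shows [lam' m = lam n], so [lam' m ^ s] may be replaced by
    [lam n ^ s] in every term contributing to the coefficient of [g] along [e n]. *)
Lemma coef_powA s f g n : is_powA l s f g -> cf g n = (lam n `^ s)%:C * cf f n.
Proof.
move=> [Lf Lg [e' [lam' [eb' cg]]]].
pose P N := \sum_(m < N) ((lam' m `^ s)%:C * inner l f (e' m)) *: e' m.
have LP N : L2 l (P N).
  by apply: L2_sum => m _; apply: L2Z; exact: (L2_e eb').
have cP : l2cvg l P g by exact: cg.
have L1 : L2 l ((lam n `^ s)%:C *: f) by exact: L2Z.
have swap m : (lam' m `^ s)%:C * inner l (e' m) (e n) =
    (lam n `^ s)%:C * inner l (e' m) (e n).
  have [->|nz] := eqVneq (inner l (e' m) (e n)) 0; first by rewrite !mulr0.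
  have := inner_opA_e eb' m (L2e n).
  rewrite coefE.
  rewrite (coef_opA l_gt0 eb n (DA_e eb' m).1 (DA_h10 l_gt0 eb' (DA_e eb' m))).
  by rewrite -coefE => /(mulIf nz) [->].
rewrite -!coefE -(innerZl _ Lf (L2e n)).
apply: (inner_eq_rinner Lg (L2e n) L1 (L2e n)) => a.
have c1 := rinner_cvg (L2Z a Lg) (L2e n) (fun N => L2Z a (LP N)) (fun=> L2e n)
  (l2cvgZ a Lg LP cP) (l2cvg_cst _ _).
have LQ N := L2_psum eb' f N.
have LQ' N : L2 l ((lam n `^ s)%:C *: psum l e' f N) by apply: L2Z; exact: LQ.
have c2 := rinner_cvg (L2Z a L1) (L2e n) (fun N => L2Z a (LQ' N)) (fun=> L2e n)
  (l2cvgZ a L1 LQ' (l2cvgZ _ Lf LQ (psum_cvg eb' Lf))) (l2cvg_cst _ _).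
apply: (cvgn_unique c1); apply: cvgn_ext c2 => N; rewrite !rinnerE; congr complex.Re.
rewrite (innerZl a (LQ' N) (L2e n)) (innerZl a (LP N) (L2e n)); congr (_ * _).
rewrite (innerZl _ (LQ N) (L2e n)) /psum /P.
rewrite !inner_suml; try (by move=> m; exact: (L2_e eb')); try exact: L2e.
rewrite mulr_sumr; apply: eq_bigr => m _; rewrite -coefE.
by rewrite mulrAC swap; ring.
Qed.

Lemma is_powA_coef s f g : L2 l f -> L2 l g ->
  (forall n, cf g n = (lam n `^ s)%:C * cf f n) -> is_powA l s f g.
Proof.
move=> Lf Lg h; split; [exact: Lf|exact: Lg|exists e, lam; split; first exact: eb].
apply: cvgn_ext (psum_cvg eb Lg) => N; congr (l2norm l (g - _)); apply: eq_bigr => n _.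
by rewrite h coefE.
Qed.

Lemma powA_spec s f : DpowA l s f -> is_powA l s f (fpow l s f).
Proof.
case=> g hg; rewrite -fpowE.
by apply: (@xgetPex _ 0 [set g | is_powA l s f g]); exists g.
Qed.

Lemma DpowA_L2 s f : DpowA l s f -> L2 l f.
Proof. by case=> g []. Qed.

Lemma L2_powA s f : DpowA l s f -> L2 l (fpow l s f).
Proof. by move=> /powA_spec[]. Qed.

Lemma coef_powA_spec s f n : DpowA l s f ->
  cf (fpow l s f) n = (lam n `^ s)%:C * cf f n.
Proof. by move=> /powA_spec/coef_powA. Qed.

Lemma powA_null s f g : DpowA l s f -> L2 l g ->
  (forall n, cf g n = (lam n `^ s)%:C * cf f n) -> l2norm l (fpow l s f - g) = 0.
Proof.
move=> Df Lg h; apply: (coef_inj eb (L2_powA Df) Lg) => n.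
by rewrite h coef_powA_spec.
Qed.

Lemma powA_linear (a : R[i]) s f g : DpowA l s f -> DpowA l s g ->
  DpowA l s (a *: f + g) /\
  l2norm l (fpow l s (a *: f + g) - (a *: fpow l s f + fpow l s g)) = 0.
Proof.
move=> Df Dg; have Lf := DpowA_L2 Df; have Lg := DpowA_L2 Dg.
have Lpf := L2_powA Df; have Lpg := L2_powA Dg.
have L1 : L2 l (a *: f + g) by exact: (L2_subspace l).2.
have L2' : L2 l (a *: fpow l s f + fpow l s g) by exact: (L2_subspace l).2.
have h n : cf (a *: fpow l s f + fpow l s g) n =
    (lam n `^ s)%:C * cf (a *: f + g) n.
  rewrite (coef_linear eb a n Lpf Lpg) (coef_linear eb a n Lf Lg).
  rewrite (coef_powA_spec n Df) (coef_powA_spec n Dg).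
  by move: (cf f n) (cf g n) (_%:C) => x y t; ring.
have D : DpowA l s (a *: f + g).
  by exists (a *: fpow l s f + fpow l s g); exact: (is_powA_coef L1 L2' h).
split; [exact: D|exact: (powA_null D L2' h)].
Qed.

Lemma DpowA_subspace s : is_subspace (DpowA l s : set (R -> R[i])).
Proof.
split; last by move=> a f g Df Dg; exact: (powA_linear a Df Dg).1.
by exists 0; apply: (is_powA_coef (L2_0 l) (L2_0 l)) => n; rewrite -!coefE (inner0l (L2e n)) mulr0.
Qed.

Lemma DpowAB s f g : DpowA l s f -> DpowA l s g -> DpowA l s (f - g).
Proof. exact: (subspaceB (DpowA_subspace s)). Qed.

Lemma parseval g h : L2 l g -> L2 l h ->
  (fun N => \sum_(n < N) complex.Re (cf g n * conjc (cf h n))) @ \oo -->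
    rinner l g h.
Proof.
move=> Lg Lh; have LP N := L2_psum eb h N.
apply: cvgn_ext (rinner_cvg Lg Lh (fun=> Lg) LP (l2cvg_cst _ _) (psum_cvg eb Lh)) => N.
rewrite !rinnerE (innerC (LP N) Lg) /psum inner_suml//; last exact: L2e.
rewrite Reconj; elim: N => [|N IH]; first by rewrite !big_ord0.
rewrite !big_ord_recr/= ReD IH; congr (_ + _).
rewrite -!coefE (innerC Lg (L2e N)) !ReM !Reconj !Imconj; ring.
Qed.

Lemma parseval_le f g h k : L2 l f -> L2 l g -> L2 l h -> L2 l k ->
  (forall n, complex.Re (cf f n * conjc (cf g n)) <=
             complex.Re (cf h n * conjc (cf k n))) ->
  rinner l f g <= rinner l h k.
Proof.
move=> Lf Lg Lh Lk le; have c1 := parseval Lf Lg; have c2 := parseval Lh Lk.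
apply: (ler_cvg_to c1 c2); apply: nearW => N; apply: ler_sum => n _; exact: le.
Qed.

Lemma powR_half n : lam n `^ (1 / 2) * lam n `^ (1 / 2) = lam n.
Proof.
rewrite -powRD; last by rewrite gt_eqF ?implybT// lam0.
have -> : 1 / 2 + 1 / 2 = 1 :> R by field.
by rewrite powRr1// ltW// lam0.
Qed.

(** One constant for both [1 <= C * lam n ^ s] and [lam n ^ s <= C * lam n], uniformly for [s] in
    [0, 1]: the summand 1 handles [lam n >= 1], and [4 * l ^ 2] handles [lam n < 1] through
    [lam_lower]. *)
Definition spectral_const := 1 + 4 * l ^+ 2.

Lemma spectral_const_ge1 : 1 <= spectral_const.
Proof. by rewrite lerDl mulr_ge0 ?sqr_ge0. Qed.

Lemma powR_lam_lower s n : 0 <= s <= 1 -> 1 <= spectral_const * lam n `^ s.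
Proof.
move=> /andP[s0 s1]; have l0 := lam0 n; have lo := lam_lower l_gt0 eb n.
have p0 : 0 < lam n `^ s by exact: powR_gt0.
have c1 := spectral_const_ge1.
have [l1|l1] := leP 1 (lam n).
  have : 1 <= lam n `^ s by rewrite -(powRr0 (lam n)) ler_powR.
  nra.
have : lam n <= lam n `^ s by rewrite ger1_powR// l0/= ltW.
rewrite /spectral_const; have := sqr_ge0 l; nra.
Qed.

Lemma powR_lam_upper s n : 0 <= s <= 1 -> lam n `^ s <= spectral_const * lam n.
Proof.
move=> /andP[s0 s1]; have l0 := lam0 n; have lo := lam_lower l_gt0 eb n.
have c1 := spectral_const_ge1.
have [l1|l1] := leP 1 (lam n).
  have : lam n `^ s <= lam n by rewrite ler1_powR.
  nra.
have : lam n `^ s <= 1 by rewrite -(powRr0 (lam n)) ger_powR// l0/= ltW.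
rewrite /spectral_const; lra.
Qed.

Definition dpsum f N := \sum_(n < N) cf f n *: wdx l (e n).

Let he n : h10 l (e n) (wdx l (e n)).
Proof. exact: (DA_h10 l_gt0 eb (DA_e eb n)). Qed.

Let Lde n : L2 l (wdx l (e n)). Proof. by case: (he n). Qed.

Lemma L2_dpsum f N : L2 l (dpsum f N).
Proof. by apply: L2_sum => n _; apply: L2Z; exact: Lde. Qed.

Lemma inner_sums (a b : nat -> R[i]) (u v : nat -> R -> R[i]) M N :
  (forall n, L2 l (u n)) -> (forall n, L2 l (v n)) ->
  inner l (\sum_(n < M) a n *: u n) (\sum_(m < N) b m *: v m) =
  \sum_(n < M) \sum_(m < N) a n * conjc (b m) * inner l (u n) (v m).
Proof.
move=> Lu Lv; have LN K : L2 l (\sum_(m < K) b m *: v m).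
  by apply: L2_sum => m _; exact: L2Z.
rewrite inner_suml; [|by move=> n; exact: Lu|exact: LN].
apply: eq_bigr => n _; elim: N => [|N IH].
  by rewrite !big_ord0 (innerC (L2_0 l) (Lu n)) (inner0l (Lu n)) rmorph0 mulr0.
rewrite !big_ord_recr/= (innerDr (LN N) (L2Z _ (Lv N)) (Lu n)) mulrDr IH.
by rewrite (innerZr _ (Lv N) (Lu n)) mulrA.
Qed.

(** The derivatives of the [e n] are orthogonal with squared norms [lam n], the square of
    [lam n ^ (1 / 2)]; so differentiating termwise yields the same products as applying
    [A^(1/2)]. *)
Lemma rinner_dpsum f g M N : DpowA l (1 / 2) f -> DpowA l (1 / 2) g ->
  rinner l (dpsum f M) (dpsum g N) =
  rinner l (ps (fpow l (1 / 2) f) M) (ps (fpow l (1 / 2) g) N).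
Proof.
move=> Df Dg; rewrite !rinnerE /dpsum /psum (inner_sums _ _ _ _ Lde Lde)
  (inner_sums _ _ _ _ (L2_e eb) (L2_e eb)).
congr complex.Re; apply: eq_bigr => n _; apply: eq_bigr => m _.
rewrite (inner_dx_e l_gt0 eb m (he n)) !coefE (coef_powA_spec n Df) (coef_powA_spec m Dg).
rewrite -[cf (e n) m]coefE (inner_e eb); case: eqVneq => [->|_]; last by rewrite !mulr0.
have := powR_half m; move: (lam m `^ (1 / 2)) => t <-.
move: (cf f m) (cf g m) => [a b] [c d].
by apply: complex_eq; rewrite /=; ring.
Qed.

Lemma l2norm_dpsum f M N : DpowA l (1 / 2) f ->
  l2norm l (dpsum f M - dpsum f N) =
  l2norm l (ps (fpow l (1 / 2) f) M - ps (fpow l (1 / 2) f) N).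
Proof.
move=> Df; have L1 := L2_dpsum f M; have L2' := L2_dpsum f N.
have L3 := L2_psum eb (fpow l (1 / 2) f) M; have L4 := L2_psum eb (fpow l (1 / 2) f) N.
rewrite !l2normE; congr Num.sqrt.
rewrite (rinnerBl L1 L2' (L2B L1 L2')) (rinnerBr L1 L2' L1) (rinnerBr L1 L2' L2').
rewrite (rinnerBl L3 L4 (L2B L3 L4)) (rinnerBr L3 L4 L3) (rinnerBr L3 L4 L4).
by rewrite !rinner_dpsum.
Qed.

(** The termwise derivatives are Cauchy, their distances being those of the partial sums of
    [A^(1/2) f]. Completeness of L^2 provides a limit, which [h10_closed] identifies as the
    derivative of [f]. This is the inclusion of D(A^(1/2)) in H^1_0. *)
Lemma half_limit f : DpowA l (1 / 2) f ->
  h10 l f (wdx l f) /\ l2cvg l (dpsum f) (wdx l f).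
Proof.
move=> Df; have Lf := DpowA_L2 Df; have Lg := L2_powA Df.
set g := fpow l (1 / 2) f in Lg *.
have [f' Lf' cf'] : exists2 f', L2 l f' & l2cvg l (dpsum f) f'.
  apply: riesz_fischer => [n|eps eps0]; first exact: L2_dpsum.
  have e2 : 0 < eps / 2 by lra.
  have /cvgrPdist_lt/(_ _ e2) [N _ hN] := psum_cvg eb Lg.
  exists N => m n Nm Nn; rewrite l2norm_dpsum// -/g.
  have := hN m Nm; have := hN n Nn; rewrite /= !sub0r !normrN !ger0_norm ?l2norm_ge0// => h1 h2.
  have Lm := L2_psum eb g m; have Ln := L2_psum eb g n.
  have -> : ps g m - ps g n = (ps g m - g) + (g - ps g n) by rewrite addrA subrK.
  apply: le_lt_trans (l2norm_triangle (L2B Lm Lg) (L2B Lg Ln)) _.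
  rewrite (l2normC Lm Lg); lra.
have hf : h10 l f f'.
  apply: (@h10_closed _ _ (ps f) (dpsum f) f f' Lf Lf' _ (psum_cvg eb Lf) cf') => N.
  exact: (h10_sum N (cf f) he).
have [hdx d0] := h10_dx l_gt0 eb hf; split => //.
have [_ Ldx _] := hdx.
apply: cvgn_ext cf' => N; have LN := L2_dpsum f N.
apply: l2norm_congr; [exact: L2B|exact: L2B|].
have -> : f' - dpsum f N - (wdx l f - dpsum f N) = f' - wdx l f.
  by rewrite opprB addrA subrK.
by rewrite l2normC.
Qed.

Lemma half_h10 f : DpowA l (1 / 2) f -> h10 l f (wdx l f).
Proof. by move=> /half_limit[]. Qed.

Lemma L2_half_dx f : DpowA l (1 / 2) f -> L2 l (wdx l f).
Proof. by move=> /half_h10[]. Qed.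

Lemma half_rinner f g : DpowA l (1 / 2) f -> DpowA l (1 / 2) g ->
  rinner l (wdx l f) (wdx l g) = rinner l (fpow l (1 / 2) f) (fpow l (1 / 2) g).
Proof.
move=> Df Dg; have [_ cf1] := half_limit Df; have [_ cg1] := half_limit Dg.
have c1 := rinner_cvg (L2_half_dx Df) (L2_half_dx Dg) (L2_dpsum f) (L2_dpsum g) cf1 cg1.
have c2 := rinner_cvg (L2_powA Df) (L2_powA Dg) (L2_psum eb _) (L2_psum eb _)
  (psum_cvg eb (L2_powA Df)) (psum_cvg eb (L2_powA Dg)).
by apply: (cvgn_unique c1); apply: cvgn_ext c2 => N; rewrite rinner_dpsum.
Qed.

Lemma half_dx_linear (a : R[i]) f g : DpowA l (1 / 2) f -> DpowA l (1 / 2) g ->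
  l2norm l (wdx l (a *: f + g) - (a *: wdx l f + wdx l g)) = 0.
Proof.
move=> Df Dg; apply: (dx_null eb).
  by apply: (L2_subspace l).2; [exact: DpowA_L2 Df|exact: DpowA_L2 Dg].
by apply: (h10_weak l_gt0); apply: h10_linear; exact: half_h10.
Qed.

Lemma half_poincare f : DpowA l (1 / 2) f ->
  rinner l f f <= 4 * l ^+ 2 * rinner l (wdx l f) (wdx l f).
Proof.
move=> Df; have Lf := DpowA_L2 Df; have Lg := L2_powA Df.
rewrite half_rinner// -rinnerZl//.
apply: (parseval_le Lf Lf (L2Z _ Lg) Lg) => n.
rewrite -[cf (_ *: _) n]coefE (innerZl _ Lg (L2e n)) coefE (coef_powA_spec n Df).
have := lam_lower l_gt0 eb n; have := powR_half n.
move: (lam n `^ (1 / 2)) => t <-.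
move: (cf f n) => [a b] lo; rewrite !ReM /=.
by have := sqr_ge0 a; have := sqr_ge0 b; nra.
Qed.

(** Coefficientwise from [1 <= C * lam n ^ s]. It bounds a kinetic energy by the corresponding
    damping, down to the weakest case [s = 0]. *)
Lemma damping_coercive s f : 0 <= s <= 1 -> DpowA l s f ->
  rinner l f f <= spectral_const * rinner l (fpow l s f) f.
Proof.
move=> s01 Df; have Lf := DpowA_L2 Df; have Lg := L2_powA Df.
rewrite -rinnerZl//.
apply: (parseval_le Lf Lf (L2Z _ Lg) Lf) => n.
rewrite -[cf (_ *: _) n]coefE (innerZl _ Lg (L2e n)) coefE (coef_powA_spec n Df).
have := powR_lam_lower n s01; move: (lam n `^ s) => t.
move: (cf f n) => [a b] lo; rewrite !ReM /=.
by have := sqr_ge0 a; have := sqr_ge0 b; nra.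
Qed.

(** Young's inequality on each coefficient with weight [lam n ^ s], then [lam n ^ s <= C * lam n] in
    the part containing [g] only. Cauchy-Schwarz in L^2 would instead produce the norm of [A^s f],
    which the dissipation does not bound. *)
Lemma damping_cross s f g (eps : R) : 0 <= s <= 1 -> 0 < eps ->
  DpowA l s f -> DpowA l (1 / 2) g ->
  - 2 * rinner l (fpow l s f) g <= eps^-1 * rinner l (fpow l s f) f +
    eps * spectral_const * rinner l (wdx l g) (wdx l g).
Proof.
Proof.
move=> s01 e0 Df Dg; have Lf := DpowA_L2 Df; have Lg := DpowA_L2 Dg.
have Lp := L2_powA Df; have Lq := L2_powA Dg.
set eps' := eps * spectral_const.
have c1 := parseval Lp Lg; have c2 := parseval Lp Lf; have c3 := parseval Lq Lq.
rewrite half_rinner//.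
have c4 : (fun N => - 2 * \sum_(n < N) complex.Re (cf (fpow l s f) n * conjc (cf g n)))
    @ \oo --> - 2 * rinner l (fpow l s f) g.
  by apply: cvgM => //; exact: cvg_cst.
have c5 : (fun N =>
   eps^-1 * (\sum_(n < N) complex.Re (cf (fpow l s f) n * conjc (cf f n))) +
   eps' * (\sum_(n < N) complex.Re (cf (fpow l (1 / 2) g) n * conjc (cf (fpow l (1 / 2) g) n))))
    @ \oo --> eps^-1 * rinner l (fpow l s f) f +
      eps' * rinner l (fpow l (1 / 2) g) (fpow l (1 / 2) g).
  by apply: cvgD; apply: cvgM => //; exact: cvg_cst.
apply: (ler_cvg_to c4 c5); apply: nearW => N.
rewrite !mulr_sumr -big_split/=; apply: ler_sum => n _.
rewrite (coef_powA_spec n Df) (coef_powA_spec n Dg).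
have := powR_lam_upper n s01; have := powR_half n.
have := powR_ge0 (lam n) s.
move: (lam n `^ (1 / 2)) => r; move: (lam n `^ s) => t t0 <- up.
move: (cf f n) (cf g n) => [a b] [c d]; rewrite !ReM /=.
have h1 : - 2 * (a * c + b * d) <= eps^-1 * (a ^+ 2 + b ^+ 2) + eps * (c ^+ 2 + d ^+ 2).
  have q1 := sqr_ge0 (a / eps + c); have q2 := sqr_ge0 (b / eps + d).
  have q3 := mulr_ge0 (ltW e0) (addr_ge0 q1 q2).
  have e1 : eps * ((a / eps + c) ^+ 2 + (b / eps + d) ^+ 2) =
     eps^-1 * (a ^+ 2 + b ^+ 2) + 2 * (a * c + b * d) + eps * (c ^+ 2 + d ^+ 2).
    by field; rewrite gt_eqF.
  by move: q3; rewrite e1; lra.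
have h2 := ler_wpM2l t0 h1.
have h3 : t * (eps * (c ^+ 2 + d ^+ 2)) <=
    spectral_const * (r * r) * (eps * (c ^+ 2 + d ^+ 2)).
  by rewrite ler_wpM2r// mulr_ge0 ?addr_ge0 ?sqr_ge0// ltW.
rewrite /eps'; move: h2 h3; move: spectral_const (eps^-1) => k i; lra.
Qed.

End SpectralCalculus.

(** * Finite expansions belong to all domains and are dense *)

Section Domains.
Context (R : realType) (l : R) (e : nat -> R -> R[i]) (lam : nat -> R).
Hypotheses (l_gt0 : 0 < l) (eb : eigenbasis l e lam).
Implicit Types (f g h : R -> R[i]).
Local Notation cf := (coef l e).
Local Notation ps := (psum l e).
Local Notation L2e := (L2_e eb).

Lemma sobolev_linear k (a : R[i]) f g : sobolev l k f -> sobolev l k g ->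
  sobolev l k (a *: f + g).
Proof.
elim: k f g => [|k IH] f g.
  by move=> [Lf _] [Lg _]; split => //; exact: (L2_subspace l).2.
move=> [Lf [f' [Wf Sf]]] [Lg [g' [Wg Sg]]]; split; first exact: (L2_subspace l).2.
exists (a *: f' + g'); split; last exact: IH.
exact: (weak_derivative_linear a Lf Lg Wf Wg).
Qed.

Lemma sobolevS k f : sobolev l k.+1 f -> sobolev l k f.
Proof.
elim: k f => [|k IH] f [Lf [f' [Wf Sf]]]; split => //.
by exists f'; split => //; exact: IH.
Qed.

Lemma C1c_linear (a : R) p q : C1c l p -> C1c l q -> C1c l (fun x => a * p x + q x).
Proof.
move=> [dp cp [a1 [b1 [a10 b1l h1]]]] [dq cq [a2 [b2 [a20 b2l h2]]]].
have dap x : derivable (a \*: p : R -> R) x 1 by exact: derivableZ.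
have d x : derivable (fun x => a * p x + q x) x 1 by exact: (derivableD (dap x) (dq x)).
split; first exact: d.
- have -> : derive1 (fun x => a * p x + q x) = fun x => a * derive1 p x + derive1 q x.
    apply/funext => x; rewrite !derive1E (_ : (fun x => _) = (a \*: p : R -> R) + q)//.
    by rewrite deriveD// deriveZ.
  by move=> x; apply: cvgD; [apply: cvgM; [exact: cvg_cst|exact: cp]|exact: cq].
- exists (Num.min a1 a2), (Num.max b1 b2); split.
  + by rewrite lt_min a10.
  + by rewrite gt_max b1l.
  + move=> x; rewrite negb_and -!ltNge lt_min gt_max => /orP[/andP[x1 x2]|/andP[x1 x2]].
      by rewrite h1 ?h2 ?mulr0 ?addr0// negb_and -!ltNge ?x1 ?x2.
    by rewrite h1 ?h2 ?mulr0 ?addr0// negb_and -!ltNge ?x1 ?x2 orbT.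
Qed.

Lemma complex_test_linear (a : R[i]) P Q :
  complex_test l P -> complex_test l Q -> complex_test l (a *: P + Q).
Proof.
move=> [P1 P2] [Q1 Q2]; split.
- rewrite (_ : (fun x => _) = fun x => complex.Re a * complex.Re (P x) +
    (- complex.Im a * complex.Im (P x) + complex.Re (Q x))); last first.
    by apply/funext => x; rewrite fctE ReD ReM mulNr addrA.
  exact: C1c_linear P1 (C1c_linear _ P2 Q1).
- rewrite (_ : (fun x => _) = fun x => complex.Re a * complex.Im (P x) +
    (complex.Im a * complex.Re (P x) + complex.Im (Q x))); last first.
    by apply/funext => x; rewrite fctE ImD ImM addrA.
  exact: C1c_linear P2 (C1c_linear _ P1 Q2).
Qed.

Lemma H10_linear (a : R[i]) f g : H10 l f -> H10 l g -> H10 l (a *: f + g).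
Proof.
move=> Hf Hg; have [Lf [P CP [cP cP']]] := H10_approx Hf.
have [Lg [Q CQ [cQ cQ']]] := H10_approx Hg.
have [[_ [f' [Wf _]]] _] := Hf; have [[_ [g' [Wg _]]] _] := Hg.
split; first by apply: sobolev_linear; [case: Hf|case: Hg].
exists (fun n => a *: P n + Q n); split.
  by move=> n; exact: complex_test_linear.
have LP n := (L2_test (CP n)).1; have LQ n := (L2_test (CQ n)).1.
have LaP n := L2Z a (LP n).
have c1 : l2cvg l (fun n => a *: P n + Q n) (a *: f + g).
  exact: (l2cvgD (L2Z a Lf) Lg LaP LQ (l2cvgZ a Lf LP cP) cQ).
(* As [wdx] chooses representatives, its value on the combination is compared with the combination
   of its values in norm only; [bnd] is the resulting bound. *)
pose bnd n := Num.sqrt (sqmod a) * l2norm l (wdx l (f - P n)) + l2norm l (wdx l (g - Q n)).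
have cb : bnd @ \oo --> (0 : R).
  rewrite -[0]addr0 -{1}(mulr0 (Num.sqrt (sqmod a))); apply: cvgD => //.
  by apply: cvgM => //; exact: cvg_cst.
have cd : (fun n => l2norm l (wdx l (a *: f + g - (a *: P n + Q n)))) @ \oo --> (0 : R).
  apply: (@squeeze_cvgr _ _ _ _ (fun=> 0) _ _ _ _ _ cb); last exact: cvg_cst.
  apply: nearW => n; rewrite l2norm_ge0/=.
  have W1 := dx_weak (weak_derivativeB Lf (LP n) Wf (test_weak_derivative l_gt0 (CP n))).
  have W2 := dx_weak (weak_derivativeB Lg (LQ n) Wg (test_weak_derivative l_gt0 (CQ n))).
  have L1 := weak_derivative_L2 W1; have L2' := weak_derivative_L2 W2.
  have La := L2Z a L1.
  have W3 := weak_derivative_linear a (L2B Lf (LP n)) (L2B Lg (LQ n)) W1 W2.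
  have E : a *: (f - P n) + (g - Q n) = a *: f + g - (a *: P n + Q n).
    by rewrite scalerBr opprD addrACA.
  rewrite E in W3.
  have L3 : L2 l (a *: f + g - (a *: P n + Q n)).
    by apply: L2B; exact: (L2_subspace l).2.
  rewrite (l2norm_congr (L2_dx W3) (weak_derivative_L2 W3) (dx_null eb L3 W3)).
  by apply: le_trans (l2norm_triangle La L2') _; rewrite (l2normZ _ L1).
pose A n := l2norm l (a *: f + g - (a *: P n + Q n)).
pose B n := l2norm l (wdx l (a *: f + g - (a *: P n + Q n))).
have c : (fun n => A n * A n + B n * B n) @ \oo --> (0 * 0 + 0 * 0 : R).
  by apply: cvgD; apply: cvgM; (exact: c1 || exact: cd).
rewrite mulr0 addr0 in c; apply: cvgn_ext c => n.
by rewrite wdxE !expr2.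
Qed.

Lemma DA_subspace : is_subspace (DA l : set (R -> R[i])).
Proof.
have lin (a : R[i]) f g : DA l f -> DA l g -> DA l (a *: f + g).
  by move=> [Sf Hf] [Sg Hg]; split; [exact: sobolev_linear|exact: H10_linear].
split => //; rewrite -(addNr (e 0)) -scaleN1r; apply: lin; exact: (DA_e eb).
Qed.

(** By the eigenvalue equation the second derivative is a multiple of [e n] in L^2, hence weakly
    differentiable in turn. *)
Lemma sobolev3_e n : sobolev l 3 (e n).
Proof.
have De := DA_e eb n; have [Le W W2] := sobolev2_weak eb De.1.
have LW := weak_derivative_L2 W; have LW2 := weak_derivative_L2 W2.
have La : L2 l (- (lam n)%:C *: e n) by apply: L2Z; exact: L2e.
split; first exact: Le.
exists (wdx l (e n)); split; first exact: W.
split; first exact: LW.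
exists (- (lam n)%:C *: e n); split; last first.
  rewrite -[_ *: _]addr0; apply: sobolev_linear; first exact: (sobolevS De.1).
  rewrite -(addNr (e n)) -scaleN1r; apply: sobolev_linear; exact: (sobolevS De.1).
apply: (weak_derivative_congr LW LW La _ _ W2); first by rewrite subrr l2norm0.
have := opA_e eb n; rewrite /opA !wdxE -(l2normN (L2B LW2 La)).
by congr (l2norm l _ = 0); rewrite scaleNr opprB addrC.
Qed.

Lemma sobolev3_subspace : is_subspace (sobolev l 3 : set (R -> R[i])).
Proof.
have lin (a : R[i]) f g : sobolev l 3 f -> sobolev l 3 g -> sobolev l 3 (a *: f + g).
  exact: sobolev_linear.
split => //; rewrite -(addNr (e 0)) -scaleN1r; apply: lin; exact: sobolev3_e.
Qed.

Lemma DA_psum f N : DA l (ps f N).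
Proof.
apply: (subspace_sum DA_subspace) => n _.
exact: (subspaceZ DA_subspace _ (DA_e eb n)).
Qed.

Lemma sobolev3_psum f N : sobolev l 3 (ps f N).
Proof.
apply: (subspace_sum sobolev3_subspace) => n _.
exact: (subspaceZ sobolev3_subspace _ (sobolev3_e n)).
Qed.

Lemma L2_comb (a : nat -> R[i]) N : L2 l (\sum_(n < N) a n *: e n).
Proof. by apply: L2_sum => n _; apply: L2Z; exact: L2e. Qed.

Lemma coef_comb (a : nat -> R[i]) N m :
  cf (\sum_(n < N) a n *: e n) m = (m < N)%:R * a m.
Proof.
elim: N => [|N IH].
  by rewrite big_ord0 -coefE (inner0l (L2e m)) mul0r.
rewrite big_ord_recr/= addrC (coef_linear eb _ _ (L2e N) (L2_comb a N)) IH.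
rewrite -coefE (inner_e eb) ltnS [(m <= N)%N]leq_eqVlt eq_sym.
case: eqVneq => [->|_] /=; first by rewrite ltnn mulr1 mul0r addr0 mul1r.
by rewrite mulr0 add0r.
Qed.

Lemma coef_psum f N m : cf (ps f N) m = (m < N)%:R * cf f m.
Proof. exact: (coef_comb (cf f)). Qed.

Lemma DpowA_psum s f N : DpowA l s (ps f N).
Proof.
exists (\sum_(n < N) ((lam n `^ s)%:C * cf f n) *: e n).
apply: (is_powA_coef eb (L2_comb _ N) (L2_comb (fun n => (lam n `^ s)%:C * cf f n) N)) => n.
rewrite (coef_comb (fun n => (lam n `^ s)%:C * cf f n)) coef_psum.
by rewrite mulrCA.
Qed.

(** Meant for the last component of [opB1], which must lie in D(A^(1/2)) although it contains
    [A theta]. *)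
Lemma DpowA_opA_psum s f N : DpowA l s (opA l (ps f N)).
Proof.
pose a n := (lam n `^ s)%:C * ((lam n)%:C * cf f n).
have D := DA_psum f N.
exists (\sum_(n < N) a n *: e n).
apply: (is_powA_coef eb (DA_L2_opA eb D) (L2_comb a N)) => n.
rewrite (coef_comb a) (coef_opA l_gt0 eb n D.1 (DA_h10 l_gt0 eb D)) coef_psum /a.
by rewrite mulrCA; congr (_ * _); rewrite mulrCA.
Qed.

Lemma psum_approx f (eps : R) : L2 l f -> 0 < eps ->
  exists N0, forall N, (N0 <= N)%N -> l2norm l (f - ps f N) < eps.
Proof.
move=> Lf e0; have /cvgrPdist_lt/(_ _ e0) [N0 _ hN] := psum_cvg eb Lf.
exists N0 => N NN; have := hN N NN.
by rewrite /= sub0r normrN ger0_norm ?l2norm_ge0.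
Qed.

(** [A^(1/2)] commutes with truncation, so the second error is a tail of the expansion of
    [A^(1/2) f]. *)
Lemma half_psum_approx f (eps : R) : DpowA l (1 / 2) f -> 0 < eps ->
  exists N0, forall N, (N0 <= N)%N ->
    l2norm l (f - ps f N) < eps /\ l2norm l (fpow l (1 / 2) (f - ps f N)) < eps.
Proof.
move=> Df e0; have Lf := DpowA_L2 Df; have Lg := L2_powA Df.
have [N1 h1] := psum_approx Lf e0; have [N2 h2] := psum_approx Lg e0.
exists (maxn N1 N2) => N; rewrite geq_max => /andP[n1 n2]; split; first exact: h1.
have Dp := DpowA_psum (1 / 2) f N.
have Dd := DpowAB l_gt0 eb Df Dp.
set g := fpow l (1 / 2) f in Lg h2.
have Lgp := L2_psum eb g N; have Lgd := L2B Lg Lgp.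
have E n : cf (g - ps g N) n = (lam n `^ (1 / 2))%:C * cf (f - ps f N) n.
  rewrite (coefB eb n Lg Lgp) (coefB eb n Lf (L2_psum eb f N)) !coef_psum.
  rewrite (coef_powA_spec l_gt0 eb n Df).
  by move: (cf f n) (_%:C) ((n < N)%:R) => x t b; ring.
rewrite (l2norm_congr (L2_powA Dd) Lgd (powA_null l_gt0 eb Dd Lgd E)).
exact: h2.
Qed.

End Domains.

(** * Real forms built from maps that are linear up to null functions *)

Section FormConstructions.
Context (R : realType) (V : lmodType R[i]) (H : set V) (l : R).
Implicit Types (b q : V -> V -> R) (S T : V -> R -> R[i]).

Lemma sym_formD b q : sym_form H b -> sym_form H q ->
  sym_form H (fun x y => b x y + q x y).
Proof.
move=> [cb lb] [cq lq]; split=> [x y Hx Hy|a x y z Hx Hy Hz].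
  by rewrite cb// cq.
by rewrite lb// lq//; ring.
Qed.

Lemma sym_formZ (k : R) b : sym_form H b -> sym_form H (fun x y => k * b x y).
Proof.
move=> [cb lb]; split=> [x y Hx Hy|a x y z Hx Hy Hz]; first by rewrite cb.
by rewrite lb//; ring.
Qed.

(* Linear up to null functions, as [dx] and [powA] choose representatives. *)
Definition null_linear T : Prop :=
  (forall x, H x -> L2 l (T x)) /\
  forall (a : R[i]) x y, H x -> H y -> l2norm l (T (a *: x + y) - (a *: T x + T y)) = 0.

Hypothesis subH : is_subspace H.

Lemma null_linear_rinner T (a : R) x y f : null_linear T -> H x -> H y -> L2 l f ->
  rinner l (T (a%:C *: x + y)) f = a * rinner l (T x) f + rinner l (T y) f.
Proof.
move=> [LT lT] Hx Hy Lf; have Hz := subH.2 a%:C x y Hx Hy.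
have L1 := L2Z a%:C (LT x Hx).
rewrite (rinner_congrl (LT _ Hz) (L2D L1 (LT y Hy)) Lf (lT a%:C x y Hx Hy)).
by rewrite (rinnerDl L1 (LT y Hy) Lf) (rinnerZl a (LT x Hx) Lf).
Qed.

Lemma cross_form S T : null_linear S -> null_linear T ->
  sym_form H (fun x y => rinner l (S x) (T y) + rinner l (T x) (S y)).
Proof.
move=> nS nT; have LS := nS.1; have LT := nT.1; split=> [x y Hx Hy|a x y z Hx Hy Hz].
  by rewrite addrC (rinnerC (LT x Hx) (LS y Hy)) (rinnerC (LS x Hx) (LT y Hy)).
rewrite (null_linear_rinner a nS Hx Hy (LT z Hz)).
by rewrite (null_linear_rinner a nT Hx Hy (LS z Hz)); ring.
Qed.

Lemma square_form T : null_linear T -> sym_form H (fun x y => rinner l (T x) (T y)).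
Proof.
move=> nT; have LT := nT.1; split=> [x y Hx Hy|a x y z Hx Hy Hz].
  exact: (rinnerC (LT x Hx) (LT y Hy)).
exact: (null_linear_rinner a nT Hx Hy (LT z Hz)).
Qed.

Lemma null_linearB S T : null_linear S -> null_linear T -> null_linear (fun x => S x - T x).
Proof.
move=> [LS lS] [LT lT]; split=> [x Hx|a x y Hx Hy]; first by apply: L2B; auto.
have Hz := subH.2 a x y Hx Hy.
have L1 := L2D (L2Z a (LS x Hx)) (LS y Hy); have L2' := L2D (L2Z a (LT x Hx)) (LT y Hy).
have L3 := L2B (LS _ Hz) L1; have L4 := L2B (LT _ Hz) L2'.
have -> : S (a *: x + y) - T (a *: x + y) - (a *: (S x - T x) + (S y - T y)) =
    (S (a *: x + y) - (a *: S x + S y)) - (T (a *: x + y) - (a *: T x + T y)).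
  apply/funext => t; rewrite !fctE; ring.
apply/eqP; rewrite eq_le l2norm_ge0 andbT.
have LN : L2 l (- (T (a *: x + y) - (a *: T x + T y))) by rewrite -scaleN1r; exact: L2Z.
apply: le_trans (l2norm_triangle L3 LN) _.
by rewrite (l2normN L4) (lS a x y Hx Hy) (lT a x y Hx Hy) addr0.
Qed.

End FormConstructions.

(** * Inner products of real linear combinations, and Young's inequality *)

Section RealCombinations.
Context (R : realType) (l : R).
Implicit Types (f g h k : R -> R[i]).

Lemma rinnerNl f k : L2 l f -> L2 l k -> rinner l (- f) k = - rinner l f k.
Proof.
move=> Lf Lk; have -> : - f = ((-1 : R)%:C : R[i]) *: f by rewrite rmorphN1 scaleN1r.
by rewrite rinnerZl// mulN1r.
Qed.

Lemma L2N f : L2 l f -> L2 l (- f).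
Proof. by move=> Lf; rewrite -scaleN1r; exact: L2Z. Qed.

Lemma rinner_young f g (t : R) : 0 < t -> L2 l f -> L2 l g ->
  2 * rinner l f g <= t * rinner l f f + t^-1 * rinner l g g.
Proof.
move=> t0 Lf Lg; have Lt := L2Z t%:C Lf.
have := rinner_ge0 l (t%:C *: f - g).
rewrite (rinnerBl Lt Lg (L2B Lt Lg)) (rinnerBr Lt Lg Lt) (rinnerBr Lt Lg Lg).
rewrite (rinnerZl t Lf Lt) (rinnerZr t Lf Lf) (rinnerZr t Lf Lg) (rinnerZl t Lf Lg).
rewrite (rinnerC Lg Lf).
move: (rinner l f f) (rinner l f g) (rinner l g g) => a b c h.
have : 0 <= t^-1 * (t * (t * a) - t * b - (t * b - c)).
  by rewrite mulr_ge0 ?invr_ge0// ltW.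
have -> : t^-1 * (t * (t * a) - t * b - (t * b - c)) = t * a - 2 * b + t^-1 * c.
  by field; rewrite gt_eqF.
lra.
Qed.

Lemma rinner_comb4 (a b c d : R) f g h k m :
  L2 l f -> L2 l g -> L2 l h -> L2 l k -> L2 l m ->
  rinner l (- (a%:C *: f) - b%:C *: g + c%:C *: h - d%:C *: k) m =
  - (a * rinner l f m) - b * rinner l g m + c * rinner l h m - d * rinner l k m.
Proof.
move=> Lf Lg Lh Lk Lm.
have L1 := L2N (L2Z a%:C Lf); have L2' := L2B L1 (L2Z b%:C Lg).
have L3 := L2D L2' (L2Z c%:C Lh).
rewrite (rinnerBl L3 (L2Z d%:C Lk) Lm) (rinnerDl L2' (L2Z c%:C Lh) Lm).
rewrite (rinnerBl L1 (L2Z b%:C Lg) Lm) (rinnerNl (L2Z a%:C Lf) Lm).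
by rewrite (rinnerZl a Lf Lm) (rinnerZl b Lg Lm) (rinnerZl c Lh Lm) (rinnerZl d Lk Lm).
Qed.

Lemma rinner_comb4' (a b c d : R) f g h k m :
  L2 l f -> L2 l g -> L2 l h -> L2 l k -> L2 l m ->
  rinner l (- (a%:C *: f) - b%:C *: g - c%:C *: h - d%:C *: k) m =
  - (a * rinner l f m) - b * rinner l g m - c * rinner l h m - d * rinner l k m.
Proof.
move=> Lf Lg Lh Lk Lm; have := rinner_comb4 a b (- c) d Lf Lg Lh Lk Lm.
by rewrite rmorphN scaleNr mulNr.
Qed.

Lemma rinner_comb3 (a b c : R) f g h m :
  L2 l f -> L2 l g -> L2 l h -> L2 l m ->
  rinner l (- (a%:C *: f) + b%:C *: g + c%:C *: h) m =
  - (a * rinner l f m) + b * rinner l g m + c * rinner l h m.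
Proof.
move=> Lf Lg Lh Lm.
have L1 := L2N (L2Z a%:C Lf); have L2' := L2D L1 (L2Z b%:C Lg).
rewrite (rinnerDl L2' (L2Z c%:C Lh) Lm).
rewrite (rinnerDl L1 (L2Z b%:C Lg) Lm) (rinnerNl (L2Z a%:C Lf) Lm).
by rewrite (rinnerZl a Lf Lm) (rinnerZl b Lg Lm) (rinnerZl c Lh Lm).
Qed.

Lemma rinner_comb3' (a b c : R) f g h m :
  L2 l f -> L2 l g -> L2 l h -> L2 l m ->
  rinner l (- (a%:C *: f) + b%:C *: g - c%:C *: h) m =
  - (a * rinner l f m) + b * rinner l g m - c * rinner l h m.
Proof.
move=> Lf Lg Lh Lm; have := rinner_comb3 a b (- c) Lf Lg Lh Lm.
by rewrite rmorphN scaleNr mulNr.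
Qed.

Lemma rinner_comb2 (a b : R) f g m : L2 l f -> L2 l g -> L2 l m ->
  rinner l (- (a%:C *: f) - b%:C *: g) m = - (a * rinner l f m) - b * rinner l g m.
Proof.
move=> Lf Lg Lm; have L1 := L2N (L2Z a%:C Lf).
rewrite (rinnerBl L1 (L2Z b%:C Lg) Lm) (rinnerNl (L2Z a%:C Lf) Lm).
by rewrite (rinnerZl a Lf Lm) (rinnerZl b Lg Lm).
Qed.

End RealCombinations.

(** * The energy form and the Lyapunov form *)

Section Energy.
Context (R : realType) (c : params R) (e : nat -> R -> R[i]) (lam : nat -> R).
Local Notation l := (len c).
Hypotheses (c_pos : params_pos c) (eb : eigenbasis l e lam).
Implicit Types (U V W : state R).
Local Notation ip := (rinner l).
Local Notation D f := (wdx l f).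
Local Notation half f := (fpow l (1 / 2) f).

Let l_gt0 : 0 < l. Proof. by case: c_pos. Qed.

Definition shear1 U : R -> R[i] := D (U cphi) - U cpsi.
Definition shear2 U : R -> R[i] := D (U cy) - U cz.
Definition gap U : R -> R[i] := U cy - U cphi.

Definition energy_form U V : R :=
  rho1 c * ip (U cu) (V cu) + rho2 c * ip (U cv) (V cv) +
  rho3 c * ip (U cs) (V cs) + rho4 c * ip (U cw) (V cw) +
  b1 c * ip (half (U cpsi)) (half (V cpsi)) + b2 c * ip (half (U cz)) (half (V cz)) +
  kappa1 c * ip (shear1 U) (shear1 V) + kappa2 c * ip (shear2 U) (shear2 V) +
  jm c * ip (gap U) (gap V) +
  rho5 c * delta c / beta c * ip (half (U ctheta)) (half (V ctheta)).

(** Symmetrized, so that [cross i j (B U) U] is the formal time derivative of [Re <U i, U j>]; on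
    the diagonal it is twice that real part. *)
Definition cross (i j : component) U V : R := ip (U i) (V j) + ip (U j) (V i).

(** [M] will be fixed by [rho2] and [beta]; then [N] is taken large enough for the energy to
    dominate the cross terms and for its dissipation to absorb what their derivatives leave. *)
Definition lyapunov_form (N M : R) U V : R :=
  N * energy_form U V + M * rho5 c * cross ctheta cv U V +
  rho1 c * cross cu cphi U V + rho2 c * cross cv cpsi U V +
  rho3 c * cross cs cy U V + rho4 c * cross cw cz U V.

Lemma phase_normE U : phase_norm c U = Num.sqrt (energy_form U U).
Proof.
(* With the three operations abstracted, squared norms, [dx] and [powA] are exchanged for [rinner],
   [wdx] and [fpow] at once. *)
pose G (nsq : (R -> R[i]) -> R) (d h : (R -> R[i]) -> R -> R[i]) := Num.sqrt (
  rho1 c * nsq (U cu) + rho2 c * nsq (U cv) +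
  rho3 c * nsq (U cs) + rho4 c * nsq (U cw) +
  b1 c * nsq (h (U cpsi)) + b2 c * nsq (h (U cz)) +
  kappa1 c * nsq (d (U cphi) - U cpsi) + kappa2 c * nsq (d (U cy) - U cz) +
  jm c * nsq (U cy - U cphi) + rho5 c * delta c / beta c * nsq (h (U ctheta))).
have E1 : (fun f => l2norm l f ^+ 2) = (fun f => ip f f).
  by apply/funext => f; exact: l2norm_sqr.
have E2 : dx l = wdx l by apply/funext => f; exact: wdxE.
have E3 : powA l (1 / 2) = fpow l (1 / 2) by apply/funext => f; exact: fpowE.
exact: (f_equal3 G E1 E2 E3).
Qed.

End Energy.

HB.lock Definition lopA (R : realType) (l : R) (f : R -> R[i]) : R -> R[i] := opA l f.

Lemma lopAE (R : realType) (l : R) : opA l = lopA l.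
Proof. by rewrite lopA.unlock. Qed.

(** * The phase space, and exact identities for the forms on the domain *)

Section EnergyIdentities.
Context (R : realType) (c : params R) (e : nat -> R -> R[i]) (lam : nat -> R).
Local Notation l := (len c).
Hypotheses (c_pos : params_pos c) (eb : eigenbasis l e lam).
Implicit Types (U V W : state R) (f g k : R -> R[i]).
Local Notation H := (phase_space c).
Local Notation ip := (rinner l).
Local Notation D f := (wdx l f).
Local Notation half f := (fpow l (1 / 2) f).

Let l_gt0 : 0 < l. Proof. by case: c_pos. Qed.

Definition half_component (i : component) : bool :=
  match i with cphi | cpsi | cy | cz | ctheta => true | _ => false end.

Lemma phase_spaceP U :
  H U <-> forall i, if half_component i then DpowA l (1 / 2) (U i) else L2 l (U i).
Proof.
split.
  move=> [[h1 h2 h3 h4] [h5 h6 h7 h8 h9]] i; case: i.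
  exact: h1. exact: h2. exact: h3. exact: h4. exact: h5. exact: h6. exact: h7.
  exact: h8. exact: h9.
move=> h; split; split.
exact: (h cphi). exact: (h cu). exact: (h cpsi). exact: (h cv). exact: (h cy).
exact: (h cs). exact: (h cz). exact: (h cw). exact: (h ctheta).
Qed.

Lemma phase_L2 U i : H U -> L2 l (U i).
Proof.
move=> /phase_spaceP/(_ i); case: half_component => //; exact: DpowA_L2.
Qed.

Lemma phase_half U i : H U -> half_component i -> DpowA l (1 / 2) (U i).
Proof. by move=> /phase_spaceP/(_ i) + hi; rewrite hi. Qed.

Lemma phase_subspace : is_subspace H.
Proof.
split.
  apply/phase_spaceP => i; case: half_component; last exact: L2_0.
  exact: (DpowA_subspace l_gt0 eb (1 / 2)).1.
move=> a U V HU HV; apply/phase_spaceP => i.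
case hi : (half_component i).
  exact: (powA_linear l_gt0 eb a (phase_half HU hi) (phase_half HV hi)).1.
exact: (L2_subspace l).2 _ _ _ (phase_L2 i HU) (phase_L2 i HV).
Qed.

Lemma component_null_linear i : null_linear H l (fun U => U i).
Proof.
split=> [U HU|a U V HU HV]; first exact: phase_L2.
by rewrite subrr l2norm0.
Qed.

Lemma half_null_linear i : half_component i -> null_linear H l (fun U => half (U i)).
Proof.
move=> hi; split=> [U HU|a U V HU HV]; first exact: (L2_powA (phase_half HU hi)).
exact: (powA_linear l_gt0 eb a (phase_half HU hi) (phase_half HV hi)).2.
Qed.

Lemma dx_null_linear i : half_component i -> null_linear H l (fun U => D (U i)).
Proof.
move=> hi; split=> [U HU|a U V HU HV].
  exact: (L2_half_dx l_gt0 eb (phase_half HU hi)).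
exact: (half_dx_linear l_gt0 eb a (phase_half HU hi) (phase_half HV hi)).
Qed.

Lemma shear1_null_linear : null_linear H l (@shear1 R c).
Proof.
exact: (null_linearB phase_subspace (dx_null_linear (isT : half_component cphi))
  (component_null_linear cpsi)).
Qed.

Lemma shear2_null_linear : null_linear H l (@shear2 R c).
Proof.
exact: (null_linearB phase_subspace (dx_null_linear (isT : half_component cy))
  (component_null_linear cz)).
Qed.

Lemma gap_null_linear : null_linear H l (@gap R).
Proof.
exact: (null_linearB phase_subspace (component_null_linear cy) (component_null_linear cphi)).
Qed.

Let sq i := square_form phase_subspace (component_null_linear i).
Let sqh i (hi : half_component i) := square_form phase_subspace (half_null_linear hi).

Lemma energy_form_sym : sym_form H (energy_form c).
Proof.
exact: (sym_formD (sym_formD (sym_formD (sym_formD (sym_formD (sym_formD (sym_formD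
  (sym_formD (sym_formD
  (sym_formZ (rho1 c) (sq cu)) (sym_formZ (rho2 c) (sq cv)))
  (sym_formZ (rho3 c) (sq cs))) (sym_formZ (rho4 c) (sq cw)))
  (sym_formZ (b1 c) (sqh (isT : half_component cpsi))))
  (sym_formZ (b2 c) (sqh (isT : half_component cz))))
  (sym_formZ (kappa1 c) (square_form phase_subspace shear1_null_linear)))
  (sym_formZ (kappa2 c) (square_form phase_subspace shear2_null_linear)))
  (sym_formZ (jm c) (square_form phase_subspace gap_null_linear)))
  (sym_formZ (rho5 c * delta c / beta c) (sqh (isT : half_component ctheta)))).
Qed.

Lemma cross_sym i j : sym_form H (cross c i j).
Proof.
exact: (cross_form phase_subspace (component_null_linear i) (component_null_linear j)).
Qed.

Lemma lyapunov_form_sym N M : sym_form H (lyapunov_form c N M).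
Proof.
exact: (sym_formD (sym_formD (sym_formD (sym_formD (sym_formD
  (sym_formZ N energy_form_sym)
  (sym_formZ (M * rho5 c) (cross_sym ctheta cv)))
  (sym_formZ (rho1 c) (cross_sym cu cphi)))
  (sym_formZ (rho2 c) (cross_sym cv cpsi)))
  (sym_formZ (rho3 c) (cross_sym cs cy)))
  (sym_formZ (rho4 c) (cross_sym cw cz))).
Qed.

Lemma energy_form_ge0 U : 0 <= energy_form c U U.
Proof.
have [_ [[r1 r2 r3 r4 r5] [[k1 k2 p1 p2 j] [_ [d b K]]]]] := c_pos.
have r6 : 0 < rho5 c * delta c / beta c by rewrite divr_gt0// mulr_gt0.
by rewrite /energy_form !addr_ge0// mulr_ge0 ?rinner_ge0// ltW.
Qed.

Lemma ibp f k : DpowA l (1 / 2) f -> DpowA l (1 / 2) k -> ip (D f) k = - ip f (D k).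
Proof.
move=> Df Dk; have [Lf _ _] := half_h10 l_gt0 eb Df.
have W := h10_weak l_gt0 (half_h10 l_gt0 eb Df).
have [_ _ hk] := half_h10 l_gt0 eb Dk.
by rewrite !rinnerE (hk _ _ Lf W); case: (inner l f _).
Qed.

Lemma ip_opA f k : sobolev l 2 f -> DpowA l (1 / 2) k -> ip (lopA l f) k = ip (D f) (D k).
Proof.
move=> Sf Dk; rewrite !rinnerE -lopAE.
by rewrite (inner_opA eb Sf (half_h10 l_gt0 eb Dk)).
Qed.

Section Generator.
Variables (tau1 tau2 tau3 : R) (U : state R).
Hypothesis DU : DB1 c tau1 tau2 tau3 U.
Local Notation B := (opB1 c tau1 tau2 tau3 U).
Local Notation phi := (U cphi).
Local Notation u := (U cu).
Local Notation psi := (U cpsi).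
Local Notation v := (U cv).
Local Notation y := (U cy).
Local Notation s := (U cs).
Local Notation z := (U cz).
Local Notation w := (U cw).
Local Notation theta := (U ctheta).

Lemma DB1_phase : H U. Proof. by case: DU. Qed.

Lemma opB1_phase : H B. Proof. by case: DU => _ [_ [_ [_]]]. Qed.

Lemma DB1_half i : DpowA l (1 / 2) (U i).
Proof.
case: DU => [[[h1 h2 h3 h4] [h5 h6 h7 h8 h9]] [[g1 g2 g3 g4] _]].
case: i.
exact: h1. exact: g1. exact: h3. exact: g2. exact: h5. exact: g3. exact: h7.
exact: g4. exact: h9.
Qed.

Lemma DB1_sobolev2 i : half_component i -> sobolev l 2 (U i).
Proof.
case: DU => _ [_ [[[_ S3] [[Sp _] _] [Ss _] [[Sy _] _] [[Sz _] _]] _]].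
by case: i => // _; exact: (sobolevS S3).
Qed.

Lemma DB1_damping : [/\ DpowA l tau1 u, DpowA l tau2 s & DpowA l tau3 w].
Proof. by case: DU => _ [_ [_ []]]. Qed.

Let L i : L2 l (U i). Proof. exact: (phase_L2 i DB1_phase). Qed.
Let LD i : L2 l (D (U i)). Proof. exact: (L2_half_dx l_gt0 eb (DB1_half i)). Qed.
Let LA i : half_component i -> L2 l (lopA l (U i)).
Proof. by rewrite -lopAE => /DB1_sobolev2/(L2_opA eb). Qed.
Let L1 : L2 l (shear1 c U). Proof. exact: L2B. Qed.
Let L2' : L2 l (shear2 c U). Proof. exact: L2B. Qed.
Let Lg : L2 l (gap U). Proof. exact: L2B. Qed.

Lemma opB1_u k : L2 l k -> rho1 c * ip (B cu) k =
  - (kappa1 c * ip (lopA l phi) k) - kappa1 c * ip (D psi) k + jm c * ip (gap U) k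
  - gamma1 c * ip (fpow l tau1 u) k.
Proof.
move=> Lk; have [_ [[r1 _ _ _ _] _]] := c_pos; have [D1 _ _] := DB1_damping.
rewrite /= lopAE (fpowE l tau1 u) (wdxE l psi)
  (rinner_comb4 _ _ _ _ (LA (isT : half_component cphi)) (LD cpsi) Lg (L2_powA D1) Lk).
by field; rewrite gt_eqF.
Qed.

Lemma opB1_v k : L2 l k -> rho2 c * ip (B cv) k =
  - (b1 c * ip (lopA l psi) k) + kappa1 c * ip (shear1 c U) k + delta c * ip (lopA l theta) k.
Proof.
move=> Lk; have [_ [[_ r2 _ _ _] _]] := c_pos.
rewrite /= lopAE (wdxE l phi) (rinner_comb3 _ _ _ (LA (isT : half_component cpsi)) L1
  (LA (isT : half_component ctheta)) Lk).
by field; rewrite gt_eqF.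
Qed.

Lemma opB1_s k : L2 l k -> rho3 c * ip (B cs) k =
  - (kappa2 c * ip (lopA l y) k) - kappa2 c * ip (D z) k - jm c * ip (gap U) k
  - gamma2 c * ip (fpow l tau2 s) k.
Proof.
move=> Lk; have [_ [[_ _ r3 _ _] _]] := c_pos; have [_ D2 _] := DB1_damping.
rewrite /= lopAE (fpowE l tau2 s) (wdxE l z)
  (rinner_comb4' _ _ _ _ (LA (isT : half_component cy)) (LD cz) Lg (L2_powA D2) Lk).
by field; rewrite gt_eqF.
Qed.

Lemma opB1_w k : L2 l k -> rho4 c * ip (B cw) k =
  - (b2 c * ip (lopA l z) k) + kappa2 c * ip (shear2 c U) k - gamma3 c * ip (fpow l tau3 w) k.
Proof.
move=> Lk; have [_ [[_ _ _ r4 _] _]] := c_pos; have [_ _ D3] := DB1_damping.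
rewrite /= lopAE (fpowE l tau3 w) (wdxE l y)
  (rinner_comb3' _ _ _ (LA (isT : half_component cz)) L2' (L2_powA D3) Lk).
by field; rewrite gt_eqF.
Qed.

Lemma opB1_theta k : L2 l k -> rho5 c * ip (B ctheta) k =
  - (K c * ip (lopA l theta) k) - beta c * ip v k.
Proof.
move=> Lk; have [_ [[_ _ _ _ r5] _]] := c_pos.
rewrite /= lopAE (rinner_comb2 _ _ (LA (isT : half_component ctheta)) (L cv) Lk).
by field; rewrite gt_eqF.
Qed.

Let expandB f g h k : L2 l f -> L2 l g -> L2 l h -> L2 l k ->
  ip (f - g) (h - k) = ip f h - ip f k - ip g h + ip g k.
Proof.
move=> Lf Lg' Lh Lk; rewrite (rinnerBl Lf Lg' (L2B Lh Lk)).
by rewrite (rinnerBr Lh Lk Lf) (rinnerBr Lh Lk Lg'); ring.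
Qed.

(** The elastic terms cancel by integration by parts. The weight [rho5 * delta / beta] is the one
    for which the coupling cancels: [delta <A theta, v>] from the equation of [v] meets
    [- delta <v, A theta>] from that of [theta]. *)
Lemma energy_dissipation : energy_form c B U =
  - (gamma1 c * ip (fpow l tau1 u) u + gamma2 c * ip (fpow l tau2 s) s +
     gamma3 c * ip (fpow l tau3 w) w +
     K c * delta c / beta c * ip (lopA l theta) (lopA l theta)).
Proof.
have [_ [[r1 r2 r3 r4 r5] [_ [_ [d b _]]]]] := c_pos.
have hB := phase_half opB1_phase (isT : half_component ctheta).
have At := LA (isT : half_component ctheta).
rewrite /energy_form (opB1_u (L cu)) (opB1_v (L cv)) (opB1_s (L cs)) (opB1_w (L cw)).
rewrite -[half (B cpsi)]/(half v) -[half (B cz)]/(half w).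
rewrite -(half_rinner l_gt0 eb (DB1_half cv) (DB1_half cpsi)).
rewrite -(half_rinner l_gt0 eb (DB1_half cw) (DB1_half cz)).
rewrite -(half_rinner l_gt0 eb hB (DB1_half ctheta)).
rewrite -[shear1 c B]/(D u - v) -[shear2 c B]/(D s - w) -[gap B]/(s - u).
have [_ LDB _] := half_h10 l_gt0 eb hB.
(* Green's formula turns the product of the derivatives of [B ctheta] and [theta] into
   [<A theta, B ctheta>]. It applies because [opB1 U] is in the phase space, so its last component
   is in D(A^(1/2)). *)
rewrite (rinnerC LDB (LD ctheta)) -(ip_opA (DB1_sobolev2 (isT : half_component ctheta)) hB).
rewrite (rinnerC At (phase_L2 ctheta opB1_phase)).
have -> : rho5 c * delta c / beta c * ip (B ctheta) (lopA l theta) =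
    delta c / beta c * (rho5 c * ip (B ctheta) (lopA l theta)) by ring.
rewrite (opB1_theta At).
rewrite (ip_opA (DB1_sobolev2 (isT : half_component cphi)) (DB1_half cu)).
rewrite (ip_opA (DB1_sobolev2 (isT : half_component cpsi)) (DB1_half cv)).
rewrite (ip_opA (DB1_sobolev2 (isT : half_component cy)) (DB1_half cs)).
rewrite (ip_opA (DB1_sobolev2 (isT : half_component cz)) (DB1_half cw)).
rewrite (ibp (DB1_half cpsi) (DB1_half cu)) (ibp (DB1_half cz) (DB1_half cs)).
rewrite /shear1 /shear2 /gap.
rewrite (rinnerBl (LD cphi) (L cpsi) (L cv)) (rinnerBl (LD cy) (L cz) (L cw)).
rewrite (rinnerBl (L cy) (L cphi) (L cu)) (rinnerBl (L cy) (L cphi) (L cs)).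
rewrite (expandB (LD cu) (L cv) (LD cphi) (L cpsi)) (expandB (LD cs) (L cw) (LD cy) (L cz)).
rewrite (expandB (L cs) (L cu) (L cy) (L cphi)).
rewrite (rinnerC (LD cv) (LD cpsi)) (rinnerC (LD cw) (LD cz)).
rewrite (rinnerC (LD cu) (LD cphi)) (rinnerC (LD cu) (L cpsi)) (rinnerC (L cv) (LD cphi)).
rewrite (rinnerC (LD cs) (LD cy)) (rinnerC (LD cs) (L cz)) (rinnerC (L cw) (LD cy)).
rewrite (rinnerC (L cv) (L cpsi)) (rinnerC (L cw) (L cz)).
rewrite (rinnerC (L cs) (L cy)) (rinnerC (L cs) (L cphi)) (rinnerC (L cu) (L cy)).
rewrite (rinnerC (L cu) (L cphi)) (rinnerC (L cv) At).
by field; rewrite gt_eqF.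
Qed.

(** The product [<A psi, theta>] is rewritten as [<A theta, psi>]: the dissipation controls
    [A theta], whereas nothing controls [A psi]. *)
Lemma cross_theta_v : rho5 c * cross c ctheta cv B U =
  - (K c * ip (lopA l theta) v) - beta c * ip v v
  + rho5 c / rho2 c * (- (b1 c * ip (lopA l theta) psi) + kappa1 c * ip (shear1 c U) theta
  + delta c * ip (lopA l theta) theta).
Proof.
have [_ [[r1 r2 r3 r4 r5] _]] := c_pos.
have -> : rho5 c * cross c ctheta cv B U =
   rho5 c * ip (B ctheta) v + rho5 c / rho2 c * (rho2 c * ip (B cv) theta).
  by rewrite /cross; field; rewrite gt_eqF.
rewrite (opB1_theta (L cv)) (opB1_v (L ctheta)).
rewrite (ip_opA (DB1_sobolev2 (isT : half_component cpsi)) (DB1_half ctheta)).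
rewrite (ip_opA (DB1_sobolev2 (isT : half_component ctheta)) (DB1_half cpsi)).
by rewrite (rinnerC (LD cpsi) (LD ctheta)).
Qed.

(** Each momentum equation is tested with its own displacement. The price is the kinetic energies
    with a plus sign and the products of [A theta] and of the fractional powers with displacements,
    all to be absorbed. *)
Lemma multipliers :
  rho1 c * cross c cu cphi B U + rho2 c * cross c cv cpsi B U +
  rho3 c * cross c cs cy B U + rho4 c * cross c cw cz B U =
  rho1 c * ip u u + rho2 c * ip v v + rho3 c * ip s s + rho4 c * ip w w
  - kappa1 c * ip (shear1 c U) (shear1 c U) - kappa2 c * ip (shear2 c U) (shear2 c U)
  - jm c * ip (gap U) (gap U) - b1 c * ip (D psi) (D psi) - b2 c * ip (D z) (D z)
  + delta c * ip (lopA l theta) psi - gamma1 c * ip (fpow l tau1 u) phi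
  - gamma2 c * ip (fpow l tau2 s) y - gamma3 c * ip (fpow l tau3 w) z.
Proof.
rewrite /cross -[B cphi]/u -[B cpsi]/v -[B cy]/s -[B cz]/w.
rewrite !mulrDr (opB1_u (L cphi)) (opB1_v (L cpsi)) (opB1_s (L cy)) (opB1_w (L cz)).
rewrite (ip_opA (DB1_sobolev2 (isT : half_component cphi)) (DB1_half cphi)).
rewrite (ip_opA (DB1_sobolev2 (isT : half_component cpsi)) (DB1_half cpsi)).
rewrite (ip_opA (DB1_sobolev2 (isT : half_component cy)) (DB1_half cy)).
rewrite (ip_opA (DB1_sobolev2 (isT : half_component cz)) (DB1_half cz)).
rewrite (ibp (DB1_half cpsi) (DB1_half cphi)) (ibp (DB1_half cz) (DB1_half cy)).
rewrite /shear1 /shear2 /gap.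
rewrite (rinnerBl (LD cphi) (L cpsi) (L cpsi)) (rinnerBl (LD cy) (L cz) (L cz)).
rewrite (rinnerBl (L cy) (L cphi) (L cphi)) (rinnerBl (L cy) (L cphi) (L cy)).
rewrite (expandB (LD cphi) (L cpsi) (LD cphi) (L cpsi)) (expandB (LD cy) (L cz) (LD cy) (L cz)).
rewrite (expandB (L cy) (L cphi) (L cy) (L cphi)).
rewrite (rinnerC (LD cphi) (L cpsi)) (rinnerC (LD cy) (L cz)) (rinnerC (L cphi) (L cy)).
ring.
Qed.

End Generator.
End EnergyIdentities.

(** Applied to [Z = <A^tau u, phi>], [d = <A^tau u, u>], [dphi = |phi_x|^2], [F] the squared shear
    and [p = |psi_x|^2], and likewise to [y] and [z]. The energy holds the shear and not [phi_x], so
    [phi_x] is paid by a quarter of the shear energy and a quarter of the bending energy. *)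
Lemma cross_absorb (R : realType) (g k b eps C P Z d dphi F p : R) :
  0 < g -> 0 < eps -> 0 < C -> 0 <= F -> 0 <= p ->
  - 2 * Z <= eps^-1 * d + eps * C * dphi -> dphi <= 2 * F + 2 * P * p ->
  g * eps * C <= k / 4 -> g * eps * C * P <= b / 4 ->
  - g * Z <= g / 2 * eps^-1 * d + k / 4 * F + b / 4 * p.
Proof.
move=> g0 e0 C0 F0 p0 hZ hd hk hb.
have q1 := ler_wpM2l (ltW g0) hZ; have q2 := ler_wpM2l (ltW (mulr_gt0 (mulr_gt0 g0 e0) C0)) hd.
have q3 := ler_wpM2r F0 hk; have q4 := ler_wpM2r p0 hb.
move: q1 q2 q3 q4; generalize (eps^-1) => ie; clear; lra.
Qed.

(** Counterpart for [z], whose gradient is in the energy itself. *)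
Lemma cross_absorb_eq (R : realType) (g k eps C Z d z : R) : 0 < g ->
  - 2 * Z <= eps^-1 * d + eps * C * z -> g * eps * C / 2 = k ->
  - g * Z <= g / 2 * eps^-1 * d + k * z.
Proof.
by move=> g0 hZ <-; have := ler_wpM2l (ltW g0) hZ; generalize (eps^-1) => ie; lra.
Qed.

(** The final budget, on bare reals. Shear and bending energies start with weight [-1] and lend at
    most two quarters each, which leaves the required half. The kinetic term of [v] counts
    [- 2 + 1 + 1 / 2 = - 1 / 2] times [r2]. Those of [u], [s], [w] are written [3 / 2 - 1 / 2], and
    the thermal energy, absent from the left, is [1 / 2 - 1 / 2]; the positive parts are charged to
    the dissipation [S]. *)
Lemma multiplier_arith (R : realType) (M K beta r1 r2 r3 r4 r5 r2i k1 k2 b1 b2 j dl r6 P C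
    c1 c2 c3 c4 X1 X2 X3 X4 g1 g2 g3 Z1 Z2 Z3 nu nv ns nw p z F G J th npsi nth T d1 d2 d3
    f1 f2 f3 f4 f5 f6 f7 h2 h3 h4 S : R) :
  r1 * c1 + r2 * c2 + r3 * c3 + r4 * c4 = r1 * nu + r2 * nv + r3 * ns + r4 * nw
    - k1 * F - k2 * G - j * J - b1 * p - b2 * z + dl * X2 - g1 * Z1 - g2 * Z2 - g3 * Z3 ->
  - (M * K) * X1 <= f1 * T + r2 / 2 * nv ->
  (dl - M * r5 * r2i * b1) * X2 <= f2 * T + h2 * npsi ->
  M * r5 * r2i * k1 * X3 <= h3 * nth + k1 / 4 * F ->
  M * r5 * r2i * dl * X4 <= h4 * T + 1 * nth ->
  h2 * npsi <= b1 / 4 * p -> h3 * nth <= f3 * T -> h4 * T + 1 * nth <= f4 * T ->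
  - g1 * Z1 <= f5 * d1 + k1 / 4 * F + b1 / 4 * p ->
  - g2 * Z2 <= f6 * d2 + k2 / 4 * G + b2 / 4 * z ->
  - g3 * Z3 <= f7 * d3 + b2 / 4 * z ->
  M * beta * nv = 2 * r2 * nv ->
  f1 * T <= f1 * S -> f2 * T <= f2 * S -> f3 * T <= f3 * S -> f4 * T <= f4 * S ->
  f5 * d1 <= f5 * S -> f6 * d2 <= f6 * S -> f7 * d3 <= f7 * S ->
  r1 * nu <= r1 * C * S -> r3 * ns <= r3 * C * S -> r4 * nw <= r4 * C * S ->
  r6 * th <= r6 * P * S ->
  0 <= k2 * G -> 0 <= j * J ->
  M * (- (K * X1) - beta * nv + r5 * r2i * (- (b1 * X2) + k1 * X3 + dl * X4)) +
    r1 * c1 + r2 * c2 + r3 * c3 + r4 * c4 <=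
  (f1 + f2 + f3 + f4 + f5 + f6 + f7 + 3 / 2 * C * (r1 + r3 + r4) + P / 2 * r6) * S -
  (r1 * nu + r2 * nv + r3 * ns + r4 * nw + b1 * p + b2 * z + k1 * F + k2 * G + j * J
   + r6 * th) / 2.
Proof. lra. Qed.

(** * Bounds for the cross terms and for their derivatives *)

Section Stability.
Context (R : realType) (c : params R) (e : nat -> R -> R[i]) (lam : nat -> R).
Local Notation l := (len c).
Hypotheses (c_pos : params_pos c) (eb : eigenbasis l e lam).
Implicit Types (U V W : state R) (f g k : R -> R[i]).
Local Notation H := (phase_space c).
Local Notation ip := (rinner l).
Local Notation D f := (wdx l f).
Local Notation E U := (energy_form c U U).
Local Notation P := (4 * l ^+ 2).
Local Notation C := (spectral_const l).

Let l_gt0 : 0 < l. Proof. by case: c_pos. Qed.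
Let P_gt0 : 0 < P. Proof. by rewrite mulr_gt0// exprn_gt0. Qed.

Let h1 : half_component cphi := isT.
Let h2 : half_component cpsi := isT.
Let h3 : half_component cy := isT.
Let h4 : half_component cz := isT.
Let h5 : half_component ctheta := isT.

Lemma energy_bounds U : H U ->
  [/\ rho1 c * ip (U cu) (U cu) <= E U, rho2 c * ip (U cv) (U cv) <= E U,
      rho3 c * ip (U cs) (U cs) <= E U & rho4 c * ip (U cw) (U cw) <= E U] /\
  [/\ b1 c * ip (D (U cpsi)) (D (U cpsi)) <= E U,
      b2 c * ip (D (U cz)) (D (U cz)) <= E U,
      kappa1 c * ip (shear1 c U) (shear1 c U) <= E U,
      kappa2 c * ip (shear2 c U) (shear2 c U) <= E U &
      rho5 c * delta c / beta c * ip (D (U ctheta)) (D (U ctheta)) <= E U].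
Proof.
move=> HU; have [_ [[r1 r2 r3 r4 r5] [[k1 k2 p1 p2 j] [_ [d b K]]]]] := c_pos.
have r6 : 0 < rho5 c * delta c / beta c by rewrite divr_gt0// mulr_gt0.
rewrite /energy_form.
rewrite -(half_rinner l_gt0 eb (phase_half HU h2) (phase_half HU h2)).
rewrite -(half_rinner l_gt0 eb (phase_half HU h4) (phase_half HU h4)).
rewrite -(half_rinner l_gt0 eb (phase_half HU h5) (phase_half HU h5)).
have m0 (a : R) f : 0 < a -> 0 <= a * ip f f.
  by move=> a0; rewrite mulr_ge0 ?rinner_ge0// ltW.
have := m0 _ (U cu) r1.
have := m0 _ (U cv) r2.
have := m0 _ (U cs) r3.
have := m0 _ (U cw) r4.
have := m0 _ (D (U cpsi)) p1.
have := m0 _ (D (U cz)) p2.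
have := m0 _ (shear1 c U) k1.
have := m0 _ (shear2 c U) k2.
have := m0 _ (gap U) j.
have := m0 _ (D (U ctheta)) r6.
generalize (rho1 c * ip (U cu) (U cu)) (rho2 c * ip (U cv) (U cv))
  (rho3 c * ip (U cs) (U cs)) (rho4 c * ip (U cw) (U cw))
  (b1 c * ip (D (U cpsi)) (D (U cpsi))) (b2 c * ip (D (U cz)) (D (U cz)))
  (kappa1 c * ip (shear1 c U) (shear1 c U)) (kappa2 c * ip (shear2 c U) (shear2 c U))
  (jm c * ip (gap U) (gap U)) (rho5 c * delta c / beta c * ip (D (U ctheta)) (D (U ctheta))).
by move=> *; split; split; lra.
Qed.

(** Splits [f' = (f' - g) + g] and uses Poincare for [g]. It recovers the gradients of [phi] and
    [y], present in the energy only through the shears. *)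
Lemma dx_shear f g : DpowA l (1 / 2) f -> DpowA l (1 / 2) g ->
  ip (D f) (D f) <= 2 * ip (D f - g) (D f - g) + 2 * P * ip (D g) (D g).
Proof.
move=> Df Dg; have LD := L2_half_dx l_gt0 eb Df; have Lg := DpowA_L2 Dg.
have Ld := L2B LD Lg.
have := half_poincare l_gt0 eb Dg; have := rinner_ge0 l (D f - g - g).
rewrite (rinnerBl Ld Lg (L2B Ld Lg)) (rinnerBr Ld Lg Ld) (rinnerBr Ld Lg Lg).
rewrite (rinnerBl LD Lg Ld) (rinnerBl LD Lg Lg) (rinnerBr LD Lg LD) (rinnerBr LD Lg Lg).
rewrite (rinnerC Lg LD).
generalize (ip (D f) (D f)) (ip (D f) g) (ip g g) (ip (D g) (D g)) => a x y t; lra.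
Qed.

(** [|f'|^2 = <A f, f>]; Young with weight [P], then Poincare, bounds twice this by
    [P |A f|^2 + |f'|^2]. Applied to [theta], it lets the dissipation control the thermal energy. *)
Lemma sobolev2_dx_bound f : sobolev l 2 f -> DpowA l (1 / 2) f ->
  ip (D f) (D f) <= P * ip (lopA l f) (lopA l f).
Proof.
move=> Sf Df; have LA : L2 l (lopA l f) by rewrite -lopAE; exact: (L2_opA eb).
have Lf := DpowA_L2 Df; have LD := L2_half_dx l_gt0 eb Df.
have y1 := rinner_young P_gt0 LA Lf; have y2 := half_poincare l_gt0 eb Df.
rewrite (ip_opA c_pos eb Sf Df) in y1.
have : P^-1 * ip f f <= ip (D f) (D f).
  by rewrite mulrC ler_pdivrMr// mulrC.
move: y1; generalize (ip (D f) (D f)) (ip f f) (ip (lopA l f) (lopA l f)) => a x y; lra.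
Qed.

(** [P * (2 / kappa1 + 2 * P / b1)] bounds [|phi|^2] by the energy through [dx_shear], and similarly
    for [y]; the two summands 2 count the four kinetic energies. *)
Definition cross_const (M : R) : R :=
  2 + P * (2 / kappa1 c + 2 * P / b1 c) * rho1 c + rho2 c * P / b1 c +
  (P * (2 / kappa2 c + 2 * P / b2 c)) * rho3 c + rho4 c * P / b2 c + 2 +
  M * rho5 c * (P / (rho5 c * delta c / beta c) + 1 / rho2 c).

Let abs2 f g : L2 l f -> L2 l g -> `|2 * ip f g| <= ip f f + ip g g.
Proof.
move=> Lf Lg; have y1 := rinner_young ltr01 Lf Lg.
have LN := L2N Lf; have y2 := rinner_young ltr01 LN Lg.
rewrite !mul1r ?invr1 ?mul1r (rinnerNl Lf LN) (rinnerNl Lf Lg) in y1 y2.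
rewrite (rinnerC Lf LN) (rinnerNl Lf Lf) in y2.
rewrite ler_norml; move: y1 y2; rewrite ?invr1 ?mul1r.
by generalize (ip f f) (ip f g) (ip g g) => a x y; lra.
Qed.

Lemma cross_bound (M : R) U : 0 <= M -> H U ->
  `|M * rho5 c * cross c ctheta cv U U + rho1 c * cross c cu cphi U U +
    rho2 c * cross c cv cpsi U U + rho3 c * cross c cs cy U U +
    rho4 c * cross c cw cz U U| <= cross_const M * E U.
Proof.
move=> M0 HU; have [_ [[r1 r2 r3 r4 r5] [[k1 k2 p1 p2 j] [_ [d b K]]]]] := c_pos.
have r6 : 0 < rho5 c * delta c / beta c by rewrite divr_gt0// mulr_gt0.
have [[e1 e2 e3 e4] [e5 e6 e7 e8 e9]] := energy_bounds HU.
have L i := phase_L2 i HU.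
have Hp i (hi : half_component i) := half_poincare l_gt0 eb (phase_half HU hi).
have q1 := Hp _ h1; have q2 := Hp _ h2; have q3 := Hp _ h3; have q4 := Hp _ h4.
have q5 := Hp _ h5.
have s1 : ip (D (U cphi)) (D (U cphi)) <= 2 * ip (shear1 c U) (shear1 c U) +
  2 * P * ip (D (U cpsi)) (D (U cpsi)) := dx_shear (phase_half HU h1) (phase_half HU h2).
have s2 : ip (D (U cy)) (D (U cy)) <= 2 * ip (shear2 c U) (shear2 c U) +
  2 * P * ip (D (U cz)) (D (U cz)) := dx_shear (phase_half HU h3) (phase_half HU h4).
have c1 := abs2 (L cu) (L cphi); have c2 := abs2 (L cv) (L cpsi).
have c3 := abs2 (L cs) (L cy); have c4 := abs2 (L cw) (L cz).
have c5 := abs2 (L ctheta) (L cv).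
have dbl i i' : cross c i i' U U = 2 * ip (U i) (U i').
  by rewrite /cross (rinnerC (L i') (L i)); ring.
rewrite !dbl.
have E0 := energy_form_ge0 c_pos U.
move: e1 e2 e3 e4 e5 e6 e7 e8 e9 q1 q2 q3 q4 q5 s1 s2 c1 c2 c3 c4 c5 E0.
generalize (2 * ip (U cu) (U cphi)) (2 * ip (U cv) (U cpsi)) (2 * ip (U cs) (U cy))
  (2 * ip (U cw) (U cz)) (2 * ip (U ctheta) (U cv)).
generalize (ip (U cu) (U cu)) (ip (U cv) (U cv)) (ip (U cs) (U cs)) (ip (U cw) (U cw))
 (ip (D (U cpsi)) (D (U cpsi))) (ip (D (U cz)) (D (U cz)))
 (ip (shear1 c U) (shear1 c U)) (ip (shear2 c U) (shear2 c U))
 (ip (D (U ctheta)) (D (U ctheta))) (E U) (ip (U cphi) (U cphi)) (ip (U cpsi) (U cpsi))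
 (ip (U cy) (U cy)) (ip (U cz) (U cz)) (ip (U ctheta) (U ctheta))
 (ip (D (U cphi)) (D (U cphi))) (ip (D (U cy)) (D (U cy))).
move=> nu nv ns nw p z2 F G th En nphi npsi ny nz nth' dphi dy x1 x2 x3 x4 x5.
move=> e1 e2 e3 e4 e5 e6 e7 e8 e9 q1 q2 q3 q4 q5 s1 s2 c1 c2 c3 c4 c5 E0.
have F1 : F <= En / kappa1 c by rewrite ler_pdivlMr// mulrC.
have G1 : G <= En / kappa2 c by rewrite ler_pdivlMr// mulrC.
have p1' : p <= En / b1 c by rewrite ler_pdivlMr// mulrC.
have z1 : z2 <= En / b2 c by rewrite ler_pdivlMr// mulrC.
have t1 : th <= En / (rho5 c * delta c / beta c) by rewrite ler_pdivlMr// mulrC.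
have v1 : nv <= En / rho2 c by rewrite ler_pdivlMr// mulrC.
have P0 := ltW P_gt0; move: P0 q1 q2 q3 q4 q5 s1 s2; rewrite /cross_const.
move: P (rho5 c * delta c / beta c) r6 t1 => P r6' _ t1 P0 q1 q2 q3 q4 q5 s1 s2.
have Pp := ler_wpM2l P0 p1'; have Pz := ler_wpM2l P0 z1.
have i1 : nphi <= P * (2 / kappa1 c + 2 * P / b1 c) * En.
  apply: le_trans q1 _; rewrite -mulrA ler_wpM2l//; apply: le_trans s1 _; lra.
have i2 : npsi <= P / b1 c * En by lra.
have i3 : ny <= P * (2 / kappa2 c + 2 * P / b2 c) * En.
  apply: le_trans q3 _; rewrite -mulrA ler_wpM2l//; apply: le_trans s2 _; lra.
have i4 : nz <= P / b2 c * En by lra.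
have i5 : nth' <= P / r6' * En.
  by have := ler_wpM2l P0 t1; lra.
have j1 := ler_wpM2l (ltW r1) (le_trans c1 (lerD (lexx _) i1)).
have j2 := ler_wpM2l (ltW r2) (le_trans c2 (lerD (lexx _) i2)).
have j3 := ler_wpM2l (ltW r3) (le_trans c3 (lerD (lexx _) i3)).
have j4 := ler_wpM2l (ltW r4) (le_trans c4 (lerD (lexx _) i4)).
have j5 := ler_wpM2l (mulr_ge0 M0 (ltW r5)) (le_trans c5 (lerD i5 v1)).
apply: le_trans (ler_normD _ _) _; apply: le_trans (lerD (ler_normD _ _) (lexx _)) _.
apply: le_trans (lerD (lerD (ler_normD _ _) (lexx _)) (lexx _)) _.
apply: le_trans (lerD (lerD (lerD (ler_normD _ _) (lexx _)) (lexx _)) (lexx _)) _.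
rewrite !normrM (ger0_norm M0) (gtr0_norm r1) (gtr0_norm r2) (gtr0_norm r3).
rewrite (gtr0_norm r4) (gtr0_norm r5).
move: j1 j2 j3 j4 j5; lra.
Qed.

Lemma energy_expand U : H U -> E U =
  rho1 c * ip (U cu) (U cu) + rho2 c * ip (U cv) (U cv) +
  rho3 c * ip (U cs) (U cs) + rho4 c * ip (U cw) (U cw) +
  b1 c * ip (D (U cpsi)) (D (U cpsi)) + b2 c * ip (D (U cz)) (D (U cz)) +
  kappa1 c * ip (shear1 c U) (shear1 c U) + kappa2 c * ip (shear2 c U) (shear2 c U) +
  jm c * ip (gap U) (gap U) +
  rho5 c * delta c / beta c * ip (D (U ctheta)) (D (U ctheta)).
Proof.
move=> HU; rewrite /energy_form.
rewrite -(half_rinner l_gt0 eb (phase_half HU h2) (phase_half HU h2)).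
rewrite -(half_rinner l_gt0 eb (phase_half HU h4) (phase_half HU h4)).
by rewrite -(half_rinner l_gt0 eb (phase_half HU h5) (phase_half HU h5)).
Qed.

Lemma young_absorb (a eps : R) f g : 0 < eps -> L2 l f -> L2 l g ->
  a * ip f g <= a ^+ 2 / (4 * eps) * ip f f + eps * ip g g.
Proof.
move=> e0 Lf Lg; have t0 : 0 < (2 * eps)^-1 by rewrite invr_gt0 mulr_gt0.
have La := L2Z a%:C Lf.
have := rinner_young t0 La Lg; rewrite invrK.
rewrite (rinnerZl a Lf Lg) (rinnerZl a Lf La) (rinnerZr a Lf Lf).
generalize (ip f f) (ip f g) (ip g g) => x y t.
have -> : a ^+ 2 / (4 * eps) * x = ((2 * eps)^-1 * (a * (a * x))) / 2.
  by field; rewrite gt_eqF.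
lra.
Qed.

(* The choice [M * beta = 2 * rho2] makes the cross term of [theta] and [v]
   absorb the kinetic energy of [v], which is not damped directly. *)
Lemma multiplier_bound (tau1 tau2 tau3 M : R) :
  0 <= tau1 <= 1 -> 0 <= tau2 <= 1 -> 0 <= tau3 <= 1 -> M * beta c = 2 * rho2 c ->
  exists2 K1 : R, 0 <= K1 & forall U, DB1 c tau1 tau2 tau3 U ->
  M * rho5 c * cross c ctheta cv (opB1 c tau1 tau2 tau3 U) U +
  rho1 c * cross c cu cphi (opB1 c tau1 tau2 tau3 U) U +
  rho2 c * cross c cv cpsi (opB1 c tau1 tau2 tau3 U) U +
  rho3 c * cross c cs cy (opB1 c tau1 tau2 tau3 U) U +
  rho4 c * cross c cw cz (opB1 c tau1 tau2 tau3 U) U <=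
  K1 * (ip (fpow l tau1 (U cu)) (U cu) + ip (fpow l tau2 (U cs)) (U cs) +
    ip (fpow l tau3 (U cw)) (U cw) + ip (lopA l (U ctheta)) (lopA l (U ctheta)))
  - E U / 2.
Proof.
move=> t1 t2 t3 Mb.
have [_ [[r1 r2 r3 r4 r5] [[k1 k2 p1 p2 j] [[g1 g2 g3] [dl bt Kp]]]]] := c_pos.
have r6 : 0 < rho5 c * delta c / beta c by rewrite divr_gt0// mulr_gt0.
have C1 := spectral_const_ge1 l; have C0 : 0 < C by rewrite (lt_le_trans ltr01).
have P0 := P_gt0.
(* The coefficients of [<A theta, v>], [<A theta, psi>], [<shear1, theta>] and [<A theta, theta>];
   [a2] gathers contributions of both kinds of multipliers. *)
pose a1 := - (M * K c); pose a2 := delta c - M * rho5 c / rho2 c * b1 c.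
pose a3 := M * rho5 c / rho2 c * kappa1 c; pose a4 := M * rho5 c / rho2 c * delta c.
(* Chosen for [gamma * eps * C <= kappa / 4] and [gamma * eps * C * P <= b / 4], the conditions of
   [cross_absorb]; [eps3] has only the gradient of [z] to absorb, at the price [b2 / 4]. *)
pose eps1 := Num.min (kappa1 c) (b1 c / P) / (4 * gamma1 c * C).
pose eps2 := Num.min (kappa2 c) (b2 c / P) / (4 * gamma2 c * C).
pose eps3 := b2 c / (2 * gamma3 c * C).
have e1 : 0 < eps1 by rewrite divr_gt0 ?mulr_gt0// lt_min k1 divr_gt0.
have e2 : 0 < eps2 by rewrite divr_gt0 ?mulr_gt0// lt_min k2 divr_gt0.
have e3 : 0 < eps3 by rewrite divr_gt0 ?mulr_gt0.
have epsC (kap b eps gam : R) : 0 < gam -> eps = Num.min kap (b / P) / (4 * gam * C) ->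
    gam * eps * C <= kap / 4 /\ gam * eps * C * P <= b / 4.
  move=> gam0 ->; have -> : gam * (Num.min kap (b / P) / (4 * gam * C)) * C =
     Num.min kap (b / P) / 4 by field; rewrite !gt_eqF.
  split; first by rewrite ler_wpM2r ?invr_ge0// ge_min lexx.
  have -> : Num.min kap (b / P) / 4 * P = (Num.min kap (b / P) * P) / 4 by ring.
  rewrite ler_wpM2r ?invr_ge0//; rewrite -ler_pdivlMr// ge_min lexx orbT//.
have [x1 x2] := epsC _ _ _ _ g1 (erefl eps1); have [x3 x4] := epsC _ _ _ _ g2 (erefl eps2).
have x5 : gamma3 c * eps3 * C / 2 = b2 c / 4.
  by rewrite /eps3; field; rewrite !gt_eqF.
(* Young constants charging the four products to [|A theta|^2]. The factor next to 4 in each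
   denominator is the amount borrowed: [b1 / (4 * P)] becomes [b1 / 4] after Poincare. The factor
   [P * P] bounds [|theta|^2] by [|A theta|^2]. *)
pose kT1 := a1 ^+ 2 / (4 * (rho2 c / 2)).
pose kT2 := a2 ^+ 2 / (4 * (b1 c / (4 * P))).
pose kT3 := a3 ^+ 2 / (4 * (kappa1 c / 4)) * (P * P).
pose kT4 := a4 ^+ 2 / (4 * 1) + 1 * (P * P).
pose kd1 := gamma1 c / 2 * eps1^-1; pose kd2 := gamma2 c / 2 * eps2^-1.
pose kd3 := gamma3 c / 2 * eps3^-1.
have q (x y : R) : 0 < y -> 0 <= x ^+ 2 / (4 * y).
  by move=> y0; rewrite mulr_ge0 ?sqr_ge0// invr_ge0 mulr_ge0// ltW.
have PP : 0 <= P * P by rewrite mulr_ge0// ltW.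
have z (x y : R) : 0 < x -> 0 < y -> 0 <= x / 2 * y^-1.
  by move=> x0 y0; rewrite ltW// mulr_gt0 ?invr_gt0// divr_gt0.
have v1 : 0 < rho2 c / 2 by rewrite divr_gt0.
have v2 : 0 < b1 c / (4 * P) by rewrite divr_gt0// mulr_gt0.
have v3 : 0 < kappa1 c / 4 by rewrite divr_gt0.
have kT1_ge0 : 0 <= kT1 by exact: q.
have kT2_ge0 : 0 <= kT2 by exact: q.
have kT3_ge0 : 0 <= kT3 by apply: mulr_ge0 => //; exact: q.
have kT4_ge0 : 0 <= kT4 by apply: addr_ge0; [exact: q|exact: mulr_ge0].
have kd1_ge0 : 0 <= kd1 by exact: z.
have kd2_ge0 : 0 <= kd2 by exact: z.
have kd3_ge0 : 0 <= kd3 by exact: z.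
have kC_ge0 : 0 <= 3 / 2 * C * (rho1 c + rho3 c + rho4 c).
  by rewrite ltW// mulr_gt0 ?addr_gt0// mulr_gt0// divr_gt0.
have kP_ge0 : 0 <= P / 2 * (rho5 c * delta c / beta c).
  by rewrite ltW// mulr_gt0// divr_gt0.
exists (kT1 + kT2 + kT3 + kT4 + kd1 + kd2 + kd3 + 3 / 2 * C * (rho1 c + rho3 c + rho4 c) +
  P / 2 * (rho5 c * delta c / beta c)).
  by do 8! (apply: addr_ge0; last by []).
move=> U DU; set B := opB1 c tau1 tau2 tau3 U.
have HU := DB1_phase DU; have L i := phase_L2 i HU.
have Hh i := DB1_half DU i; have Sb i (hi : half_component i) := DB1_sobolev2 DU hi.
have [D1 D2 D3] := DB1_damping DU.
have LA : L2 l (lopA l (U ctheta)) by rewrite -lopAE; exact: (L2_opA eb (Sb _ h5)).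
have LS := (shear1_null_linear c_pos eb).1 U HU.
rewrite -mulrA (cross_theta_v c_pos eb DU).
have mul := multipliers c_pos eb DU.
have y1 := young_absorb a1 v1 LA (L cv).
have y2 := young_absorb a2 v2 LA (L cpsi).
have y3 := young_absorb a3 v3 (L ctheta) LS.
have y4 := young_absorb a4 ltr01 LA (L ctheta).
rewrite (rinnerC (L ctheta) LS) in y3.
have z1 := damping_cross l_gt0 eb t1 e1 D1 (Hh cphi).
have z2 := damping_cross l_gt0 eb t2 e2 D2 (Hh cy).
have z3 := damping_cross l_gt0 eb t3 e3 D3 (Hh cz).
have d1 := damping_coercive l_gt0 eb t1 D1.
have d2 := damping_coercive l_gt0 eb t2 D2.
have d3 := damping_coercive l_gt0 eb t3 D3.
have s1 : ip (D (U cphi)) (D (U cphi)) <= 2 * ip (shear1 c U) (shear1 c U) +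
  2 * P * ip (D (U cpsi)) (D (U cpsi)) := dx_shear (Hh cphi) (Hh cpsi).
have s2 : ip (D (U cy)) (D (U cy)) <= 2 * ip (shear2 c U) (shear2 c U) +
  2 * P * ip (D (U cz)) (D (U cz)) := dx_shear (Hh cy) (Hh cz).
have w1 := sobolev2_dx_bound (Sb _ h5) (Hh ctheta).
have w2 := half_poincare l_gt0 eb (Hh ctheta).
have w3 := half_poincare l_gt0 eb (Hh cpsi).
have T0 := rinner_ge0 l (lopA l (U ctheta)).
have nu0 := rinner_ge0 l (U cu); have ns0 := rinner_ge0 l (U cs).
have nw0 := rinner_ge0 l (U cw); have nv0 := rinner_ge0 l (U cv).
have F0 := rinner_ge0 l (shear1 c U); have G0 := rinner_ge0 l (shear2 c U).
have J0 := rinner_ge0 l (gap U).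
have pp0 := rinner_ge0 l (D (U cpsi)); have zz0 := rinner_ge0 l (D (U cz)).
have th0 := rinner_ge0 l (D (U ctheta)).
rewrite (energy_expand HU).
move: mul y1 y2 y3 y4 z1 z2 z3 d1 d2 d3 s1 s2 w1 w2 w3 T0 nu0 ns0 nw0 nv0 F0 G0 J0 pp0 zz0 th0.
move: x1 x2 x3 x4 x5; rewrite -/B -/kT1 -/kT2.
generalize (cross c cu cphi B U) (cross c cv cpsi B U) (cross c cs cy B U)
  (cross c cw cz B U).
generalize (ip (fpow l tau1 (U cu)) (U cu)) (ip (fpow l tau2 (U cs)) (U cs))
  (ip (fpow l tau3 (U cw)) (U cw)) (ip (lopA l (U ctheta)) (lopA l (U ctheta)))
  (ip (fpow l tau1 (U cu)) (U cphi)) (ip (fpow l tau2 (U cs)) (U cy))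
  (ip (fpow l tau3 (U cw)) (U cz)).
generalize (ip (lopA l (U ctheta)) (U cv)) (ip (lopA l (U ctheta)) (U cpsi))
  (ip (shear1 c U) (U ctheta)) (ip (lopA l (U ctheta)) (U ctheta)).
generalize (ip (U cu) (U cu)) (ip (U cv) (U cv)) (ip (U cs) (U cs)) (ip (U cw) (U cw))
  (ip (D (U cpsi)) (D (U cpsi))) (ip (D (U cz)) (D (U cz)))
  (ip (shear1 c U) (shear1 c U)) (ip (shear2 c U) (shear2 c U)) (ip (gap U) (gap U))
  (ip (D (U ctheta)) (D (U ctheta))).
generalize (ip (U cpsi) (U cpsi)) (ip (U ctheta) (U ctheta))
  (ip (D (U cphi)) (D (U cphi))) (ip (D (U cy)) (D (U cy))).
move=> npsi nth' dphi dy nu nv ns nw p z2 F G J th X1 X2 X3 X4.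
move=> d1 d2 d3 T Z1 Z2 Z3 c1 c2 c3 c4 x1 x2 x3 x4 x5.
move=> mul y1 y2 y3 y4 z1 z2' z3 q1 q2 q3 s1 s2 w1 w2 w3 T0 nu0 ns0 nw0 nv0 F0 G0 J0 pp0 zz0 th0.
have d1_ge0 : 0 <= d1 by rewrite -(pmulr_rge0 _ C0) (le_trans nu0).
have d2_ge0 : 0 <= d2 by rewrite -(pmulr_rge0 _ C0) (le_trans ns0).
have d3_ge0 : 0 <= d3 by rewrite -(pmulr_rge0 _ C0) (le_trans nw0).
have nth_le : nth' <= P * P * T.
  by rewrite -mulrA; apply: le_trans w2 _; rewrite ler_wpM2l// ltW.
have i2 : b1 c / (4 * P) * npsi <= b1 c / 4 * p.
  have := ler_wpM2l (ltW v2) w3.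
  have -> : b1 c / (4 * P) * (P * p) = b1 c / 4 * p by field; rewrite gt_eqF.
  by [].
have i3 : a3 ^+ 2 / (4 * (kappa1 c / 4)) * nth' <= kT3 * T.
  by rewrite /kT3 -[leRHS]mulrA; apply: ler_wpM2l => //; exact: q.
have i4 : a4 ^+ 2 / (4 * 1) * T + 1 * nth' <= kT4 * T.
  apply: (@le_trans _ _ (a4 ^+ 2 / (4 * 1) * T + 1 * (P * P * T))).
    by apply: lerD => //; exact: ler_wpM2l.
  by rewrite /kT4 [leRHS]mulrDl [1 * (P * P * T)]mulrA.
have j1 := cross_absorb g1 e1 C0 F0 pp0 z1 s1 x1 x2.
have j2 := cross_absorb g2 e2 C0 G0 zz0 z2' s2 x3 x4.
have j3 := cross_absorb_eq g3 z3 x5.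
have mb := congr1 ( *%R^~ nv) Mb; rewrite /= in mb.
set SS := d1 + d2 + d3 + T.
have S1 : d1 <= SS by rewrite /SS -!addrA lerDl !addr_ge0.
have S2 : d2 <= SS by rewrite /SS [d1 + d2]addrC -!addrA lerDl !addr_ge0.
have S3 : d3 <= SS by rewrite /SS addrAC lerDr !addr_ge0.
have S4 : T <= SS by rewrite /SS lerDr !addr_ge0.
have m1 := ler_wpM2l kT1_ge0 S4; have m2 := ler_wpM2l kT2_ge0 S4.
have m3 := ler_wpM2l kT3_ge0 S4; have m4 := ler_wpM2l kT4_ge0 S4.
have m5 := ler_wpM2l kd1_ge0 S1; have m6 := ler_wpM2l kd2_ge0 S2.
have m7 := ler_wpM2l kd3_ge0 S3.
have m8 : rho1 c * nu <= rho1 c * C * SS.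
  by rewrite -mulrA ler_wpM2l// ?(ltW r1)//; apply: le_trans q1 _; rewrite ler_wpM2l// ltW.
have m9 : rho3 c * ns <= rho3 c * C * SS.
  by rewrite -mulrA ler_wpM2l// ?(ltW r3)//; apply: le_trans q2 _; rewrite ler_wpM2l// ltW.
have m10 : rho4 c * nw <= rho4 c * C * SS.
  by rewrite -mulrA ler_wpM2l// ?(ltW r4)//; apply: le_trans q3 _; rewrite ler_wpM2l// ltW.
have m11 : rho5 c * delta c / beta c * th <= rho5 c * delta c / beta c * P * SS.
  rewrite -[leRHS]mulrA; apply: ler_wpM2l; first exact: ltW.
  by apply: le_trans w1 _; apply: ler_wpM2l => //; exact: ltW.
have n1 := mulr_ge0 (ltW k2) G0; have n2 := mulr_ge0 (ltW j) J0.
exact: (multiplier_arith mul y1 y2 y3 y4 i2 i3 i4 j1 j2 j3 mb m1 m2 m3 m4 m5 m6 m7 m8 m9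
  m10 m11 n1 n2).
Qed.

End Stability.

(** * Density of the domain by spectral truncation *)

Section Density.
Context (R : realType) (c : params R) (e : nat -> R -> R[i]) (lam : nat -> R).
Local Notation l := (len c).
Hypotheses (c_pos : params_pos c) (eb : eigenbasis l e lam).
Implicit Types (U V W : state R) (f g : R -> R[i]).
Local Notation H := (phase_space c).
Local Notation ip := (rinner l).
Local Notation D f := (wdx l f).
Local Notation half f := (fpow l (1 / 2) f).
Local Notation E U := (energy_form c U U).

Let l_gt0 : 0 < l. Proof. by case: c_pos. Qed.

Let h1 : half_component cphi := isT.
Let h2 : half_component cpsi := isT.
Let h3 : half_component cy := isT.
Let h4 : half_component cz := isT.
Let h5 : half_component ctheta := isT.

(** The weights of [kappa1], [kappa2] and [jm] are multiplied by 4 because they go with differences,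
    where [|f - g|^2 <= (2 * eta) ^ 2]. *)
Definition energy_weight : R :=
  rho1 c + rho2 c + rho3 c + rho4 c + b1 c + b2 c + 4 * kappa1 c + 4 * kappa2 c +
  4 * jm c + rho5 c * delta c / beta c.

Lemma energy_small U (eta : R) : H U -> 0 < eta ->
  (forall i, l2norm l (U i) < eta) ->
  (forall i, half_component i -> l2norm l (half (U i)) < eta) ->
  E U <= energy_weight * eta ^+ 2.
Proof.
move=> HU eta0 s sh.
have [_ [[r1 r2 r3 r4 r5] [[k1 k2 p1 p2 j] [_ [d b K]]]]] := c_pos.
have r6 : 0 < rho5 c * delta c / beta c by rewrite divr_gt0// mulr_gt0.
have L i := phase_L2 i HU.
have sq f (t : R) : 0 <= t -> l2norm l f <= t -> ip f f <= t ^+ 2.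
  by move=> t0 ft; rewrite -l2norm_sqr ler_sqr ?nnegrE ?l2norm_ge0.
have eta1 := ltW eta0.
have s1 i : ip (U i) (U i) <= eta ^+ 2 by apply: sq => //; exact: ltW.
have s2 i (hi : half_component i) : ip (half (U i)) (half (U i)) <= eta ^+ 2.
  by apply: sq => //; exact: ltW (sh i hi).
have sD i (hi : half_component i) : l2norm l (D (U i)) <= eta.
  rewrite l2normE (half_rinner l_gt0 eb (phase_half HU hi) (phase_half HU hi)) -l2normE.
  exact: ltW (sh i hi).
have LD i (hi : half_component i) := L2_half_dx l_gt0 eb (phase_half HU hi).
have e2 : 0 <= 2 * eta by rewrite mulr_ge0.
have diff f g : L2 l f -> L2 l g -> l2norm l f <= eta -> l2norm l g <= eta ->
    ip (f - g) (f - g) <= 4 * eta ^+ 2.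
  move=> Lf Lg nf ng; have -> : 4 * eta ^+ 2 = (2 * eta) ^+ 2 by ring.
  apply: sq => //; apply: le_trans (l2norm_triangle Lf (L2N Lg)) _.
  by rewrite (l2normN Lg) mulr_natl mulr2n lerD.
have sn i := ltW (s i).
have d1 : ip (shear1 c U) (shear1 c U) <= 4 * eta ^+ 2 :=
  diff _ _ (LD _ h1) (L cpsi) (sD _ h1) (sn cpsi).
have d2 : ip (shear2 c U) (shear2 c U) <= 4 * eta ^+ 2 :=
  diff _ _ (LD _ h3) (L cz) (sD _ h3) (sn cz).
have d3 : ip (gap U) (gap U) <= 4 * eta ^+ 2 := diff _ _ (L cy) (L cphi) (sn cy) (sn cphi).
rewrite /energy_form /energy_weight.
have m4 (a x : R) : 0 < a -> x <= 4 * eta ^+ 2 -> a * x <= 4 * a * eta ^+ 2.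
  by move=> a0 hx; rewrite [4 * a]mulrC -mulrA; apply: ler_wpM2l => //; exact: ltW.
have m1 (a x : R) : 0 < a -> x <= eta ^+ 2 -> a * x <= a * eta ^+ 2.
  by move=> a0 hx; apply: ler_wpM2l => //; exact: ltW.
apply: le_trans (lerD (lerD (lerD (lerD (lerD (lerD (lerD (lerD (lerD
  (m1 _ _ r1 (s1 cu)) (m1 _ _ r2 (s1 cv))) (m1 _ _ r3 (s1 cs))) (m1 _ _ r4 (s1 cw)))
  (m1 _ _ p1 (s2 _ h2))) (m1 _ _ p2 (s2 _ h4))) (m4 _ _ k1 d1)) (m4 _ _ k2 d2))
  (m4 _ _ j d3)) (m1 _ _ r6 (s2 _ h5))) _.
by rewrite le_eqVlt; apply/orP; left; apply/eqP; ring.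
Qed.

Definition truncation U N : state R := fun i => psum l e (U i) N.

Lemma truncation_approx U (eta : R) : H U -> 0 < eta ->
  exists N, (forall i, l2norm l (U i - truncation U N i) < eta) /\
    (forall i, half_component i -> l2norm l (half (U i - truncation U N i)) < eta).
Proof.
move=> HU eta0.
have h i : exists N0, forall N, (N0 <= N)%N ->
    l2norm l (U i - truncation U N i) < eta /\
    (half_component i -> l2norm l (half (U i - truncation U N i)) < eta).
  case hi : (half_component i).
    have [N0 hN] := half_psum_approx l_gt0 eb (phase_half HU hi) eta0.
    by exists N0 => N NN; have [a b] := hN N NN; split.
  have [N0 hN] := psum_approx eb (phase_L2 i HU) eta0.
  by exists N0 => N NN; split => //; exact: hN.
have [m hm] := choice h.
(* A sum serves as a common upper bound of the nine ranks. *)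
pose N := (m cphi + (m cu + (m cpsi + (m cv + (m cy + (m cs + (m cz + (m cw + m ctheta))))))))%N.
have le i : (m i <= N)%N.
  rewrite /N; case: i; do ?[exact: leq_addr|exact: leqnn|apply: leq_trans (leq_addl _ _)].
exists N; split=> i; first exact: (hm i N (le i)).1.
exact: (hm i N (le i)).2.
Qed.

(** Finite combinations of the [e n] lie in every D(A^s) and are stable under A, so all clauses hold
    whatever the exponents, including the one on [opB1]. *)
Lemma truncation_DB1 tau1 tau2 tau3 U N : DB1 c tau1 tau2 tau3 (truncation U N).
Proof.
pose T := truncation U N.
have Hs s i : DpowA l s (T i) := DpowA_psum eb s (U i) N.
have Hh := Hs (1 / 2).
have L i : L2 l (T i) := DpowA_L2 (Hh i).
have Da i : DA l (T i) := DA_psum l_gt0 eb (U i) N.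
have LA i : L2 l (opA l (T i)) := DA_L2_opA eb (Da i).
have LD i : L2 l (dx l (T i)).
  by have := L2_half_dx l_gt0 eb (Hh i); rewrite -wdxE.
have LP s i : L2 l (powA l s (T i)).
  by rewrite fpowE; exact: (L2_powA (Hs s i)).
have HT : H T by apply/phase_spaceP => i; case: half_component; [exact: Hh|exact: L].
have Z (a : R) f : L2 l f -> L2 l (a%:C *: f) by exact: L2Z.
split; first exact: HT.
split; first by split; exact: Hh.
split.
  split; first by split; [exact: Hh|exact: (sobolev3_psum eb)].
  - by split; [exact: Da|exact: Hs].
  - exact: Da.
  - by split; [exact: Da|exact: Hs].
  - by split; [exact: Da|exact: Hs].
split; first by split; exact: Hs.
apply/phase_spaceP => i; case: i.
- exact: Hh.
- exact: (L2B (L2D (L2B (L2N (Z _ _ (LA cphi))) (Z _ _ (LD cpsi)))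
    (Z _ _ (L2B (L cy) (L cphi)))) (Z _ _ (LP tau1 cu))).
- exact: Hh.
- exact: (L2D (L2D (L2N (Z _ _ (LA cpsi))) (Z _ _ (L2B (LD cphi) (L cpsi))))
    (Z _ _ (LA ctheta))).
- exact: Hh.
- exact: (L2B (L2B (L2B (L2N (Z _ _ (LA cy))) (Z _ _ (LD cz)))
    (Z _ _ (L2B (L cy) (L cphi)))) (Z _ _ (LP tau2 cs))).
- exact: Hh.
- exact: (L2B (L2D (L2N (Z _ _ (LA cz))) (Z _ _ (L2B (LD cy) (L cz))))
    (Z _ _ (LP tau3 cw))).
- have S := DpowA_subspace l_gt0 eb (1 / 2).
  have A1 := subspaceZ S (K c / rho5 c)%:C (DpowA_opA_psum l_gt0 eb (1 / 2) (U ctheta) N).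
  have A2 := subspaceZ S (beta c / rho5 c)%:C (Hh cv).
  have A0 := subspaceB S S.1 A1; rewrite sub0r in A0.
  exact: (subspaceB S A0 A2).
Qed.

Lemma DB1_dense tau1 tau2 tau3 U (eps : R) : H U -> 0 < eps ->
  exists2 W, DB1 c tau1 tau2 tau3 W & phase_norm c (U - W) < eps.
Proof.
move=> HU eps0.
have [_ [[r1 r2 r3 r4 r5] [[k1 k2 p1 p2 j] [_ [d b K]]]]] := c_pos.
have r6 : 0 < rho5 c * delta c / beta c by rewrite divr_gt0// mulr_gt0.
have w0 : 0 < energy_weight.
  by rewrite /energy_weight !addr_gt0// mulr_gt0.
have d0 : 0 < energy_weight + 1 by rewrite addr_gt0.
(* For this value of [eta] and [w = energy_weight], [w * eta ^ 2 < eps ^ 2] because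
   [w < (w + 1) ^ 2]. *)
have eta0 : 0 < eps / (energy_weight + 1) by rewrite divr_gt0.
have [N [s sh]] := truncation_approx HU eta0.
have DT := truncation_DB1 tau1 tau2 tau3 U N.
exists (truncation U N) => //.
have HT := DB1_phase DT.
have Hd := subspaceB (phase_subspace c_pos eb) HU HT.
have small := energy_small Hd eta0 s sh.
rewrite phase_normE -[ltRHS](ger0_norm (ltW eps0)) -sqrtr_sqr ltr_sqrt ?exprn_gt0//.
apply: le_lt_trans small _.
rewrite expr_div_n mulrA ltr_pdivrMr ?exprn_gt0// mulrC ltr_pM2l ?exprn_gt0//.
by move: w0; generalize energy_weight => x x0; nra.
Qed.

End Density.

(** * Choice of the weights and of the decay rate *)

Theorem theorem9 (R : realType) (c : params R) (tau1 tau2 tau3 : R)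
    (S1 : R -> state R -> state R) :
  params_pos c ->
  0 <= tau1 <= 1 -> 0 <= tau2 <= 1 -> 0 <= tau3 <= 1 ->
  contraction_semigroup (phase_space c) (phase_norm c) S1 ->
  generated_by (phase_space c) (phase_norm c)
    (DB1 c tau1 tau2 tau3) (opB1 c tau1 tau2 tau3) S1 ->
  exists M omega : R, [/\ 1 <= M, 0 < omega &
    forall t : R, 0 <= t ->
      (opnorm (phase_space c) (phase_norm c) (S1 t)
         <= (M * expR (- (omega * t)))%:E)%E].
Proof.
move=> c_pos t1 t2 t3 semi gen.
(* An element of the phase space carries an eigenbasis in its membership; without any element the
   supremum defining [opnorm] is over the empty set. *)
have [[U0 HU0]|noU] := pselect (exists U, phase_space c U); last first.
  exists 1, 1; split => // t _; apply: ge_ereal_sup => y [x [Hx _] _].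
  by case: noU; exists x.
have [e [lam eb]] : exists e lam, eigenbasis (len c) e lam.
  have [[D0 _ _ _] _] := HU0; case: D0 => g [_ _ [e [lam [eb _]]]].
  by exists e, lam.
have [_ [[r1 r2 r3 r4 r5] [[k1 k2 p1 p2 j] [[g1 g2 g3] [dl bt Kp]]]]] := c_pos.
pose M := 2 * rho2 c / beta c.
have M0 : 0 <= M by rewrite divr_ge0 ?mulr_ge0// ltW.
have Mb : M * beta c = 2 * rho2 c by rewrite /M divfK// gt_eqF.
have [K1 K10 mul] := multiplier_bound c_pos eb t1 t2 t3 Mb.
have l_gt0 : 0 < len c by case: c_pos.
have C0 := lt_le_trans ltr01 (spectral_const_ge1 (len c)).
have [cc cc0 cb] : exists2 cc : R, 0 <= cc & forall U, phase_space c U ->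
    `|M * rho5 c * cross c ctheta cv U U + rho1 c * cross c cu cphi U U +
      rho2 c * cross c cv cpsi U U + rho3 c * cross c cs cy U U +
      rho4 c * cross c cw cz U U| <= cc * energy_form c U U.
  exists `|cross_const c M| => [|U HU]; first exact: normr_ge0.
  apply: le_trans (cross_bound c_pos eb M0 HU) _.
  by rewrite ler_wpM2r ?(energy_form_ge0 c_pos U)// ler_norm.
pose kT := K c * delta c / beta c.
have kT0 : 0 < kT by rewrite divr_gt0// mulr_gt0.
(* The part [cc + 1] lets the energy dominate the cross terms with margin one, whence the lower
   constant 1 for the form; each quotient makes [N] times one dissipation coefficient exceed
   [K1]. *)
pose N := cc + 1 + (K1 / gamma1 c + K1 / gamma2 c + K1 / gamma3 c + K1 / kT).
have q1 : 0 <= K1 / gamma1 c by rewrite divr_ge0// ltW.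
have q2 : 0 <= K1 / gamma2 c by rewrite divr_ge0// ltW.
have q3 : 0 <= K1 / gamma3 c by rewrite divr_ge0// ltW.
have q4 : 0 <= K1 / kT by rewrite divr_ge0// ltW.
have aux (x : R) : 0 < x -> K1 / x <= N -> K1 <= N * x.
  by move=> x0; rewrite ler_pdivrMr.
have N1 : K1 <= N * gamma1 c by apply: aux => //; rewrite /N; clear -cc0 q1 q2 q3 q4; lra.
have N2 : K1 <= N * gamma2 c by apply: aux => //; rewrite /N; clear -cc0 q1 q2 q3 q4; lra.
have N3 : K1 <= N * gamma3 c by apply: aux => //; rewrite /N; clear -cc0 q1 q2 q3 q4; lra.
have N4 : K1 <= N * kT by apply: aux => //; rewrite /N; clear -cc0 q1 q2 q3 q4; lra.
have Ncc : cc + 1 <= N by rewrite /N lerDl !addr_ge0.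
clearbody N.
have split_form U V : lyapunov_form c N M U V = N * energy_form c U V +
    (M * rho5 c * cross c ctheta cv U V + rho1 c * cross c cu cphi U V +
     rho2 c * cross c cv cpsi U V + rho3 c * cross c cs cy U V +
     rho4 c * cross c cw cz U V) by rewrite /lyapunov_form; ring.
have subH := phase_subspace c_pos eb.
have Nc0 : 0 < N + cc by rewrite ltr_wpDr// (lt_le_trans _ Ncc)// ltr_wpDl.
(* With [E] the energy, the form is at most [(N + cc) * E] and its dissipation is at least [E / 2],
   whence the rate [(2 * (N + cc))^-1]. *)
apply: (@lyapunov_exponential_stability R (state R) (phase_space c) (DB1 c tau1 tau2 tau3)
  (energy_form c) (lyapunov_form c N M) (phase_norm c) (opB1 c tau1 tau2 tau3) S1
  1 (N + cc) (2 * (N + cc))^-1 subH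
  (energy_form_sym c_pos eb) (lyapunov_form_sym c_pos eb N M)).
- exact: phase_normE.
- by move=> U _; exact: energy_form_ge0.
- exact: ltr01.
- exact: Nc0.
- by rewrite invr_gt0 mulr_gt0.
- move=> U HU; rewrite mul1r split_form.
  have := cb U HU; rewrite ler_norml => /andP[+ _].
  have := ler_wpM2r (energy_form_ge0 c_pos U) Ncc.
  by generalize (energy_form c U U) cc N (M * rho5 c * cross c ctheta cv U U +
    rho1 c * cross c cu cphi U U + rho2 c * cross c cv cpsi U U +
    rho3 c * cross c cs cy U U + rho4 c * cross c cw cz U U) => En y N' x; clear; lra.
- move=> U HU; rewrite split_form [leRHS]mulrDl lerD2l.
  by have := cb U HU; rewrite ler_norml => /andP[_].
- by move=> U DU; split; [exact: DB1_phase DU|exact: opB1_phase DU].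
- by move=> U eps HU; exact: (DB1_dense c_pos eb).
- move=> U DU; have HU := DB1_phase DU.
  have up : lyapunov_form c N M U U <= (N + cc) * energy_form c U U.
    rewrite split_form [leRHS]mulrDl lerD2l.
    by have := cb U HU; rewrite ler_norml => /andP[_].
  apply: (@le_trans _ _ (- energy_form c U U / 2)); last first.
    have Z : 0 <= (2 * (N + cc))^-1 by rewrite invr_ge0 mulr_ge0// ltW.
    have := ler_wpM2l Z up.
    have -> : (2 * (N + cc))^-1 * ((N + cc) * energy_form c U U) =
      energy_form c U U / 2 by field; rewrite gt_eqF.
    by rewrite !mulNr lerN2.
  rewrite split_form (energy_dissipation c_pos eb DU).
  have := mul U DU.
  have [D1 D2 D3] := DB1_damping DU.
  have a1 := damping_coercive l_gt0 eb t1 D1.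
  have a2 := damping_coercive l_gt0 eb t2 D2.
  have a3 := damping_coercive l_gt0 eb t3 D3.
  have d1 : 0 <= rinner (len c) (fpow (len c) tau1 (U cu)) (U cu).
    by rewrite -(pmulr_rge0 _ C0) (le_trans _ a1)// rinner_ge0.
  have d2 : 0 <= rinner (len c) (fpow (len c) tau2 (U cs)) (U cs).
    by rewrite -(pmulr_rge0 _ C0) (le_trans _ a2)// rinner_ge0.
  have d3 : 0 <= rinner (len c) (fpow (len c) tau3 (U cw)) (U cw).
    by rewrite -(pmulr_rge0 _ C0) (le_trans _ a3)// rinner_ge0.
  have d4 := rinner_ge0 (len c) (lopA (len c) (U ctheta)).
  have := ler_wpM2r d1 N1; have := ler_wpM2r d2 N2.
  have := ler_wpM2r d3 N3; have := ler_wpM2r d4 N4.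
  rewrite -/kT; generalize N kT (energy_form c U U) => N' kT' En.
  move: (_ + rho4 c * _) => X.
  move: (rinner _ (fpow _ tau1 _) _) (rinner _ (fpow _ tau2 _) _)
    (rinner _ (fpow _ tau3 _) _) (rinner _ (lopA _ _) _) => x1 x2 x3 x4; lra.
- exact: semi.
- exact: gen.
Qed.
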